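(* Let $0<q<1$, $t>0$, and let $a_1,\dots,a_N,b_1,\dots,b_M>0$ with $a_ib_j<1$ for all $i,j$. Let $\mu$ be a random partition with law $M_{qW}$, $\lambda$ a random partition with law $M_{pS}$, and let $\chi$, $S$ be random variables independent of $\mu$, $\lambda$ and of each other, with the laws given below. Then for every $n\in\mathbb{Z}_{\ge 0}$: (a) $\mathbb{P}(\mu_1+\chi\le n)=\mathbb{P}(\lambda_1\le n)$; (b) $\mathbb{E}\big[1/(-t q^{\frac12+n-\mu_1};q)_\infty\big]=\mathbb{P}(\lambda_1+S\le n)$. Moreover (a) and (b) are equivalent.
   Context: Notation: $(x;q)_\infty=\prod_{j\ge0}(1-xq^j)$, $(x;q)_n=(x;q)_\infty/(xq^n;q)_\infty$, $\theta(x)=(x;q)_\infty(q/x;q)_\infty$. $\mathcal{P}$ is the set of integer partitions, $|\rho|=\sum\rho_i$, $\rho\subset\lambda$ means $\rho_i\le\lambda_i$ for all $i$. $P_\mu$ is the $q$-Whittaker polynomial (Macdonald $P_\mu(\cdot;q,t)$ at $t=0$), $Q_\mu=\prod_{j\ge1}(q;q)^{-1}_{\mu_j-\mu_{j+1}}P_\mu$, and $s_{\lambda/\rho}$ is the skew Schur polynomial. The $q$-Whittaker measure is $M_{qW}(\mu)=P_\mu(a_1,\dots,a_N)Q_\mu(b_1,\dots,b_M)\prod_{i,j}(a_ib_j;q)_\infty$. The periodic Schur measure is $M_{pS}(\lambda)=(q;q)_\infty\prod_{i,j}(a_ib_j;q)_\infty\sum_{\rho\subset\lambda}q^{|\rho|}s_{\lambda/\rho}(a_1,\dots,a_N)s_{\lambda/\rho}(b_1,\dots,b_M)$.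 $\chi$ takes values in $\mathbb{Z}_{\ge0}$ with $\mathbb{P}(\chi=n)=\frac{q^n}{(q;q)_n}(q;q)_\infty$. $S$ takes values in $\mathbb{Z}$ with $\mathbb{P}(S=\ell)=\frac{t^\ell q^{\ell^2/2}}{(q;q)_\infty\,\theta(-tq^{1/2})}$. *)

(* Defs.v *)
From HB Require Import structures.
From mathcomp Require Import all_boot all_order all_algebra.
From mathcomp Require Import all_classical all_reals all_analysis.
Set Implicit Arguments. Unset Strict Implicit. Unset Printing Implicit Defensive.
Import Order.TTheory GRing.Theory Num.Theory numFieldNormedType.Exports.
Local Open Scope ring_scope.

Definition qpoch {R : realType} (x q : R) (n : nat) : R :=
  \prod_(j < n) (1 - x * q ^+ j).
Definition qpinf {R : realType} (x q : R) : R := limn (qpoch x q).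
Definition qtheta {R : realType} (q x : R) : R := qpinf x q * qpinf (q / x) q.

(* A partition is a weakly decreasing sequence of positive integers;
   lam_1 = head 0 lam, |lam| = sumn lam, lam_i = nth 0 lam (i-1). *)
Definition is_part (s : seq nat) : bool :=
  sorted (fun a b => b <= a)%N s && all (fun x => 0 < x)%N s.

(* all sequences of length <= k with entries in [0, m] (each exactly once) *)
Fixpoint box_seqs (k m : nat) : seq (seq nat) :=
  match k with
  | 0 => [:: [::]]
  | k'.+1 => [::] :: [seq x :: s | x <- iota 0 m.+1, s <- box_seqs k' m]
  end.

Definition interlace (mu lam : seq nat) : bool :=
  all (fun i => nth 0 lam i.+1 <= nth 0 mu i <= nth 0 lam i)%N
      (iota 0 (size lam).+1).

Definition subpart (rho lam : seq nat) : bool :=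
  all (fun i => nth 0 rho i <= nth 0 lam i)%N (iota 0 (size rho)).

(* Every partition mu with mu < lam (interlacing) or mu \subset lam lies in
   box_seqs (size lam) (head 0 lam); sums below range over these. *)

(* ---------- q-Whittaker polynomials (Macdonald P at t = 0) ---------- *)
(* psi_{lam/mu}(q) at t = 0 : prod_i [lam_i - lam_{i+1} choose lam_i - mu_i]_q *)
Definition psiW {R : realType} (q : R) (lam mu : seq nat) : R :=
  \prod_(i < size lam)
    (qpoch q q (nth 0 lam i - nth 0 lam i.+1) /
     (qpoch q q (nth 0 lam i - nth 0 mu i) *
      qpoch q q (nth 0 mu i - nth 0 lam i.+1))).

(* branching (tableau) formula, variables listed in reverse order x_N, ..., x_1:
   P_lam(x_1..x_N) = sum_{mu < lam} psi_{lam/mu} x_N^{|lam|-|mu|} P_mu(x_1..x_{N-1}) *)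
Fixpoint qWP_rev {R : realType} (q : R) (xr : seq R) (lam : seq nat) : R :=
  match xr with
  | [::] => (lam == [::])%:R
  | xN :: xs =>
      \sum_(mu <- box_seqs (size lam) (head 0%N lam) | is_part mu && interlace mu lam)
        psiW q lam mu * xN ^+ (sumn lam - sumn mu) * qWP_rev q xs mu
  end.

Definition qWP {R : realType} (q : R) (x : seq R) (lam : seq nat) : R :=
  qWP_rev q (rev x) lam.

Definition qWQ {R : realType} (q : R) (x : seq R) (mu : seq nat) : R :=
  (\prod_(j < size mu) qpoch q q (nth 0 mu j - nth 0 mu j.+1))^-1 * qWP q x mu.

(* s_{lam/rho}(x_1..x_N) = sum over rho = l^0 < l^1 < ... < l^N = lam of
   prod_i x_i^{|l^i| - |l^{i-1}|}  (semistandard tableaux of shape lam/rho) *)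
Fixpoint skewS_rev {R : realType} (xr : seq R) (lam rho : seq nat) : R :=
  match xr with
  | [::] => (lam == rho)%:R
  | xN :: xs =>
      \sum_(mu <- box_seqs (size lam) (head 0%N lam) | is_part mu && interlace mu lam)
        xN ^+ (sumn lam - sumn mu) * skewS_rev xs mu rho
  end.

Definition skewS {R : realType} (x : seq R) (lam rho : seq nat) : R :=
  skewS_rev (rev x) lam rho.

Definition cauchy_prod {R : realType} (q : R) (a b : seq R) : R :=
  \prod_(x <- a) \prod_(y <- b) qpinf (x * y) q.

Definition MqW {R : realType} (q : R) (a b : seq R) (mu : seq nat) : R :=
  qWP q a mu * qWQ q b mu * cauchy_prod q a b.

Definition MpS {R : realType} (q : R) (a b : seq R) (lam : seq nat) : R :=
  qpinf q q * cauchy_prod q a b *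
  \sum_(rho <- box_seqs (size lam) (head 0%N lam) | is_part rho && subpart rho lam)
     q ^+ sumn rho * skewS a lam rho * skewS b lam rho.

Definition Pchi {R : realType} (q : R) (k : nat) : R :=
  q ^+ k / qpoch q q k * qpinf q q.

Definition PS {R : realType} (q t : R) (l : int) : R :=
  t ^ l * Num.sqrt q ^+ (`|l| ^ 2)%N / (qpinf q q * qtheta q (- t * Num.sqrt q)).

(* ---------- the events (sums of the joint laws of independent variables) ---------- *)
Local Open Scope ereal_scope.

Definition probA_qW {R : realType} (q : R) (a b : seq R) (n : nat) : \bar R :=
  \esum_(p in [set p : seq nat * nat | is_part p.1 && (head 0 p.1 + p.2 <= n)%N])
     (MqW q a b p.1 * Pchi q p.2)%:E.

Definition probA_pS {R : realType} (q : R) (a b : seq R) (n : nat) : \bar R :=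
  \esum_(l in [set l : seq nat | is_part l && (head 0 l <= n)%N])
     (MpS q a b l)%:E.

Definition expB_qW {R : realType} (q t : R) (a b : seq R) (n : nat) : \bar R :=
  \esum_(m in [set m : seq nat | is_part m])
     (MqW q a b m *
      (qpinf (- t * (Num.sqrt q * q ^ (n%:Z - (head 0 m)%:Z))) q)^-1)%:E.

Definition probB_pS {R : realType} (q t : R) (a b : seq R) (n : nat) : \bar R :=
  \esum_(p in [set p : seq nat * int | is_part p.1 && ((head 0 p.1)%:Z + p.2 <= n%:Z)%R])
     (MpS q a b p.1 * PS q t p.2)%:E.

(* Main.v *)
Require Import Defs.
From HB Require Import structures.
From mathcomp Require Import all_boot all_order all_algebra.
From mathcomp Require Import all_classical all_reals all_analysis.
From mathcomp Require Import perm complex separable cyclotomic cyclic ring lra zify.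
Set Implicit Arguments. Unset Strict Implicit. Unset Printing Implicit Defensive.
Import Order.TTheory GRing.Theory Num.Theory numFieldNormedType.Exports.
Local Open Scope classical_set_scope.
Local Open Scope ring_scope.

(* Fix n and encode a partition mu with mu_1 <= n by its n column lengths, read as
   the exponents of a monomial in x_1, ..., x_n. A linear functional on Laurent
   polynomials that kills (y - q x)(x^i y^j + x^j y^i) in adjacent variables x, y
   turns multiplication by prod_j (1 + a x_j) into the branching rule of the
   q-Whittaker polynomials. Applied to the constant term of x^v prod_(i<j)
   (1 - x_i/x_j) / (1 - q x_i/x_j), this writes the sum of P_mu(a) Q_mu(b) /
   (q;q)_(n - mu_1) over mu_1 <= n as the constant term of prod (1 + a x_j)(1 + b/x_j)
   times that kernel. At q = 0 the antisymmetrised coefficient functionals have the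
   same property and yield the sums of s_(lam/rho)(a) s_(lam/rho)(b) over lam_1 <= n.
   Symmetrising the kernel gives the Cauchy determinant det (1 / (1 - q x_i/x_j)), whose
   expansion is the sum over rho of q^|rho| times the latter functionals; this is (a).
   Constant terms are realised as averages over L-th roots of unity, with L -> oo, so
   no contour integrals are needed.
   For (b), Euler's identity and the quasi-periodicity of theta show that chi + S has
   distribution function m |-> 1 / (- t q^(1/2 + m); q)_oo, so that by (a) both sides
   are P(mu_1 + chi + S <= n). *)

(** * Functionals on exponent vectors and the branching rule *)

(** A factor 1 + a x_j raises each column by 0 or 1, which adds a horizontal strip. Within a block
    of equal columns the straightening relation makes the shifts q-commute, and the q-binomial
    theorem produces the branching weights. The (q;q) factors of the block lengths telescope along a
    chain of partitions, and the block of zero columns has length n - mu_1: this is where 1 /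
    (q;q)_(n - mu_1), hence chi, comes from. The obstacle is that an average over L-th roots of
    unity sees exponents only modulo L. Upward branching and the determinant identity are exact for
    every L, but downward branching needs the functional to vanish on vectors with a negative last
    entry, and coefficients modulo L have to be replaced by true ones; both hold only up to an error
    of order q^(L/2). The exponent is halved because one factor q^(1/2) per unit of degree pays for
    the wrap-around and the other one keeps the sums bounded. *)

Section ShiftOperators.
Variable R : comNzRingType.
Implicit Types (D : seq int -> R) (v l r : seq int).

(* Reading D as the linear functional x^v |-> D v, Ex al be d D is
   D precomposed with multiplication by prod_j x_j^d (be + al x_j). *)
Fixpoint Ex (al be : R) (d : int) (D : seq int -> R) (v : seq int) : R :=
  if v is c :: v' then
    al * Ex al be d (fun l => D (c + d + 1 :: l)) v'
    + be * Ex al be d (fun l => D (c + d :: l)) v'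
  else D [::].

Definition inc (v : seq int) := [seq c + 1 | c <- v].

Lemma eq_Ex al be d D D' v : D =1 D' -> Ex al be d D v = Ex al be d D' v.
Proof.
elim: v D D' => [|c v IH] D D' e /=; first exact: e.
by congr (_ * _ + _ * _); apply: IH => l; apply: e.
Qed.

Lemma Ex_add al be d D D' v :
  Ex al be d (fun l => D l + D' l) v = Ex al be d D v + Ex al be d D' v.
Proof. by elim: v D D' => [|c v IH] D D' //=; rewrite !IH; ring. Qed.

Lemma Ex_scale al be d k D v :
  Ex al be d (fun l => k * D l) v = k * Ex al be d D v.
Proof. by elim: v D => [|c v IH] D //=; rewrite !IH; ring. Qed.

Lemma Ex_cat al be d D u v :
  Ex al be d D (u ++ v) =
  Ex al be d (fun u' => Ex al be d (fun v' => D (u' ++ v')) v) u.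
Proof. by elim: u D => [|c u IH] D //=; rewrite !IH. Qed.

Lemma Ex_inc al be d D v :
  Ex al be d D (inc v) = Ex al be d (fun l => D (inc l)) v.
Proof.
elim: v D => [|c v IH] D //=; rewrite !IH.
by congr (_ * _ + _ * _); apply: eq_Ex => l /=; congr (D (_ :: _)); ring.
Qed.

(* D kills (y - q x)(x^a y^b + x^b y^a) in any two adjacent variables x, y. *)
Definition straight (q : R) D := forall l a b r,
  D (l ++ a :: b + 1 :: r) + D (l ++ b :: a + 1 :: r) =
  q * (D (l ++ a + 1 :: b :: r) + D (l ++ b + 1 :: a :: r)).

Lemma straight_catl q D l : straight q D -> straight q (fun v => D (l ++ v)).
Proof. by move=> s l' a b r; rewrite !catA s. Qed.

Lemma straight_catr q D r : straight q D -> straight q (fun v => D (v ++ r)).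
Proof. by move=> s l a b r'; rewrite -!catA s. Qed.

Lemma straight_inc q D : straight q D -> straight q (fun v => D (inc v)).
Proof. by move=> s l a b r; rewrite /inc !map_cat /= s. Qed.

(** The factor (be + al x)(be + al y) is symmetric in two adjacent variables, so it maps a killed
    generator to a combination of killed generators: be^2 keeps (a, b), al be raises either index,
    al^2 raises both. *)
Lemma straight_Ex q al be d D : straight q D -> straight q (Ex al be d D).
Proof.
move=> sD l; elim: l D sD => [|c l IH] D sD a b r /=; last first.
  have s1 x := straight_catl [:: x] sD.
  have := IH _ (s1 (c + d + 1)) a b r; have := IH _ (s1 (c + d)) a b r => /=.
  set A1 := Ex _ _ _ _ _; set A2 := Ex _ _ _ _ _.
  set A3 := Ex _ _ _ _ _; set A4 := Ex _ _ _ _ _ => e1.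
  set B1 := Ex _ _ _ _ _; set B2 := Ex _ _ _ _ _.
  set B3 := Ex _ _ _ _ _; set B4 := Ex _ _ _ _ _ => e2.
  transitivity (al * (B1 + B2) + be * (A1 + A2)); first by ring.
  by rewrite e1 e2; ring.
pose X u w := Ex al be d (fun l => D [:: u, w & l]) r.
pose gen x y := X x (y + 1) + X y (x + 1) - q * (X (x + 1) y + X (y + 1) x).
have gen0 x y : gen x y = 0.
  apply/eqP; rewrite subr_eq0 -!Ex_add -Ex_scale; apply/eqP.
  by apply: eq_Ex => w; exact: (sD [::]).
rewrite -!/(X _ _) !(addrAC _ 1 d).
apply/eqP; rewrite -subr_eq0; apply/eqP.
transitivity (al * be * gen (a + d) (b + d + 1) + al * be * gen (a + d + 1) (b + d)
  + be * be * gen (a + d) (b + d) + al * al * gen (a + d + 1) (b + d + 1)).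
  by rewrite /gen; ring.
by rewrite !gen0 !mulr0 !addr0.
Qed.

(* Multiplication by prod_j (1 + a x_j), resp. by prod_j (1 + b / x_j). *)
Fixpoint ExU (xs : seq R) D : seq int -> R :=
  if xs is x :: xs' then ExU xs' (Ex x 1 0 D) else D.

Fixpoint ExD (xs : seq R) D : seq int -> R :=
  if xs is x :: xs' then Ex 1 x (-1) (ExD xs' D) else D.

Lemma straight_ExD q xs D : straight q D -> straight q (ExD xs D).
Proof. by move=> sD; elim: xs => //= x xs; exact: straight_Ex. Qed.

(** Each factor moves an exponent by at most one, so two functionals only need to agree near the
    point of evaluation. This is what later compares coefficients modulo L with true
    coefficients. *)
Definition near_seq (c : nat) (v w : seq int) :=
  all2 (fun a b : int => `|a - b| <= c)%N v w.

Lemma near_seq_refl c v : near_seq c v v.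
Proof. by elim: v => //= a v ->; rewrite subrr. Qed.

Lemma near_seq_size c v w : near_seq c v w -> size v = size w.
Proof. by elim: v w => [|a v IH] [|b w] //= /andP[_ /IH ->]. Qed.

Lemma near_seq_trans c c' u v w :
  near_seq c u v -> near_seq c' v w -> near_seq (c + c') u w.
Proof.
elim: u v w => [|x u IH] [|y v] [|t w] //= /andP[xy uv] /andP[yt vw].
by rewrite (IH v) // andbT; lia.
Qed.

Lemma eq_Ex_near al be d D D' v : (d == 0) || (d == -1) ->
  (forall w, near_seq 1 v w -> D w = D' w) -> Ex al be d D v = Ex al be d D' v.
Proof.
move=> dP; elim: v D D' => [|c v IH] D D' e /=; first exact: e.
congr (_ * _ + _ * _); apply: IH => w vw; apply: e => /=; rewrite vw andbT;
  by case/orP: dP => /eqP ->; lia.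
Qed.

Lemma eq_ExU_near xs D D' v :
  (forall w, near_seq (size xs) v w -> D w = D' w) -> ExU xs D v = ExU xs D' v.
Proof.
elim: xs D D' v => [|x xs IH] D D' v e /=; first exact/e/near_seq_refl.
apply: IH => w vw; apply: eq_Ex_near => // u wu; apply: e.
by rewrite /= -addn1; exact: near_seq_trans vw wu.
Qed.

Lemma eq_ExD_near xs D D' v :
  (forall w, near_seq (size xs) v w -> D w = D' w) -> ExD xs D v = ExD xs D' v.
Proof.
elim: xs v => [|x xs IH] v e /=; first exact/e/near_seq_refl.
apply: eq_Ex_near => // w vw; apply: IH => u wu; apply: e.
by rewrite /= -add1n; exact: near_seq_trans vw wu.
Qed.

End ShiftOperators.

Lemma sum_iota_ord (V : nmodType) n (F : nat -> V) :
  \sum_(j <- iota 0 n) F j = \sum_(j < n) F j.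
Proof. by rewrite -[in LHS](subn0 n) -/(index_iota 0 n) big_mkord. Qed.

(** * Finite q-Pochhammer symbols and q-binomial coefficients *)

Section QBinomial.
Variable R : realType.
Implicit Types (q : R).

Lemma qpochS q x n : qpoch x q n.+1 = qpoch x q n * (1 - x * q ^+ n).
Proof. by rewrite /qpoch big_ord_recr. Qed.

Lemma qpoch0 q x : qpoch x q 0 = 1.
Proof. by rewrite /qpoch big_ord0. Qed.

Lemma qpoch_gt0 q n : 0 <= q -> q < 1 -> 0 < qpoch q q n.
Proof.
move=> q0 q1; apply: prodr_gt0 => i _.
by rewrite subr_gt0 -exprS exprn_ilt1.
Qed.

Definition qbin q m k : R :=
  if (k <= m)%N then qpoch q q m / (qpoch q q k * qpoch q q (m - k)) else 0.

Lemma qbin_pascal q m k : 0 <= q -> q < 1 ->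
  qbin q m.+1 k.+1 = qbin q m k + q ^+ k.+1 * qbin q m k.+1.
Proof.
move=> q0 q1; have P n := lt0r_neq0 (qpoch_gt0 n q0 q1).
rewrite /qbin ltnS subSS.
have [km|mk] := ltnP k m; last first.
  rewrite mulr0 addr0; case: leqP => // km.
  have -> : k = m by apply/eqP; rewrite eqn_leq km.
  by rewrite subnn qpoch0 !mulr1 !divff.
rewrite (ltnW km); have {km}[j ->] : exists j, m = (k + j).+1.
  by exists (m - k.+1)%N; lia.
rewrite subSS addKn -addnS addKn !qpochS.
have := P k.+1; have := P j.+1; rewrite !qpochS !mulf_eq0 !negb_or.
move=> /andP[? ?] /andP[? ?].
rewrite ?addnS !exprS exprD; field.
all: try by repeat (apply/andP; split).
Qed.

Lemma qbin0 q m : 0 <= q -> q < 1 -> qbin q m 0 = 1.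
Proof.
move=> q0 q1; rewrite /qbin leq0n qpoch0 subn0 mul1r divff //.
exact/lt0r_neq0/qpoch_gt0.
Qed.

Lemma qbin_gt q m k : (m < k)%N -> qbin q m k = 0.
Proof. by move=> mk; rewrite /qbin leqNgt mk. Qed.
End QBinomial.

(* The column lengths of mu, padded with zeros to n entries. *)
Fixpoint conjl (n : nat) (mu : seq nat) : seq int :=
  if mu is m :: mu' then inc (conjl m mu') ++ nseq (n - m) 0 else nseq n 0.

(* The partitions lam with lam_1 <= n such that lam / mu is a horizontal strip. *)
Fixpoint UpL (n : nat) (mu : seq nat) : seq (seq nat) :=
  if mu is m :: mu' then [seq j :: lam | j <- iota m (n - m).+1, lam <- UpL m mu']
  else [::] :: [seq [:: j.+1] | j <- iota 0 n].

Lemma UpL_props n mu lam : path geq n mu -> lam \in UpL n mu ->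
  path geq n lam /\ (sumn mu <= sumn lam <= sumn mu + n)%N.
Proof.
elim: mu n lam => [|m mu IH] n lam.
  move=> /= _; rewrite inE => /orP[/eqP -> //|/mapP[j]].
  by rewrite mem_iota => /andP[_ jn] -> /=; rewrite andbT; lia.
rewrite [path _ _ _]/= [UpL _ _]lock => /andP[mn pm]; rewrite -lock.
move=> /allpairsPdep[j [lam' [+ /(IH _ _ pm)[pl sl] ->]]].
rewrite mem_iota => jm /=; split; last by move: mn; rewrite /geq /=; lia.
apply/andP; split; first by move: mn; rewrite /geq /=; lia.
move: pl; case: (lam') => //= x l' /andP[xm ->].
by rewrite andbT; move: xm; rewrite /geq /=; lia.
Qed.

Lemma conjl_widen m k lam : path geq m lam ->
  conjl (m + k) lam = conjl m lam ++ nseq k 0.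
Proof.
case: lam => [|x l] /=; first by rewrite nseqD.
by rewrite /geq /= => /andP[xm _]; rewrite -catA -nseqD addnBAC.
Qed.

(** * One branching step for a straight functional *)

Section Pieri.
Variables (R : realType) (q : R).
Hypotheses (q_ge0 : 0 <= q) (q_lt1 : q < 1).
Implicit Types (D : seq int -> R) (v l r : seq int).

Lemma Ex_sum I (s : seq I) al be d (F : I -> seq int -> R) v :
  Ex al be d (fun l => \sum_(i <- s) F i l) v =
  \sum_(i <- s) Ex al be d (F i) v.
Proof.
elim: s => [|i s IH].
  rewrite big_nil -[RHS](mul0r (Ex al be d (fun => 0) v)) -Ex_scale.
  by apply: eq_Ex => l; rewrite big_nil mul0r.
by rewrite big_cons -IH -Ex_add; apply: eq_Ex => l; rewrite big_cons.
Qed.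

(** At a = b = c the straightening relation says that adjacent exponents c, c + 1 may be exchanged
    at the cost of a factor q. *)
Lemma straight_swap D l c k r : straight q D ->
  D (l ++ c :: nseq k (c + 1) ++ r) = q ^+ k * D (l ++ nseq k (c + 1) ++ c :: r).
Proof.
move=> sD; elim: k l => [|k IH] l /=; first by rewrite expr0 mul1r.
have -> : forall s, D (l ++ c :: c + 1 :: s) = q * D (l ++ c + 1 :: c :: s).
  by move=> s; have := sD l c c s; lra.
by have := IH (rcons l (c + 1)); rewrite !cat_rcons => ->; rewrite exprS mulrA.
Qed.

(* the q-binomial theorem for the q-commuting shifts of a block of equal entries *)
Lemma Ex_nseq D al be d m c : straight q D ->
  Ex al be d D (nseq m c) =
  \sum_(k < m.+1) al ^+ k * be ^+ (m - k) * qbin q m k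
     * D (nseq k (c + d + 1) ++ nseq (m - k) (c + d)).
Proof.
move=> sD; elim: m D sD => [|m IH] D sD.
  by rewrite /= big_ord1 qbin0 // !expr0 !mul1r.
rewrite [LHS]/= (IH _ (straight_catl [:: _] sD)).
rewrite (IH _ (straight_catl [:: _] sD)) /=.
set h := c + d + 1; set lo := c + d.
pose T k := D (nseq k h ++ nseq (m.+1 - k) lo).
(* Moving an unraised first entry behind k raised ones costs q^k, which is the weight in the
   q-Pascal rule. *)
have E1 (k : nat) : (k <= m)%N ->
    D (lo :: nseq k h ++ nseq (m - k) lo) = q ^+ k * T k.
  by move=> km; rewrite (straight_swap [::]) // /T subSn.
pose A := \sum_(k < m.+1) al ^+ k.+1 * be ^+ (m - k) * qbin q m k * T k.+1.
pose B := \sum_(k < m.+1) al ^+ k * be ^+ (m.+1 - k) * (q ^+ k * qbin q m k) * T k.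
transitivity (A + B).
  rewrite !mulr_sumr; congr (_ + _); apply: eq_bigr => k _.
    by rewrite exprS /T subSS /=; ring.
  by rewrite E1 -1?ltnS // subSn -1?ltnS // exprS; ring.
have -> : B = \sum_(k < m.+2) al ^+ k * be ^+ (m.+1 - k) * (q ^+ k * qbin q m k) * T k.
  by rewrite [RHS]big_ord_recr /= qbin_gt // !mulr0 mul0r addr0.
rewrite [RHS]big_ord_recl [X in _ + X]big_ord_recl addrCA; congr (_ + _).
  by rewrite !qbin0 // expr0 !mul1r.
rewrite -big_split; apply: eq_bigr => k _ /=.
by rewrite /bump /= add1n qbin_pascal // subSS /T; ring.
Qed.

(** One q-binomial per block of equal columns: with mu_0 = n, the i-th block has mu_(i-1) - mu_i
    columns, of which lam_i - mu_i grow. *)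
Fixpoint upw (n : nat) (mu lam : seq nat) : R :=
  if mu is m :: mu' then qbin q (n - m) (head 0%N lam - m) * upw m mu' (behead lam)
  else qbin q n (head 0%N lam).

(** The n - m zero columns form one block, handled by [Ex_nseq]; raising k of them makes the first
    part m + k. The remaining columns are a shifted instance of width m. *)
Lemma Ex_conjl D al be n mu : straight q D -> path geq n mu ->
  Ex al be 0 D (conjl n mu) =
  \sum_(lam <- UpL n mu) upw n mu lam * al ^+ (sumn lam - sumn mu)
     * be ^+ (n - (sumn lam - sumn mu)) * D (conjl n lam).
Proof.
elim: mu n D => [|m mu IH] n D sD.
  move=> _; rewrite Ex_nseq //= big_ord_recl big_cons; congr (_ + _).
    by rewrite !subn0 /= addr0; ring.
  rewrite big_map sum_iota_ord; apply: eq_bigr => j _.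
  by rewrite /= /bump /= !addn0 !subn0 !addr0 add1n ?add0n /inc map_nseq; ring.
rewrite [path _ _ _]/= => /andP[mn pm].
rewrite [conjl _ _]/= Ex_cat.
under eq_Ex => u do rewrite (Ex_nseq _ _ _ _ _ (straight_catl u sD)).
rewrite Ex_sum big_allpairs_dep -[m in iota m _]addn0 iotaDl big_map.
rewrite sum_iota_ord; apply: eq_bigr => k _.
rewrite Ex_scale Ex_inc (IH _ (fun u => D (inc u ++ _))) //; last first.
  by apply: (straight_inc (D := fun l => D (l ++ _))); exact: straight_catr.
rewrite big_distrr /= !big_seq; apply: eq_bigr => lam /(UpL_props pm)[pl sl].
rewrite addKn (conjl_widen _ pl) /inc map_cat map_nseq -catA !addr0 add0r subnDA.
have kn := ltn_ord k.
have -> : (m + k + sumn lam - m - sumn mu = k + (sumn lam - sumn mu))%N by lia.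
have -> : (n - (k + (sumn lam - sumn mu)) =
           n - m - k + (m - (sumn lam - sumn mu)))%N by lia.
have -> : (n - (m + k) = n - m - k)%N by lia.
by rewrite !exprD; ring.
Qed.
End Pieri.

(** * Combinatorics of interlacing, horizontal strips and boxes *)

Lemma is_part_cons x s :
  is_part (x :: s) = [&& 0 < x, head 0 s <= x & is_part s]%N.
Proof. by case: s => [|y s]; rewrite /is_part /= ?andbT //; lia. Qed.

Lemma path_geq_part n mu : is_part mu -> path geq n mu = (head 0 mu <= n)%N.
Proof.
elim: mu n => [|m mu IH] n //=.
by rewrite is_part_cons => /and3P[_ mm pm]; rewrite IH // mm andbT.
Qed.

Lemma interlace_cons m mu j lam : interlace (m :: mu) (j :: lam) =
  (head 0 lam <= m <= j)%N && interlace mu lam.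
Proof.
rewrite {1}/interlace.
have -> : iota 0 (size (j :: lam)).+1 =
    [:: 0%N] ++ [seq (1 + i)%N | i <- iota 0 (size lam).+1].
  exact: (congr1 (cons 0%N) (iotaDl 1 0 (size lam).+1)).
by rewrite all_cat all_map [all _ [:: _]]/= andbT nth0.
Qed.

Lemma mem_UpL n mu lam : is_part mu -> (head 0 mu <= n)%N ->
  (lam \in UpL n mu) = [&& is_part lam, head 0 lam <= n & interlace mu lam]%N.
Proof.
elim: mu n lam => [|m mu IH] n lam.
  move=> _ _; case: lam => [|j [|x lam]] //.
  - rewrite inE /= /interlace /is_part /= !andbT.
    apply/mapP/andP => [[x]|[j0 jn]].
      by rewrite mem_iota => /andP[_ ?] [->].
    by exists j.-1; rewrite ?mem_iota ?prednK //; lia.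
  - rewrite inE /= !is_part_cons /interlace /= leqn0.
    have -> : ([:: j, x & lam] \in [seq [:: j0.+1] | j0 <- iota 0 n]) = false.
      by apply/mapP => -[].
    by case: x => [|x] //=; rewrite !andbF.
rewrite is_part_cons => /and3P[m0 hm pm]; rewrite [head _ (m :: _)]/= => mn.
case: lam => [|j lam].
  have -> : interlace (m :: mu) [::] = false by rewrite /interlace /= leqNgt m0.
  by rewrite !andbF; apply/negbTE/allpairsPdep => -[? [? []]].
rewrite interlace_cons is_part_cons [head _ (j :: lam)]/=.
apply/allpairsPdep/idP => [[j' [lam' []]]|].
  rewrite mem_iota IH // => /andP[mj jn] /and3P[pl hl il] [-> ->].
  by rewrite pl hl il mj !andbT /=; lia.
move=> /and3P[/and3P[j0 hj pl] jn /andP[/andP[h1 h2] il]].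
exists j, lam; split => //; first by rewrite mem_iota; lia.
by rewrite IH // pl il h1.
Qed.

(** Going down from l1 :: lam is going up from lam inside width l1, so one list of partitions serves
    both directions. *)
Lemma mem_UpL_down l1 lam mu : is_part (l1 :: lam) ->
  (mu \in UpL l1 lam) = is_part mu && interlace mu (l1 :: lam).
Proof.
rewrite is_part_cons => /and3P[_ hl pl]; rewrite mem_UpL //.
case: (boolP (is_part mu)) => //=.
elim: lam l1 mu hl pl => [|m lam IH] l1 mu.
  move=> _ _; case: mu => [|j [|x mu]] //.
  rewrite !is_part_cons => /and3P[_ _ /andP[x0 _]].
  by rewrite /interlace /= !(leqNgt x 0) x0 !andbF.
rewrite is_part_cons => hl /and3P[m0 hm pl].
case: mu => [_|j mu]; first by rewrite /interlace /= leqNgt m0.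
rewrite is_part_cons => /and3P[j0 hj pmu].
rewrite !interlace_cons [head _ (m :: lam)]/= [head _ (j :: mu)]/= -IH //; lia.
Qed.

Lemma UpL_uniq n mu : uniq (UpL n mu).
Proof.
elim: mu n => [|m mu IH] n.
  rewrite /= map_inj_uniq ?iota_uniq ?andbT; last by move=> ? ? [].
  by apply/mapP => -[].
apply: allpairs_uniq_dep; rewrite ?iota_uniq // => [[a u] [b v]] _ _ /= [-> ->].
by [].
Qed.

Lemma mem_box_seqs k m s :
  (s \in box_seqs k m) = (size s <= k)%N && all (fun x => x <= m)%N s.
Proof.
elim: k s => [|k IH] s; first by rewrite inE; case: s.
rewrite inE; case: s => [|x s]; first by rewrite eqxx.
rewrite [_ == _]/= orFb [size _]/= [all _ _]/=.
apply/allpairsPdep/idP => [[y [t []]]|].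
  by rewrite mem_iota IH => ym /andP[st at_] [-> ->]; rewrite ltnS st at_ andbT; lia.
rewrite ltnS => /and3P[sk xm as_]; exists x, s.
by rewrite mem_iota IH sk as_; split => //; lia.
Qed.

Lemma box_seqs_uniq k m : uniq (box_seqs k m).
Proof.
elim: k => [|k IH] //.
rewrite -[box_seqs _ _]/([::] :: [seq x :: s | x <- iota 0 m.+1, s <- box_seqs k m]).
rewrite cons_uniq; apply/andP; split.
  by apply/allpairsPdep => -[? [? []]].
apply: allpairs_uniq_dep; rewrite ?iota_uniq // => [[a u] [b v]] _ _ /= [-> ->].
by [].
Qed.

Lemma eq_sum_uniq (V : nmodType) (I : eqType) (r s : seq I) (P Q : pred I)
    (F : I -> V) : uniq r -> uniq s ->
  (forall i, (i \in r) && P i = (i \in s) && Q i) ->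
  \sum_(i <- r | P i) F i = \sum_(i <- s | Q i) F i.
Proof.
move=> ur us e; rewrite -big_filter -[RHS]big_filter; apply: perm_big.
apply: uniq_perm; rewrite ?filter_uniq // => i.
by rewrite !mem_filter andbC e andbC.
Qed.

Lemma part_le_head lam : is_part lam -> all (fun x => x <= head 0 lam)%N lam.
Proof.
elim: lam => //= m lam IH; rewrite is_part_cons => /and3P[_ hm /IH].
by rewrite leqnn; apply: sub_all => x; lia.
Qed.

Lemma part_in_box k n lam : is_part lam ->
  (lam \in box_seqs k n) = (size lam <= k)%N && (head 0 lam <= n)%N.
Proof.
move=> pl; rewrite mem_box_seqs; congr (_ && _).
apply/idP/idP => [|hl]; first by case: (lam) => //= x s /andP[].
by apply: sub_all (part_le_head pl) => x; lia.
Qed.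

(** Deleting the first row turns a downward step into an upward one with the same q-binomials, up to
    their symmetry. *)
Lemma psiW_UpL (R : realType) (q : R) l1 lam mu : path geq l1 lam ->
  mu \in UpL l1 lam -> psiW q (l1 :: lam) mu = upw q l1 lam mu.
Proof.
elim: lam l1 mu => [|m lam IH] l1 mu.
  move=> _ H; have h1 : (head 0 mu <= l1)%N.
    have := @UpL_props l1 [::] mu isT H; case: (mu) => //= x s [/andP[]] //.
  rewrite /psiW /= big_ord1 /= nth0 /qbin h1 !subn0; congr (_ / _).
  by rewrite mulrC.
rewrite [path _ _ _]/= => /andP[ml pl] /allpairsPdep[j [mu' [+ mu'l ->]]].
rewrite mem_iota => jm /=; rewrite -IH // /psiW big_ord_recl /= /qbin.
rewrite ifT; last by move: ml; rewrite /geq /=; lia.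
have -> : (l1 - m - (j - m) = l1 - j)%N by move: ml; rewrite /geq /=; lia.
by congr (_ / _ * _); rewrite mulrC.
Qed.

Lemma size_conjl n mu : path geq n mu -> size (conjl n mu) = n.
Proof.
elim: mu n => [|m mu IH] n; first by rewrite /= size_nseq.
rewrite [path _ _ _]/= => /andP[mn pm].
by rewrite /= size_cat size_map IH // size_nseq subnKC.
Qed.

Lemma conjl_ge0 n mu : all (fun c : int => 0 <= c) (conjl n mu).
Proof.
elim: mu n => [|m mu IH] n; first by rewrite /= all_nseq lexx orbT.
rewrite /= all_cat all_nseq lexx orbT andbT all_map.
by apply: sub_all (IH m) => c /=; lia.
Qed.

(** * Iterated branching and the q-Whittaker weights *)

Section Branching.
Variables (R : realType) (q : R).
Hypotheses (q_ge0 : 0 <= q) (q_lt1 : q < 1).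
Implicit Types (D : seq int -> R).

Let qp_neq0 n : qpoch q q n != 0.
Proof. exact/lt0r_neq0/qpoch_gt0. Qed.

(** The skew q-Whittaker sum: rho = [::] gives P_lam, and q = 0 gives the skew Schur polynomial, so
    one development covers both measures. *)
Fixpoint skewW (xr : seq R) (lam rho : seq nat) : R :=
  if xr is x :: xs then
    \sum_(mu <- box_seqs (size lam) (head 0%N lam) | is_part mu && interlace mu lam)
      psiW q lam mu * x ^+ (sumn lam - sumn mu) * skewW xs mu rho
  else (lam == rho)%:R.

Lemma skewW_cons x xs lam rho : skewW (x :: xs) lam rho =
  \sum_(mu <- box_seqs (size lam) (head 0%N lam) | is_part mu && interlace mu lam)
    psiW q lam mu * x ^+ (sumn lam - sumn mu) * skewW xs mu rho.
Proof. by []. Qed.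

(** The (q;q) factors of the block lengths of [conjl n lam]. The block of zeros gives (q;q)_(n -
    lam_1); the other blocks give the normalisation of Q_lam. *)
Definition bnorm n (lam : seq nat) : R :=
  qpoch q q (n - head 0 lam)%N *
  \prod_(j < size lam) qpoch q q (nth 0 lam j - nth 0 lam j.+1)%N.

Lemma bnorm_neq0 n lam : bnorm n lam != 0.
Proof. by rewrite mulf_neq0 //; apply/prodf_neq0. Qed.

Lemma bnorm_cons n m lam : bnorm n (m :: lam) = qpoch q q (n - m) * bnorm m lam.
Proof. by rewrite /bnorm big_ord_recl /= nth0. Qed.

Lemma psiW_cons j lam m mu : psiW q (j :: lam) (m :: mu) =
  qpoch q q (j - head 0%N lam) /
    (qpoch q q (j - m) * qpoch q q (m - head 0%N lam)) * psiW q lam mu.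
Proof. by rewrite /psiW big_ord_recl /= nth0. Qed.

(** The upward weight differs from psi only by a ratio of block norms, which telescopes when steps
    are composed. *)
Lemma upw_bnorm n mu lam : path geq n mu -> lam \in UpL n mu ->
  upw q n mu lam * bnorm n lam = psiW q lam mu * bnorm n mu.
Proof.
elim: mu n lam => [|m mu IH] n lam.
  move=> _; rewrite inE => /orP[/eqP ->|/mapP[j jn ->]].
    by rewrite /psiW big_ord0 mul1r [upw _ _ _ _]/= qbin0 // mul1r.
  move: jn; rewrite mem_iota => /andP[_ jn].
  rewrite /psiW /bnorm /= !big_ord1 big_ord0 /= !subn0 qpoch0 !mulr1 divff // mul1r.
  by rewrite /qbin jn; field; rewrite !qp_neq0.
rewrite [path _ _ _]/= => /andP[mn pm] /allpairsPdep[j [lam' [+ lm ->]]].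
rewrite mem_iota => jm.
have : (head 0 lam' <= m)%N.
  by have [] := UpL_props pm lm; case: (lam') => //= x s /andP[].
have := IH _ _ pm lm; rewrite !bnorm_cons psiW_cons /= /qbin /bnorm.
set h := head 0%N lam'; set P := \prod_(i < size lam') _.
set Q := \prod_(i < size mu) _ => e hm.
rewrite ifT; last by move: mn; rewrite /geq /=; lia.
have -> : (n - m - (j - m) = n - j)%N by move: mn; rewrite /geq /=; lia.
transitivity (qpoch q q (n - m) * qpoch q q (j - h) /
   (qpoch q q (j - m) * qpoch q q (m - h)) *
   (upw q m mu lam' * (qpoch q q (m - h) * P))).
  by field; rewrite !qp_neq0.
by rewrite e; field; rewrite !qp_neq0.
Qed.

Lemma interlace_size mu lam : is_part mu -> interlace mu lam ->
  (size mu <= size lam)%N && (head 0 mu <= head 0 lam)%N.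
Proof.
move=> pm /allP il; apply/andP; split.
  rewrite leqNgt; apply/negP => s.
  have := il (size lam); rewrite mem_iota leqnn (nth_default _ (leqnn (size lam))).
  move=> /(_ isT) /andP[_]; rewrite leqNgt; case/negP.
  by move: pm => /andP[_ /allP]; apply; apply: mem_nth.
by have := il 0%N; rewrite mem_iota !nth0 => /(_ isT) /andP[].
Qed.

Lemma UpL_size n mu lam : lam \in UpL n mu -> (size lam <= (size mu).+1)%N.
Proof.
elim: mu n lam => [|m mu IH] n lam.
  by rewrite inE => /orP[/eqP ->//|/mapP[? _ ->]].
by move=> /allpairsPdep[j [l [_ /IH + ->]]].
Qed.

(** A horizontal strip adds at most one row, so each variable increases the length by at most
    one. *)
Lemma skewW_size xs lam rho : is_part lam -> skewW xs lam rho != 0 ->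
  (size lam <= size rho + size xs)%N.
Proof.
elim: xs lam => [|x xs IH] lam pl /=.
  by case: (lam =P rho) => [->|_]; rewrite ?addn0 // eqxx.
apply: contraR; rewrite -ltnNge addnS => sl.
rewrite big1_seq // => mu /andP[/andP[pm il] _].
have [->|/(IH _ pm) sm] := eqVneq (skewW xs mu rho) 0; first by rewrite mulr0.
have /andP[_ hml] := interlace_size pm il.
have : lam \in UpL (head 0%N lam) mu by rewrite mem_UpL // pl leqnn il.
move=> /UpL_size h; have : (size lam <= (size rho + size xs).+1)%N.
  exact: leq_trans h _.
by rewrite leqNgt sl.
Qed.

(** The norm ratios of the single steps telescope to the ratio between rho and lam. The height K
    only has to contain every partition that can be reached. *)
Lemma ExU_conjl D as_ n rho K : straight q D -> is_part rho ->
  (head 0 rho <= n)%N -> (size rho + size as_ <= K)%N ->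
  ExU as_ D (conjl n rho) =
  \sum_(lam <- box_seqs K n | is_part lam)
     bnorm n rho / bnorm n lam * skewW as_ lam rho * D (conjl n lam).
Proof.
move=> + pr hr; elim: as_ D => [|a as_ IH] D sD sK /=.
  rewrite (big_rem rho) /=; last by rewrite part_in_box // hr; lia.
  rewrite pr eqxx divff ?bnorm_neq0 // !mul1r big1_seq ?addr0 // => lam.
  rewrite mem_rem_uniq ?box_seqs_uniq // inE => /andP[_ /andP[/negbTE -> _]].
  by rewrite mulr0 mul0r.
rewrite IH; [|exact: straight_Ex|by move: sK => /=; lia].
pose G mu lam : R := bnorm n rho / bnorm n lam *
  (psiW q lam mu * a ^+ (sumn lam - sumn mu) * skewW as_ mu rho) * D (conjl n lam).
transitivity (\sum_(mu <- box_seqs K n | is_part mu)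
    \sum_(lam <- box_seqs K n | is_part lam && interlace mu lam) G mu lam).
  rewrite big_seq_cond [RHS]big_seq_cond; apply: eq_bigr => mu /andP[muK pm].
  move: (muK); rewrite part_in_box // => /andP[sm hm].
  have [z|nz] := eqVneq (skewW as_ mu rho) 0.
    by rewrite z mulr0 mul0r big1 // => lam _; rewrite /G z !(mulr0, mul0r).
  have sm' := skewW_size pm nz.
  rewrite (Ex_conjl q_ge0 q_lt1 _ _ sD) ?path_geq_part // mulr_sumr.
  rewrite big_seq (eq_sum_uniq (s := box_seqs K n)
    (Q := fun lam => is_part lam && interlace mu lam)); last 3 first.
  - exact: UpL_uniq.
  - exact: box_seqs_uniq.
  - move=> lam; rewrite andbb mem_UpL //.
    case: (boolP (is_part lam)) => pl; rewrite ?andbF //=.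
    rewrite part_in_box //; case: (boolP (interlace mu lam)) => il; rewrite ?andbF // !andbT.
    case hl: (head 0 lam <= n)%N; rewrite ?andbF // andbT.
    suff -> : (size lam <= K)%N by [].
    have : lam \in UpL n mu by rewrite mem_UpL // pl hl il.
    by move=> /UpL_size; move: sK => /=; lia.
  rewrite big_seq_cond [RHS]big_seq_cond; apply: eq_bigr => lam /and3P[lK pl il].
  move: lK; rewrite part_in_box // => /andP[_ hl].
  have lU : lam \in UpL n mu by rewrite mem_UpL // pl hl il.
  have e : upw q n mu lam = psiW q lam mu * bnorm n mu / bnorm n lam.
    by rewrite -upw_bnorm ?path_geq_part // mulfK // bnorm_neq0.
  rewrite e expr1n /G; field; rewrite !bnorm_neq0 //.
rewrite (exchange_big_dep is_part) /=; last by move=> mu lam _ /andP[].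
rewrite big_seq_cond [RHS]big_seq_cond; apply: eq_bigr => lam /andP[lK pl].
rewrite mulr_sumr mulr_suml (eq_sum_uniq (s := box_seqs (size lam) (head 0%N lam))
  (Q := fun mu => is_part mu && interlace mu lam)) ?box_seqs_uniq // => mu.
case: (boolP (is_part mu)) => pm; rewrite ?andbF //= pl.
case: (boolP (interlace mu lam)) => il; rewrite ?andbF // !andbT !part_in_box //.
have /andP[-> ->] := interlace_size pm il.
move: lK; rewrite part_in_box // => /andP[lK ln].
have /andP[? ?] := interlace_size pm il; lia.
Qed.

Lemma cvg_sum_seq (I : eqType) (r : seq I) (P : pred I) (F : I -> nat -> R)
    (l : I -> R) : (forall i, i \in r -> P i -> F i @ \oo --> l i) ->
  (fun L => \sum_(i <- r | P i) F i L) @ \oo --> \sum_(i <- r | P i) l i.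
Proof.
elim: r => [|i r IH] h.
  by rewrite big_nil; under eq_fun do rewrite big_nil; exact: cvg_cst.
have {}IH : (fun L => \sum_(i <- r | P i) F i L) @ \oo --> \sum_(i <- r | P i) l i.
  by apply: IH => k kr; apply: h; rewrite in_cons kr orbT.
rewrite big_cons; under eq_fun do rewrite big_cons.
case: (boolP (P i)) => // Pi.
by apply: cvgD => //; apply: h => //; rewrite mem_head.
Qed.

Lemma Ex_dec al be D v : Ex al be (-1) D (inc v) = Ex al be 0 D v.
Proof. by elim: v D => [|c v IH] D //=; rewrite !IH !addrK !addr0. Qed.

Lemma cvg_lincomb0 (al be : R) (f g : nat -> R) :
  f @ \oo --> (0 : R) -> g @ \oo --> (0 : R) ->
  (fun L => al * f L + be * g L) @ \oo --> (0 : R).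
Proof.
move=> f0 g0; have -> : 0 = al * 0 + be * 0 :> R by rewrite !mulr0 addr0.
by apply: cvgD; apply: cvgMl_tmp.
Qed.

Lemma Ex_rcons_cvg0 (D : nat -> seq int -> R) al be v m :
  (forall v m, m < 0 -> D^~ (rcons v m) @ \oo --> (0 : R)) -> m < 0 ->
  (fun L => Ex al be (-1) (D L) (rcons v m)) @ \oo --> (0 : R).
Proof.
move=> + m0; elim: v D => [|c v IH] D D0 /=; apply: cvg_lincomb0.
- by apply: (D0 [::]); lia.
- by apply: (D0 [::]); lia.
- by apply: (IH (fun L l => D L (_ :: l))) => w k k0; rewrite -rcons_cons; exact: D0.
- by apply: (IH (fun L l => D L (_ :: l))) => w k k0; rewrite -rcons_cons; exact: D0.
Qed.

(** Each column is lowered or kept. On the l1 positive columns, lowering by one compensates [inc]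
    and leaves an upward step from lam. Lowering a zero column produces a negative last entry, where
    the functional tends to 0, so among the terms indexed by the number k of kept zeros only k = n -
    l1 survives. *)
Lemma Ex_down_cvg (D : nat -> seq int -> R) b n l1 lam (g : seq nat -> R) :
  (forall L, straight q (D L)) ->
  (forall v m, m < 0 -> D^~ (rcons v m) @ \oo --> (0 : R)) ->
  path geq n (l1 :: lam) ->
  (forall mu, mu \in UpL l1 lam -> D^~ (conjl n mu) @ \oo --> g mu) ->
  (fun L => Ex 1 b (-1) (D L) (conjl n (l1 :: lam))) @ \oo -->
  \sum_(mu <- UpL l1 lam)
     upw q l1 lam mu * b ^+ (l1 - (sumn mu - sumn lam)) * g mu.
Proof.
move=> sD D0 /= /andP[ln pl] Dg.
pose F k mu L := b ^+ (n - l1 - k) * qbin q (n - l1) k *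
  (upw q l1 lam mu * b ^+ (l1 - (sumn mu - sumn lam)) *
   D L (conjl l1 mu ++ nseq k 0 ++ nseq (n - l1 - k) (-1))).
have E L : Ex 1 b (-1) (D L) (inc (conjl l1 lam) ++ nseq (n - l1) 0) =
    \sum_(k < (n - l1).+1) \sum_(mu <- UpL l1 lam) F k mu L.
  rewrite Ex_cat.
  under eq_Ex => u do rewrite (Ex_nseq _ _ _ _ _ _ _ (straight_catl u (sD L))) //.
  rewrite Ex_sum; apply: eq_bigr => k _; rewrite Ex_scale Ex_dec.
  rewrite (Ex_conjl q_ge0 q_lt1 1 b (straight_catr _ (sD L)) pl) mulr_sumr.
  by apply: eq_bigr => mu _; rewrite !expr1n /F; ring.
under eq_fun do rewrite E.
pose w mu := upw q l1 lam mu * b ^+ (l1 - (sumn mu - sumn lam)).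
have -> : \sum_(mu <- UpL l1 lam) w mu * g mu =
    \sum_(k < (n - l1).+1) \sum_(mu <- UpL l1 lam)
       if k == ord_max then w mu * g mu else 0.
  rewrite big_ord_recr /= eqxx [X in _ = X + _]big1 ?add0r // => k _; apply: big1 => mu _.
  by rewrite -val_eqE /= ltn_eqF.
apply: cvg_sum_seq => k _ _; apply: cvg_sum_seq => mu muU _; rewrite /F.
case: eqP => [->|/eqP kn].
  rewrite /= subnn expr0 /qbin leqnn subnn qpoch0 mulr1 divff // !mul1r cats0.
  under eq_fun do rewrite mul1r.
  apply: cvgMl_tmp; have [pm _] := UpL_props pl muU.
  have := Dg _ muU; rewrite -{1}(subnKC ln); under eq_fun do rewrite conjl_widen //.
  exact.
rewrite -(mulr0 (b ^+ (n - l1 - k) * qbin q (n - l1) k)); apply: cvgMl_tmp.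
rewrite -(mulr0 (w mu)); apply: cvgMl_tmp.
have [j ej] : exists j, nseq (n - l1 - k) (-1 : int) = rcons (nseq j (-1)) (-1).
  exists (n - l1 - k).-1; rewrite -cats1 -[[:: -1]]/(nseq 1 (-1)) -nseqD; congr nseq.
  by move: kn (ltn_ord k); rewrite -val_eqE /=; lia.
by under eq_fun do rewrite ej -!rcons_cat; apply: D0.
Qed.

(** Stated for a sequence of functionals because the averages over roots of unity meet the last two
    conditions only in the limit; the determinants enter as a constant sequence. *)
Lemma ExD_cvg (D : nat -> seq int -> R) bs n rho :
  (forall L, straight q (D L)) ->
  (forall v m, m < 0 -> D^~ (rcons v m) @ \oo --> (0 : R)) ->
  (forall mu, is_part mu -> (head 0 mu <= n)%N ->
     D^~ (conjl n mu) @ \oo --> ((mu == rho)%:R : R)) ->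
  forall lam, is_part lam -> (head 0 lam <= n)%N ->
  (fun L => ExD bs (D L) (conjl n lam)) @ \oo --> skewW bs lam rho.
Proof.
move=> sD D0 Dr; elim: bs => [|b bs IH] lam pl hl; first exact: Dr.
have sE L : straight q (ExD bs (D L)).
  exact: straight_ExD.
have E0 v m : m < 0 -> (fun L => ExD bs (D L) (rcons v m)) @ \oo --> (0 : R).
  elim: (bs) v m => [|c cs IHc] v m m0 /=; first exact: D0.
  exact: (Ex_rcons_cvg0 (D := fun L => ExD cs (D L))).
have partU l1 lam' mu : is_part (l1 :: lam') -> (l1 <= n)%N ->
    mu \in UpL l1 lam' -> is_part mu /\ (head 0 mu <= n)%N.
  move=> pl' l1n; rewrite mem_UpL_down // => /andP[pm il].
  by split=> //; have /andP[_ /leq_trans] := interlace_size pm il; exact.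
case: lam pl hl => [|l1 lam'] pl hl.
  have -> : skewW (b :: bs) [::] rho = skewW bs [::] rho.
    by rewrite /= big_cons big_nil /= /psiW big_ord0 !mul1r addr0.
  under eq_fun do rewrite [ExD _ _]/= [conjl _ _]/= (Ex_nseq q_ge0 q_lt1 _ _ _ _ _ (sE _)).
  have -> : skewW bs [::] rho =
      \sum_(k < n.+1) if k == ord_max then skewW bs [::] rho else 0.
    rewrite big_ord_recr /= eqxx [X in _ = X + _]big1 ?add0r // => k _.
    by rewrite -val_eqE /= ltn_eqF.
  apply: cvg_sum_seq => k _ _; case: eqP => [->|/eqP kn].
    rewrite /= subnn expr0 /qbin leqnn subnn qpoch0 !mulr1 divff // cats0 addrNK.
    by under eq_fun do rewrite expr1n !mul1r; exact: IH.
  rewrite -(mulr0 (1 ^+ k * b ^+ (n - k) * qbin q n k)); apply: cvgMl_tmp.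
  have [j ej] : exists j, nseq (n - k) (0 - 1 : int) = rcons (nseq j (-1)) (-1).
    exists (n - k).-1; rewrite -cats1 -[[:: -1]]/(nseq 1 (-1)) -nseqD sub0r; congr nseq.
    by move: kn (ltn_ord k); rewrite -val_eqE /=; lia.
  by under eq_fun do rewrite ej -rcons_cat; apply: E0.
have pl1 : path geq n (l1 :: lam') by rewrite path_geq_part.
have /andP[_ pl2] := pl1.
have -> : skewW (b :: bs) (l1 :: lam') rho = \sum_(mu <- UpL l1 lam')
     upw q l1 lam' mu * b ^+ (l1 - (sumn mu - sumn lam')) * skewW bs mu rho.
  rewrite skewW_cons [RHS]big_seq (eq_sum_uniq (s := UpL l1 lam')
    (Q := fun mu => mu \in UpL l1 lam')) ?box_seqs_uniq ?UpL_uniq //; last first.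
    move=> mu; rewrite andbb mem_UpL_down //.
    case: (boolP (is_part mu)) => pm; rewrite ?andbF // !andTb.
    case: (boolP (interlace mu _)) => il; rewrite ?andbF // !andbT.
    by rewrite part_in_box //; exact: (interlace_size pm il).
  apply: eq_bigr => mu muU; rewrite psiW_UpL //; congr (_ * _ ^+ _ * _).
  by have [_ /andP[]] := UpL_props pl2 muU; rewrite /=; lia.
apply: (Ex_down_cvg (D := fun L => ExD bs (D L))) => // mu muU.
by have [pm hm] := partU _ _ _ pl hl muU; exact: IH.
Qed.

End Branching.

(** * The q-Whittaker functional: averages over roots of unity *)

(* The effect on exponents of multiplying x^v by prod_j sum_k c_k (y / x_j)^k: the
   first argument of Phi is the exponent of y. *)
Fixpoint Tk (A : comNzRingType) (L : nat) (c : nat -> A)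
    (Phi : nat -> seq int -> A) (v : seq int) : A :=
  if v is a :: v' then
    \sum_(k < L.+1) c k * Tk L c (fun s l => Phi (k + s)%N (a - k%:Z :: l)) v'
  else Phi 0%N [::].

Lemma eq_Tk (A : comNzRingType) L (c : nat -> A) Phi Phi' v :
  (forall s l, size l = size v -> Phi s l = Phi' s l) ->
  Tk L c Phi v = Tk L c Phi' v.
Proof.
elim: v Phi Phi' => [|a v IH] Phi Phi' e /=; first exact: e.
by apply: eq_bigr => k _; congr (_ * _); apply: IH => s l sl; apply: e => /=; rewrite sl.
Qed.

Fixpoint sw (T : Type) (i : nat) (x : seq T) : seq T :=
  match i, x with
  | 0, u :: v :: x' => v :: u :: x'
  | i'.+1, y :: x' => y :: sw i' x'
  | _, _ => x
  end.

Section RootAverage.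
Variables (K : numFieldType) (L : nat) (z q : K).
Hypotheses (L_gt0 : (0 < L)%N) (zP : L.-primitive_root z) (qL : q ^+ L != 1).
Implicit Types (G H : seq K -> K) (x : seq K) (l r : seq int).

Definition avg (f : K -> K) : K := L%:R^-1 * \sum_(i < L) f (z ^+ i).

Fixpoint E (n : nat) (G : seq K -> K) : K :=
  if n is n'.+1 then avg (fun y => E n' (fun x => G (y :: x))) else G [::].

Fixpoint mon (v : seq int) (x : seq K) : K :=
  if v is c :: v' then if x is y :: x' then y ^ c * mon v' x' else 1 else 1.

(* On roots of unity 1 - q y / w never vanishes, since q^L <> 1. *)
Definition gfun (y w : K) := (1 - y / w) / (1 - q * (y / w)).

Fixpoint dd (x : seq K) : K :=
  if x is y :: x' then (\prod_(w <- x') gfun y w) * dd x' else 1.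

Definition rootL (y : K) := y ^+ L == 1.

Lemma rootL_z i : rootL (z ^+ i).
Proof. by rewrite /rootL -exprM mulnC exprM (prim_expr_order zP) expr1n. Qed.

Lemma rootL_neq0 y : rootL y -> y != 0.
Proof. by apply: contraTneq => ->; rewrite /rootL expr0n gtn_eqF //= eq_sym oner_eq0. Qed.

Lemma rootL_qden y w : rootL y -> rootL w -> w - q * y != 0.
Proof.
move=> ry rw; apply: contra qL; rewrite subr_eq0 => /eqP e.
have := rw; rewrite /rootL e exprMn.
by move: ry; rewrite /rootL => /eqP ->; rewrite mulr1.
Qed.

Lemma eq_avg f g : (forall y, rootL y -> f y = g y) -> avg f = avg g.
Proof. by move=> e; congr (_ * _); apply: eq_bigr => i _; rewrite e ?rootL_z. Qed.

Lemma avg_eq0 f : (forall y, rootL y -> f y = 0) -> avg f = 0.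
Proof. by move=> e; rewrite /avg big1 ?mulr0 // => i _; rewrite e ?rootL_z. Qed.

Lemma avg_sum I (s : seq I) (P : pred I) (f : I -> K -> K) :
  avg (fun y => \sum_(i <- s | P i) f i y) = \sum_(i <- s | P i) avg (f i).
Proof. by rewrite /avg exchange_big /= mulr_sumr. Qed.

Lemma avg_add f g : avg (fun y => f y + g y) = avg f + avg g.
Proof. by rewrite /avg big_split mulrDr. Qed.

Lemma avg_scale k f : avg (fun y => k * f y) = k * avg f.
Proof. by rewrite /avg -mulr_sumr mulrCA. Qed.

Lemma avg_exchange (f : K -> K -> K) :
  avg (fun u => avg (fun v => f u v)) = avg (fun v => avg (fun u => f u v)).
Proof.
rewrite /avg -mulr_sumr -[in RHS]mulr_sumr; congr (_ * (_ * _)).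
exact: exchange_big.
Qed.

Lemma eq_E n G G' :
  (forall x, size x = n -> all rootL x -> G x = G' x) -> E n G = E n G'.
Proof.
elim: n G G' => [|n IH] G G' e /=; first exact: e.
by apply: eq_avg => y ry; apply: IH => x sx rx; apply: e => /=; rewrite ?sx ?ry.
Qed.

Lemma E_add n G G' : E n (fun x => G x + G' x) = E n G + E n G'.
Proof.
elim: n G G' => [|n IH] G G' //=; rewrite -avg_add.
by apply: eq_avg => y _; exact: IH.
Qed.

Lemma E_scale n k G : E n (fun x => k * G x) = k * E n G.
Proof.
elim: n G => [|n IH] G //=; rewrite -avg_scale.
by apply: eq_avg => y _; exact: IH.
Qed.

Lemma E_sum n I (s : seq I) (P : pred I) (F : I -> seq K -> K) :
  E n (fun x => \sum_(i <- s | P i) F i x) = \sum_(i <- s | P i) E n (F i).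
Proof.
elim: n F => [|n IH] F //=; rewrite -avg_sum.
by apply: eq_avg => y _; exact: IH.
Qed.

Lemma gfunE u v : rootL u -> rootL v -> gfun u v * (v - q * u) = v - u.
Proof.
move=> ru rv; have v0 := rootL_neq0 rv; have d0 := rootL_qden ru rv.
rewrite /gfun; field; rewrite v0 /=.
by apply: contra d0 => /eqP h; apply/eqP; rewrite -[RHS]h; field.
Qed.

(** The factor v - q u of the relation cancels the denominator of [gfun u v] and leaves v - u times
    a function symmetric in u and v. Averaging over both variables therefore gives its own
    negative. *)
Lemma E_straight l r a b H :
  (forall x1 u v x2, size x1 = size l ->
     H (x1 ++ u :: v :: x2) = H (x1 ++ v :: u :: x2)) ->
  E (size l + (size r).+2) (fun x => H x * (
      mon (l ++ a :: b + 1 :: r) x + mon (l ++ b :: a + 1 :: r) x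
      - q * (mon (l ++ a + 1 :: b :: r) x + mon (l ++ b + 1 :: a :: r) x)) * dd x)
  = 0.
Proof.
elim: l H => [|c l IH] H Hs /=; last first.
  apply: avg_eq0 => y _.
  rewrite -(IH (fun x => H (y :: x) * y ^ c * \prod_(w <- x) gfun y w)).
    by apply: eq_E => x _ _; ring.
  move=> x1 u v x2 s1; rewrite -cat_cons Hs /= ?s1 //; congr (_ * _).
  by rewrite !big_cat !big_cons /=; ring.
pose f u v := E (size r) (fun x => H (u :: v :: x) * (
  mon [:: a, b + 1 & r] (u :: v :: x) + mon [:: b, a + 1 & r] (u :: v :: x)
  - q * (mon [:: a + 1, b & r] (u :: v :: x) + mon [:: b + 1, a & r] (u :: v :: x)))
  * dd (u :: v :: x)).
rewrite -/(avg (fun u => avg (f u))).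
pose h u v := E (size r) (fun x => H (u :: v :: x) * (u ^ a * v ^ b + u ^ b * v ^ a)
  * mon r x * \prod_(w <- x) gfun u w * \prod_(w <- x) gfun v w * dd x).
have fE u v : rootL u -> rootL v -> f u v = (v - u) * h u v.
  move=> ru rv; rewrite -E_scale; apply: eq_E => x _ _ /=.
  have u0 := rootL_neq0 ru; have v0 := rootL_neq0 rv.
  by rewrite big_cons -(gfunE ru rv) !expfzDr // !expr1z; ring.
have hC u v : h u v = h v u.
  by apply: eq_E => x _ _; rewrite (Hs [::]) //=; ring.
have e : avg (fun u => avg (f u)) = - avg (fun u => avg (f u)).
  rewrite {1}avg_exchange -mulN1r -avg_scale; apply: eq_avg => u ru.
  rewrite -avg_scale; apply: eq_avg => v rv.
  by rewrite -/(f v u) !fE // (hC v u); ring.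
by move/eqP: e; rewrite -addr_eq0 -mulr2n mulrn_eq0 /= => /eqP.
Qed.

Lemma rootL_qden' u w : rootL u -> rootL w -> 1 - q * (u / w) != 0.
Proof.
move=> ru rw; have w0 := rootL_neq0 rw; have := rootL_qden ru rw.
by apply: contra => /eqP h; apply/eqP; rewrite -(mulr0 w) -h; field.
Qed.

Lemma q_neq1 : 1 - q != 0.
Proof. by apply: contra qL; rewrite subr_eq0 => /eqP <-; rewrite expr1n. Qed.

Lemma det_schur n (A : 'M[K]_(1 + n)) : A 0 0 != 0 ->
  \det A = A 0 0 * \det (\matrix_(i < n, j < n)
     (A (rshift 1 i) (rshift 1 j) - A (rshift 1 i) 0 * A 0 (rshift 1 j) / A 0 0)).
Proof.
move=> a0; set S := \matrix_(i, j) _.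
have e : A = block_mx 1 0 ((A 0 0)^-1 *: dlsubmx A) 1 *m
    block_mx (ulsubmx A) (ursubmx A) 0 S.
  rewrite -[LHS]submxK mulmx_block !mul1mx !mul0mx !addr0.
  congr block_mx; apply/matrixP => i j; rewrite !mxE big_ord1 !mxE !ord1.
    by rewrite lshift0; field.
  by rewrite lshift0; field.
rewrite {1}e det_mulmx det_lblock det_ublock !det1 !mul1r; congr (_ * _).
by rewrite [ulsubmx A]mx11_scalar det_scalar1 !mxE lshift0.
Qed.

Definition hfun (y w : K) :=
  (1 - y / w) * (1 - w / y) / ((1 - q * (y / w)) * (1 - q * (w / y))).

Fixpoint PF (x : seq K) : K :=
  if x is y :: x' then (\prod_(w <- x') hfun y w) * PF x' else 1.

Definition Cmx (x : seq K) : 'M[K]_(size x) :=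
  \matrix_(i, j) (1 - q * (nth 0 x i / nth 0 x j))^-1.

(** Cauchy's determinant by Schur complements: eliminating y turns the entry 1 / (1 - q u / w) into
    [al] at u times that entry times [be] at w, and for each variable the two factors multiply to q
    times [hfun]. *)
Lemma det_Cmx x : all rootL x ->
  \det (Cmx x) = (1 - q)^-1 ^+ size x * q ^+ 'C(size x, 2) * PF x.
Proof.
elim: x => [|y x IH] /=; first by rewrite det_mx00 !expr0 !mulr1.
move=> /andP[ry rx]; have y0 := rootL_neq0 ry; have q1 := q_neq1.
have C00 : Cmx (y :: x) 0 0 = (1 - q)^-1 by rewrite mxE /= divff // mulr1.
rewrite (@det_schur (size x)) C00 ?invr_neq0 // invrK.
pose al i := (1 - nth 0 x i / y) / (1 - q * (nth 0 x i / y)).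
pose be i := q * (1 - y / nth 0 x i) / (1 - q * (y / nth 0 x i)).
have rn (i : 'I_(size x)) : rootL (nth 0 x i) by apply: (allP rx); exact: mem_nth.
rewrite (_ : \matrix_(i, j) _ =
    diag_mx (\row_(i < size x) al i) *m Cmx x *m diag_mx (\row_(i < size x) be i)); last first.
  apply/matrixP => i j; rewrite mul_mx_diag mul_diag_mx !mxE /=.
  have := rootL_qden (rn i) (rn j); have := rootL_qden ry (rn j).
  have := rootL_qden (rn i) ry; have := rootL_neq0 (rn j); have := rootL_neq0 (rn i).
  rewrite /al /be /=; move: (nth 0 x i) (nth 0 x j) => u v u0 v0 d1 d2 d3.
  by field; rewrite ?u0 ?v0 ?y0 ?d1 ?d2 ?d3.
have e : (\prod_i (\row_(i < size x) al i) 0 i) * (\prod_i (\row_(i < size x) be i) 0 i) =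
    q ^+ size x * \prod_(w <- x) hfun y w.
  rewrite (big_nth 0) big_mkord -[X in q ^+ X](card_ord (size x)) -prodr_const.
  transitivity (\prod_i ((\row_(i < size x) al i) 0 i * (\row_(i < size x) be i) 0 i)); first by rewrite big_split.
  transitivity (\prod_(i < size x) (q * hfun y (nth 0 x i))); last by rewrite big_split.
  apply: eq_bigr => i _; rewrite /= !mxE /al /be /hfun.
  have := rootL_qden ry (rn i); have := rootL_qden (rn i) ry.
  have := rootL_neq0 (rn i); move: (nth 0 x i) => u u0 d1 d2.
  by field; rewrite ?u0 ?y0 ?d1 ?d2.
rewrite !det_mulmx !det_diag IH // binS bin1 exprD exprS.
set P1 := \prod_i _ in e *; set P2 := \prod_i _ in e *.
transitivity ((1 - q)^-1 * (1 - q)^-1 ^+ size x * q ^+ 'C(size x, 2) * PF x * (P1 * P2)).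
  by ring.
by rewrite e; ring.
Qed.

Lemma PF_uniq x : all rootL x -> ~~ uniq x -> PF x = 0.
Proof.
elim: x => [|y x IH] //= /andP[ry rx].
rewrite negb_and negbK => /orP[yx|/IH ->]; rewrite ?mulr0 //.
by rewrite (big_rem y) //= /hfun divff ?rootL_neq0 // subrr !mul0r.
Qed.

Definition rho (u w : K) := (1 - q * (w / u)) / (1 - w / u).

(** For i < size x this is the product over j != i of (x_i - q x_j) / (x_i - x_j), the coefficient
    in Hall-Littlewood symmetrisation. *)
Fixpoint Qw (i : nat) (x : seq K) : K :=
  if x is y :: x' then
    if i is i'.+1 then rho (nth 0 x' i') y * Qw i' x' else \prod_(w <- x') rho y w
  else 1.

Lemma E_sw i n G : (i.+1 < n)%N -> E n (fun x => G (sw i x)) = E n G.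
Proof.
elim: i n G => [|i IH] [|n] G //=.
  by case: n => [|n] // _; rewrite [LHS]avg_exchange.
by move=> h; apply: eq_avg => y _; rewrite (IH n (fun x => G (y :: x))).
Qed.

Definition swap_invariant (F : seq K -> K) := forall x1 u v x2,
  F (x1 ++ u :: v :: x2) = F (x1 ++ v :: u :: x2).

Lemma swap_invariant_cons F y : swap_invariant F -> swap_invariant (fun x => F (y :: x)).
Proof. by move=> s x1 u v x2; exact: (s (y :: x1)). Qed.

Lemma swap_invariant_sw F i x : swap_invariant F -> F (sw i x) = F x.
Proof.
elim: i F x => [|i IH] F [|y x] //= s.
  by case: x => [|v x] //; rewrite (s [::]).
exact: (IH _ _ (swap_invariant_cons y s)).
Qed.

Lemma Qw_sw i x : (i.+1 < size x)%N -> Qw i.+1 (sw i x) = Qw i x.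
Proof.
elim: i x => [|i IH] [|y x] //.
  by case: x => [|v x] //= _; rewrite big_cons.
rewrite [size _]/= ltnS => h.
rewrite -[LHS]/(rho (nth 0 (sw i x) i.+1) y * Qw i.+1 (sw i x)) (IH x h).
rewrite -[RHS]/(rho (nth 0 x i) y * Qw i x); congr (rho _ _ * _).
by case: x h => [|u x] //=; elim: i {IH} u x => [|i IH] u [|v x] //=; exact: IH.
Qed.

Lemma E_Qw F n i : swap_invariant F -> (i < n)%N ->
  E n (fun x => F x * Qw i x) = E n (fun x => F x * Qw 0 x).
Proof.
move=> sF; elim: i => // i IH h; rewrite -IH; last exact: ltnW.
rewrite -(@E_sw i) //; apply: eq_E => x sx _.
by rewrite swap_invariant_sw // Qw_sw ?sx.
Qed.

(** Partial fractions in y: the product tends to 1 at infinity and has simple poles at the entries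
    of x, with residue (1 - q) x_i [Qw i x]. *)
Lemma Qw_partial_fraction y x : uniq (y :: x) -> all (fun u => u != 0) (y :: x) ->
  \prod_(w <- x) rho y w =
  1 + \sum_(i < size x) (1 - q) * nth 0 x i / (y - nth 0 x i) * Qw i x.
Proof.
elim: x y => [|w x IH] y; first by rewrite big_nil big_ord0 addr0.
rewrite big_cons /= inE negb_or => /and3P[/andP[yw yx] wx ux] /and3P[y0 w0 ax].
rewrite (IH y) /= ?yx ?ux ?y0 ?ax // big_ord_recl /= (IH w) /= ?wx ?ux ?w0 ?ax //.
have -> : rho y w = 1 + (1 - q) * w / (y - w).
  by rewrite /rho; field; rewrite y0 subr_eq0 yw.
set c := (1 - q) * w / (y - w).
have -> : \sum_(i < size x) (1 - q) * nth 0 x i / (y - nth 0 x i) * (rho (nth 0 x i) w * Qw i x)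
  = (1 + c) * (\sum_(i < size x) (1 - q) * nth 0 x i / (y - nth 0 x i) * Qw i x)
    - c * (\sum_(i < size x) (1 - q) * nth 0 x i / (w - nth 0 x i) * Qw i x).
  rewrite !mulr_sumr -sumrB; apply: eq_bigr => i _.
  have ix : nth 0 x i \in x by exact: mem_nth.
  have : nth 0 x i != y by apply: contraNneq yx => <-.
  have : nth 0 x i != w by apply: contraNneq wx => <-.
  have := allP ax _ ix; rewrite /rho /c; move: (nth 0 x i) (Qw i x) => u Q u0 uw uy.
  have := uw; have := uy; rewrite eq_sym => yu; rewrite eq_sym => wu.
  by field; rewrite !subr_eq0 ?u0 ?uw ?wu ?yw ?uy ?yu.
by ring.
Qed.

(** Adding a variable y turns the sum S into 1 + q S: for each old index the partial-fraction
    coefficient and the new factor [rho] at (x_i, y) add up to q. *)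
Lemma sum_Qw x : uniq x -> all (fun u => u != 0) x ->
  \sum_(i < size x) Qw i x = \sum_(i < size x) q ^+ i.
Proof.
elim: x => [|y x IH] u0 a0; first by rewrite !big_ord0.
have /andP[yx ux] := u0; have /andP[y0 ax] := a0.
rewrite !big_ord_recl expr0 [Qw _ _]/= Qw_partial_fraction // -addrA; congr (_ + _).
transitivity (q * \sum_(i < size x) Qw i x).
  rewrite mulr_sumr -big_split; apply: eq_bigr => i _ /=.
  have ix : nth 0 x i \in x by exact: mem_nth.
  have : nth 0 x i != y by apply: contraNneq yx => <-.
  have := allP ax _ ix; rewrite /rho; move: (nth 0 x i) (Qw i x) => u Q u1 uy.
  have := uy; rewrite eq_sym => yu.
  by field; rewrite !subr_eq0 ?u1 ?uy ?yu.
by rewrite IH // mulr_sumr; apply: eq_bigr => i _; rewrite -exprS.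
Qed.

Lemma hfunC u w : hfun u w = hfun w u.
Proof. by rewrite /hfun; congr (_ / _); exact: mulrC. Qed.

Lemma PF_swap_invariant : swap_invariant PF.
Proof.
elim=> [|y x1 IH] u v x2 /=; last first.
  by rewrite IH; congr (_ * _); rewrite !big_cat !big_cons /=; ring.
by rewrite !big_cons hfunC; ring.
Qed.

Lemma gfun_hfun y w : rootL y -> rootL w -> gfun y w = hfun y w * rho y w.
Proof.
move=> ry rw; have y0 := rootL_neq0 ry; have w0 := rootL_neq0 rw.
(* On the diagonal [rho] divides by zero, but both sides vanish. *)
have [->|yw] := eqVneq y w; first by rewrite /gfun /hfun divff // subrr !mul0r.
have d1 := rootL_qden ry rw; have d2 := rootL_qden rw ry.
have := yw; rewrite eq_sym => wy.
by rewrite /gfun /hfun /rho; field; rewrite ?y0 ?w0 ?d1 ?d2 ?subr_eq0 ?yw ?wy.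
Qed.

(* symmetrising dd over which variable comes first turns it into the symmetric PF *)
Lemma E_dd_PF n F : swap_invariant F ->
  E n (fun x => F x * dd x) =
  (\prod_(m < n) ((\sum_(i < m.+1) q ^+ i) / m.+1%:R)) * E n (fun x => F x * PF x).
Proof.
elim: n F => [|n IH] F sF; first by rewrite big_ord0 mul1r.
rewrite big_ord_recr [LHS]/=; set kap := \prod_(m < n) _.
transitivity (kap * E n.+1 (fun x => F x * PF x * Qw 0 x)).
  rewrite -avg_scale; apply: eq_avg => y ry.
  transitivity (E n (fun x => F (y :: x) * (\prod_(w <- x) gfun y w) * dd x)).
    by apply: eq_E => x _ _; rewrite mulrA.
  rewrite IH; last first.
    move=> x1 u v x2; rewrite -cat_cons sF; congr (_ * _).
    by rewrite !big_cat !big_cons /=; ring.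
  rewrite -/kap; congr (_ * _); apply: eq_E => x _ rx.
  rewrite /= (eq_big_seq (fun w => hfun y w * rho y w)) => [|w wx]; last first.
    by apply: gfun_hfun => //; exact: (allP rx).
  by rewrite big_split /=; ring.
rewrite -mulrA; congr (_ * _).
have sFP : swap_invariant (fun x => F x * PF x).
  by move=> x1 u v x2; rewrite sF PF_swap_invariant.
have n0 : n.+1%:R != 0 :> K by rewrite pnatr_eq0.
apply: (mulfI n0); rewrite [RHS]mulrA [n.+1%:R * (_ / _)]mulrC divfK //.
(* By symmetry of F and [PF] any variable may be the distinguished one; n + 1 equal averages become
   the sum of all [Qw i]. *)
transitivity (\sum_(i < n.+1) E n.+1 (fun x => F x * PF x * Qw i x)).
  rewrite (eq_bigr (fun=> E n.+1 (fun x => F x * PF x * Qw 0 x))) => [|i _].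
    by rewrite sumr_const card_ord -[RHS]mulr_natl.
  exact: (E_Qw (i := i) sFP).
rewrite -E_sum -E_scale; apply: eq_E => x sx rx.
rewrite -mulr_sumr -sx mulrC.
(* The identity for the sum of the [Qw i] needs distinct points; at coinciding points [PF] is
   zero. *)
case: (boolP (uniq x)) => [ux|/(PF_uniq rx) ->]; last by rewrite !(mulr0, mul0r).
by rewrite sum_Qw //; apply: sub_all rx => y; exact: rootL_neq0.
Qed.

(** The n! comes from symmetrising and q^C(n,2) from the Cauchy determinant, while (1 - q)^n times
    the q-integers of the symmetrisation is (q;q)_n. *)
Lemma E_dd_Cmx n F : swap_invariant F ->
  n`!%:R * q ^+ 'C(n, 2) * E n (fun x => F x * dd x) =
  (\prod_(m < n) (1 - q ^+ m.+1)) * E n (fun x => F x * \det (Cmx x)).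
Proof.
move=> sF; rewrite E_dd_PF //.
have -> : E n (fun x => F x * \det (Cmx x)) =
    (1 - q)^-1 ^+ n * q ^+ 'C(n, 2) * E n (fun x => F x * PF x).
  by rewrite -E_scale; apply: eq_E => x sx rx; rewrite det_Cmx // sx; ring.
have q1 := q_neq1.
have -> : \prod_(m < n) (1 - q ^+ m.+1) =
    (1 - q) ^+ n * \prod_(m < n) (\sum_(i < m.+1) q ^+ i).
  rewrite -[X in _ ^+ X](card_ord n) -prodr_const -big_split; apply: eq_bigr => m _ /=.
  by rewrite -opprB subrX1 -mulNr opprB.
have <- : n`!%:R * (\prod_(m < n) ((\sum_(i < m.+1) q ^+ i) / m.+1%:R)) =
    \prod_(m < n) (\sum_(i < m.+1) q ^+ i).
  elim: n {sF F} => [|n IH]; first by rewrite !big_ord0 mulr1.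
  rewrite !big_ord_recr /= -IH factS natrM.
  have : n.+1%:R != 0 :> K by rewrite pnatr_eq0.
  by move: n.+1%:R => c c0; field.
by rewrite exprVn; field; rewrite expf_neq0.
Qed.

Lemma avg_exprz (c : int) : avg (fun y => y ^ c) = (L %| `|c|)%N%:R.
Proof.
have z0 : z != 0.
  by apply: rootL_neq0; rewrite -(expr1 z); exact: rootL_z.
have L0 : L%:R != 0 :> K by rewrite pnatr_eq0 -lt0n.
have zcL : (z ^ c) ^+ L = 1.
  by rewrite exprnP exprz_exp mulrC -exprz_exp -exprnP (prim_expr_order zP) exp1rz.
have e : \sum_(i < L) (z ^+ i) ^ c = \sum_(i < L) (z ^ c) ^+ i.
  by apply: eq_bigr => i _; rewrite !exprnP !exprz_exp mulrC.
rewrite /avg e; have dv : (L %| `|c|)%N = (z ^ c == 1).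
  have [n [->|->]] : exists n : nat, c = n \/ c = - n%:Z.
    by exists `|c|%N; case: (leP 0 c) => ?; [left|right]; lia.
    by rewrite (prim_order_dvd zP).
  by rewrite abszN (prim_order_dvd zP) -exprnN invr_eq1.
rewrite dv; case: eqP => [->|/eqP zc1].
  by under eq_bigr do rewrite expr1n; rewrite sumr_const card_ord mulVf.
apply/eqP; rewrite mulf_eq0; apply/orP; right.
have := subrX1 (z ^ c) L; rewrite zcL subrr => /esym/eqP.
by rewrite mulf_eq0 subr_eq0 (negbTE zc1).
Qed.

Lemma E_prod n (phi : nat -> K -> K) :
  E n (fun x => \prod_(i < n) phi i (nth 0 x i)) = \prod_(i < n) avg (phi i).
Proof.
elim: n phi => [|n IH] phi; first by rewrite /= !big_ord0.
rewrite big_ord_recl -(IH (fun i => phi i.+1)) mulrC -avg_scale /=.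
apply: eq_avg => y _; rewrite mulrC -E_scale; apply: eq_E => x _ _.
by rewrite big_ord_recl.
Qed.

Lemma monE n v x : size v = n -> size x = n ->
  mon v x = \prod_(i < n) nth 0 x i ^ nth 0 v i.
Proof.
elim: n v x => [|n IH] [|c v] [|y x] //=; first by rewrite big_ord0.
by move=> [sv] [sx]; rewrite big_ord_recl /= IH.
Qed.

Fixpoint words (n : nat) : seq (seq nat) :=
  if n is n'.+1 then [seq i :: w | i <- iota 0 L, w <- words n'] else [:: [::]].

Lemma size_words n w : w \in words n -> size w = n /\ all (fun k => k < L)%N w.
Proof.
elim: n w => [|n IH] w; first by rewrite inE => /eqP ->.
move=> /allpairsPdep[i [w' [+ /IH[<- aw] ->]]].
by rewrite mem_iota /= => ->.
Qed.

Lemma sum_words n (phi : nat -> nat -> K) :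
  \sum_(w <- words n) \prod_(i < n) phi i (nth 0%N w i) =
  \prod_(i < n) \sum_(k < L) phi i k.
Proof.
elim: n phi => [|n IH] phi; first by rewrite big_seq1 !big_ord0.
rewrite big_ord_recl /= big_allpairs_dep sum_iota_ord big_distrl; apply: eq_bigr => k _.
rewrite -(IH (fun i => phi i.+1)) /= mulr_sumr; apply: eq_bigr => w _.
by rewrite big_ord_recl.
Qed.

Lemma det_sum_words n (A : nat -> nat -> 'I_n -> K) :
  \det (\matrix_(i < n, j < n) \sum_(k < L) A i k j) =
  \sum_(w <- words n) \det (\matrix_(i < n, j < n) A i (nth 0%N w i) j).
Proof.
rewrite exchange_big /=; apply: eq_bigr => s _; rewrite -mulr_sumr; congr (_ * _).
transitivity (\prod_(i < n) \sum_(k < L) A i k (s i)).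
  by apply: eq_bigr => i _; rewrite mxE.
pose phi i k := if insub i is Some i' then A i k (s i') else 0.
transitivity (\prod_(i < n) \sum_(k < L) phi i k).
  by apply: eq_bigr => i _; apply: eq_bigr => k _; rewrite /phi valK.
rewrite -sum_words; apply: eq_bigr => w _; apply: eq_bigr => i _.
by rewrite mxE /phi valK.
Qed.

(* The antisymmetrised coefficient of x^w, with exponents only known modulo L. *)
Definition detL (w : seq nat) (v : seq int) : K :=
  \det (\matrix_(i < size v, j < size v) (dvdn L (absz (nth 0 v i - (nth 0%N w j)%:Z)%R))%:R).

Lemma E_mon_det w v n : size v = n ->
  E n (fun x => mon v x * \det (\matrix_(i < n, j < n) nth 0 x j ^ - (nth 0%N w i)%:Z)) =
  detL w v.
Proof.
move=> <-; rewrite /detL.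
under eq_E => x sx rx.
  rewrite (monE (erefl _) sx) -det_tr mulr_sumr.
  over.
rewrite E_sum; apply: eq_bigr => s _.
transitivity (E (size v) (fun x => (-1) ^+ s *
    \prod_(i < size v) nth 0 x i ^ (nth 0 v i - (nth 0%N w (s i))%:Z))).
  apply: eq_E => x sx rx; rewrite mulrCA; congr (_ * _).
  rewrite -big_split; apply: eq_bigr => i _; rewrite /= !mxE expfzDr //.
  by apply/rootL_neq0/(allP rx)/mem_nth; rewrite sx.
rewrite E_scale; congr (_ * _).
pose phi i := if insub i is Some i' then
  fun y : K => y ^ (nth 0 v i - (nth 0%N w (s i'))%:Z) else fun=> 0.
transitivity (E (size v) (fun x => \prod_(i < size v) phi i (nth 0 x i))).
  by apply: eq_E => x _ _; apply: eq_bigr => i _; rewrite /phi valK.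
rewrite E_prod; apply: eq_bigr => i _; rewrite mxE /phi valK.
exact: avg_exprz.
Qed.

(** For t^L = 1 the geometric series folds to 1 / (1 - q t) = (1 - q^L)^(-1) sum_(k < L) (q t)^k.
    Expanding the determinant row by row then gives one term per word of exponents. *)
Lemma E_det_Cmx n F : E n (fun x => F x * \det (Cmx x)) =
  (1 - q ^+ L)^-1 ^+ n * \sum_(w <- words n) q ^+ sumn w *
     E n (fun x => F x * (mon [seq k%:Z | k <- w] x *
       \det (\matrix_(i < n, j < n) nth 0 x j ^ - (nth 0%N w i)%:Z))).
Proof.
rewrite mulr_sumr; under [RHS]eq_bigr => w _ do rewrite -!E_scale.
rewrite -E_sum; apply: eq_E => x sx rx; case: n / sx.
have qL1 : 1 - q ^+ L != 0 by rewrite subr_eq0 eq_sym.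
have ri (i : 'I_(size x)) : rootL (nth 0 x i) by apply: (allP rx); exact: mem_nth.
pose A (i k : nat) (j : 'I_(size x)) := (1 - q ^+ L)^-1 * q ^+ k * nth 0 x i ^ k%:Z *
  nth 0 x j ^ - k%:Z.
have -> : Cmx x = \matrix_(i < size x, j < size x) \sum_(k < L) A i k j.
  apply/matrixP => i j; rewrite !mxE; set t := nth 0 x i / nth 0 x j.
  have tL : t ^+ L = 1.
    by rewrite expr_div_n (eqP (ri i)) (eqP (ri j)) divr1.
  have := subrX1 (q * t) L; rewrite exprMn tL mulr1 => e.
  have d := rootL_qden' (ri i) (ri j).
  have -> : \sum_(k < L) A i k j = (1 - q ^+ L)^-1 * \sum_(k < L) (q * t) ^+ k.
    rewrite mulr_sumr; apply: eq_bigr => k _.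
    by rewrite /A -exprnP -exprnN exprMn expr_div_n !mulrA.
  apply: (mulIf d); rewrite mulVf // -mulrA.
  have -> : (\sum_(k < L) (q * t) ^+ k) * (1 - q * t) = 1 - q ^+ L.
    by rewrite -[RHS]opprB e; ring.
  by rewrite mulVf.
rewrite det_sum_words mulr_sumr; apply: eq_big_seq => w /size_words[sw _].
rewrite (_ : \matrix_(i, j) A i _ j = diag_mx (\row_(i < size x) ((1 - q ^+ L)^-1 *
    q ^+ nth 0%N w i * nth 0 x i ^ (nth 0%N w i)%:Z)) *m
    \matrix_(i < size x, j < size x) nth 0 x j ^ - (nth 0%N w i)%:Z); last first.
  by apply/matrixP => i j; rewrite mul_diag_mx !mxE /A.
rewrite det_mulmx det_diag (monE (n := size x)) ?size_map //.
under eq_bigr do rewrite mxE; rewrite !big_split /= prodr_const card_ord.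
have -> : \prod_(i < size x) q ^+ nth 0%N w i = q ^+ sumn w.
  by rewrite prodrXr sumnE (big_nth 0%N) big_mkord sw.
under [in RHS]eq_bigr => i _ do rewrite (nth_map 0%N) ?sw //.
by ring.
Qed.

Definition stepf (al be : K) (d : int) (x : seq K) :=
  \prod_(y <- x) (y ^ d * (be + al * y)).

Lemma swap_invariant_stepf al be d : swap_invariant (stepf al be d).
Proof. by move=> x1 u v x2; rewrite /stepf !big_cat !big_cons /=; ring. Qed.

Lemma Ex_mon al be d v x : size v = size x -> all rootL x ->
  stepf al be d x * mon v x = Ex al be d (fun v' => mon v' x) v.
Proof.
rewrite /stepf; elim: v x => [|c v IH] [|y x] //=; first by rewrite big_nil mul1r.
move=> [sv] /andP[ry rx]; rewrite !Ex_scale -IH // big_cons.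
by rewrite !expfzDr ?rootL_neq0 // expr1z; ring.
Qed.

Lemma E_Ex n al be d v (H : seq K -> seq int -> K) :
  E n (fun x => Ex al be d (H x) v) = Ex al be d (fun v' => E n (H^~ v')) v.
Proof.
elim: v H => [|c v IH] H //=.
by rewrite E_add !E_scale (IH (fun x l => H x (c + d + 1 :: l)))
  (IH (fun x l => H x (c + d :: l))).
Qed.

Lemma E_stepf n al be d v W : size v = n ->
  E n (fun x => stepf al be d x * (mon v x * W x)) =
  Ex al be d (fun v' => E n (fun x => mon v' x * W x)) v.
Proof.
move=> sv; rewrite -(E_Ex n al be d v (fun x v' => mon v' x * W x)).
apply: eq_E => x sx rx; rewrite mulrA Ex_mon // ?sv //.
rewrite mulrC -Ex_scale; apply: eq_Ex => l; exact: mulrC.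
Qed.

Fixpoint FU (xs : seq K) (x : seq K) : K :=
  if xs is a :: xs' then stepf a 1 0 x * FU xs' x else 1.

Fixpoint FD (xs : seq K) (x : seq K) : K :=
  if xs is b :: xs' then stepf 1 b (-1) x * FD xs' x else 1.

Lemma swap_invariant_FUD as_ bs : swap_invariant (fun x => FU as_ x * FD bs x).
Proof.
move=> x1 u v x2; congr (_ * _).
  by elim: as_ => //= a s ->; rewrite swap_invariant_stepf.
by elim: bs => //= a s ->; rewrite swap_invariant_stepf.
Qed.

Lemma E_FU n as_ v W : size v = n ->
  E n (fun x => FU as_ x * (mon v x * W x)) =
  ExU as_ (fun v' => E n (fun x => mon v' x * W x)) v.
Proof.
elim: as_ v W => [|a s IH] v W sv /=.
  by apply: eq_E => x _ _; rewrite mul1r.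
transitivity (E n (fun x => FU s x * (mon v x * (stepf a 1 0 x * W x)))).
  by apply: eq_E => x _ _; ring.
rewrite IH //; apply: eq_ExU_near => w /near_seq_size sw.
rewrite -E_stepf ?sw //; last by rewrite -sw.
by apply: eq_E => x _ _; ring.
Qed.

Lemma E_FD n bs v W : size v = n ->
  E n (fun x => FD bs x * (mon v x * W x)) =
  ExD bs (fun v' => E n (fun x => mon v' x * W x)) v.
Proof.
elim: bs v W => [|b s IH] v W sv /=.
  by apply: eq_E => x _ _; rewrite mul1r.
transitivity (E n (fun x => stepf 1 b (-1) x * (mon v x * (FD s x * W x)))).
  by apply: eq_E => x _ _; ring.
rewrite E_stepf //; apply: eq_Ex_near => // w /near_seq_size sw.
rewrite -IH -?sw //; by apply: eq_E => x _ _; ring.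
Qed.

Definition DL (v : seq int) := E (size v) (fun x => mon v x * dd x).

Lemma E_FUD n as_ bs v W : size v = n ->
  E n (fun x => FU as_ x * FD bs x * (mon v x * W x)) =
  ExU as_ (ExD bs (fun v' => E n (fun x => mon v' x * W x))) v.
Proof.
move=> sv; transitivity (E n (fun x => FU as_ x * (mon v x * (FD bs x * W x)))).
  by apply: eq_E => x _ _; ring.
rewrite E_FU //; apply: eq_ExU_near => w /near_seq_size sw.
by rewrite -E_FD -?sw //; apply: eq_E => x _ _; ring.
Qed.

Lemma ExUD_DL as_ bs n :
  n`!%:R * q ^+ 'C(n, 2) * ExU as_ (ExD bs DL) (nseq n 0) =
  (\prod_(m < n) (1 - q ^+ m.+1)) * (1 - q ^+ L)^-1 ^+ n *
  \sum_(w <- words n) q ^+ sumn w * ExU as_ (ExD bs (detL w)) [seq k%:Z | k <- w].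
Proof.
have -> : ExU as_ (ExD bs DL) (nseq n 0) = E n (fun x => FU as_ x * FD bs x * dd x).
  transitivity (E n (fun x => FU as_ x * FD bs x * (mon (nseq n 0) x * dd x))).
    rewrite E_FUD ?size_nseq //; apply: eq_ExU_near => v /near_seq_size sv.
    apply: eq_ExD_near => w /near_seq_size sw.
    by rewrite /DL -sw -sv size_nseq.
  apply: eq_E => x sx _; congr (_ * _); rewrite (monE (n := n)) ?size_nseq //.
  by rewrite big1 ?mul1r // => i _; rewrite nth_nseq if_same expr0z.
rewrite E_dd_Cmx; last exact: swap_invariant_FUD.
rewrite E_det_Cmx mulrA; congr (_ * _); apply: eq_big_seq => w /size_words[sw _].
rewrite E_FUD ?size_map //; congr (_ * _).
apply: eq_ExU_near => v /near_seq_size sv; apply: eq_ExD_near => u /near_seq_size su.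
by rewrite E_mon_det // -su -sv size_map.
Qed.
(* The geometric expansion of gfun, folded using (y / w)^L = 1. *)
Definition gcoef (k : nat) : K :=
  if k is k'.+1 then (q - 1) * q ^+ k' / (1 - q ^+ L) else 1.

Lemma gfun_expand y w : rootL y -> rootL w ->
  gfun y w = \sum_(k < L.+1) gcoef k * (y ^ k%:Z * w ^ - k%:Z).
Proof.
move=> ry rw; have qL1 : 1 - q ^+ L != 0 by rewrite subr_eq0 eq_sym.
have d := rootL_qden' ry rw; rewrite big_ord_recl /= expr0z oppr0 expr0z !mulr1.
set t := y / w in d *; have tL : t ^+ L = 1 by rewrite expr_div_n (eqP ry) (eqP rw) divr1.
have := subrX1 (q * t) L; rewrite exprMn tL mulr1 => e.
have -> : \sum_(i < L) gcoef (lift ord0 i) * (y ^ (lift ord0 i)%:Z * w ^ - (lift ord0 i)%:Z)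
    = (q - 1) / (1 - q ^+ L) * t * \sum_(k < L) (q * t) ^+ k.
  rewrite mulr_sumr; apply: eq_bigr => k _; rewrite lift0 /gcoef.
  rewrite -exprnP -exprnN /t exprMn !expr_div_n !exprS !invfM.
  by ring.
have -> : \sum_(k < L) (q * t) ^+ k = (1 - q ^+ L) / (1 - q * t).
  by apply: (mulIf d); rewrite mulfVK // -[RHS]opprB e; ring.
by rewrite /gfun -/t; field; rewrite d qL1.
Qed.

Lemma Tk_avg (c : nat -> K) (Phi : K -> nat -> seq int -> K) v :
  avg (fun y => Tk L c (Phi y) v) = Tk L c (fun s l => avg (fun y => Phi y s l)) v.
Proof.
elim: v Phi => [|a v IH] Phi //=; rewrite avg_sum; apply: eq_bigr => k _.
by rewrite avg_scale (IH (fun y s l => Phi y (k + s)%N (a - k%:Z :: l))).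
Qed.

Lemma Tk_E n (c : nat -> K) (Phi : seq K -> nat -> seq int -> K) v :
  E n (fun x => Tk L c (Phi x) v) = Tk L c (fun s l => E n (fun x => Phi x s l)) v.
Proof.
elim: v Phi => [|a v IH] Phi //=; rewrite E_sum; apply: eq_bigr => k _.
by rewrite E_scale (IH (fun y s l => Phi y (k + s)%N (a - k%:Z :: l))).
Qed.

Lemma Tk_mon v x y (W : K) (c : int) : size v = size x -> rootL y -> all rootL x ->
  y ^ c * mon v x * (\prod_(w <- x) gfun y w) * W =
  Tk L gcoef (fun s l => y ^ (c + s%:Z) * mon l x * W) v.
Proof.
move=> + ry; elim: v x c W => [|a v IH] [|u x] c W //=.
  by rewrite big_nil addr0 !mulr1.
move=> [sv] /andP[ru rx]; rewrite big_cons gfun_expand //.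
transitivity ((\sum_(k < L.+1) gcoef k * (y ^ k%:Z * u ^ - k%:Z)) *
   (u ^ a * (y ^ c * mon v x * \prod_(j <- x) gfun y j * W))); first by ring.
rewrite mulr_suml; apply: eq_bigr => k _; rewrite -mulrA; congr (_ * _).
transitivity (y ^ (c + k%:Z) * mon v x * (\prod_(j <- x) gfun y j) * (u ^ (a - k%:Z) * W)).
  by rewrite !expfzDr ?rootL_neq0 //; ring.
rewrite IH //; apply: eq_Tk => s l _; rewrite PoszD addrA; ring.
Qed.

(** Averaging over the first variable keeps only those shifts s for which L divides c + s, which
    gives a recursion on the number of variables. *)
Lemma DL_cons c v : DL (c :: v) =
  Tk L gcoef (fun s l => (dvdn L (absz (c + s%:Z)%R))%:R * DL l) v.
Proof.
transitivity (avg (fun y => E (size v) (fun x =>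
    Tk L gcoef (fun s l => y ^ (c + s%:Z) * mon l x * dd x) v))).
  apply: eq_avg => y ry; apply: eq_E => x sx rx.
  by rewrite -Tk_mon //= mulrA.
transitivity (avg (fun y => Tk L gcoef (fun s l => y ^ (c + s%:Z) *
    E (size v) (fun x => mon l x * dd x)) v)).
  apply: eq_avg => y ry; rewrite Tk_E; apply: eq_Tk => s l _.
  by rewrite -E_scale; apply: eq_E => x _ _; rewrite mulrA.
rewrite Tk_avg; apply: eq_Tk => s l sl; rewrite /DL sl mulrC -avg_exprz -avg_scale.
by apply: eq_avg => y _; rewrite mulrC.
Qed.

Lemma DL_nil : DL [::] = 1.
Proof. by rewrite /DL /= mulr1. Qed.

Lemma straight_DL : straight q DL.
Proof.
move=> l a b r; have sD (c d : int) : DL (l ++ c :: d :: r) =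
    E (size l + (size r).+2) (fun u => mon (l ++ c :: d :: r) u * dd u).
  by rewrite /DL size_cat.
apply/eqP; rewrite -subr_eq0; apply/eqP; rewrite !sD -!E_add -E_scale -mulN1r -E_scale -E_add.
rewrite -[RHS](@E_straight l r a b (fun=> 1)) //.
by apply: eq_E => x _ _; ring.
Qed.
End RootAverage.

(** * Passing from complex averages to real functionals *)

Section RealFunctional.
Variables (R : realType) (q : R).
Hypotheses (q_gt0 : 0 < q) (q_lt1 : q < 1).
Implicit Types (v l : seq int).

Local Notation Cx := (R[i]).
Local Notation toC := (fun x : R => (x%:C)%C).
Local Notation ReC := (@complex.Re R).

Lemma prim_root_exists (L : nat) : (0 < L)%N -> exists z : Cx, L.-primitive_root z.
Proof.
move=> L0; pose p : {poly Cx} := 'X^L - 1.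
have [r Dp] := closed_field_poly_normal p.
rewrite (monicP _) ?monicXnsubC // scale1r in Dp.
have rn1 : all L.-unity_root r by apply/allP => z; rewrite -root_prod_XsubC -Dp.
have szr : (L < (size r).+1)%N by rewrite -(size_prod_XsubC r id) -Dp size_XnsubC.
have [|z] := hasP (has_prim_root L0 rn1 _ szr); last by exists z.
by rewrite -separable_prod_XsubC -Dp separable_Xn_sub_1 // pnatr_eq0 -lt0n.
Qed.

Definition zeta (L : nat) : Cx := xget 1 [set z | L.-primitive_root z].

Lemma zetaP L : (0 < L)%N -> L.-primitive_root (zeta L).
Proof. by move=> /prim_root_exists[z zP]; rewrite /zeta; case: xgetP => // /(_ z). Qed.

Lemma ReC_add w w' : ReC (w + w') = ReC w + ReC w'.
Proof. by case: w; case: w'. Qed.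

Lemma ReC_scale (x : R) w : ReC (toC x * w) = x * ReC w.
Proof. by case: w => a b /=; rewrite mul0r subr0. Qed.

Lemma ReC_sum I (s : seq I) (P : pred I) (F : I -> Cx) :
  ReC (\sum_(i <- s | P i) F i) = \sum_(i <- s | P i) ReC (F i).
Proof. by apply: (big_morph ReC ReC_add). Qed.

Lemma toCE (x : R) : ReC (toC x) = x. Proof. by []. Qed.

Lemma ReC_Ex al be d (D : seq int -> Cx) v :
  ReC (Ex (toC al) (toC be) d D v) = Ex al be d (fun l => ReC (D l)) v.
Proof. by elim: v D => [|c v IH] D //=; rewrite ReC_add !ReC_scale !IH. Qed.

Lemma ReC_ExU as_ (D : seq int -> Cx) v :
  ReC (ExU (map toC as_) D v) = ExU as_ (fun l => ReC (D l)) v.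
Proof.
elim: as_ D v => [|a s IH] D v //=; rewrite IH; apply: eq_ExU_near => w _.
by rewrite -ReC_Ex.
Qed.

Lemma ReC_ExD bs (D : seq int -> Cx) v :
  ReC (ExD (map toC bs) D v) = ExD bs (fun l => ReC (D l)) v.
Proof.
by elim: bs v => [|b s IH] v //=; rewrite (ReC_Ex 1); apply: eq_Ex_near.
Qed.

Lemma ReC_Tk L (c : nat -> R) (Phi : nat -> seq int -> Cx) v :
  ReC (Tk L (fun k => toC (c k)) Phi v) = Tk L c (fun s l => ReC (Phi s l)) v.
Proof.
elim: v Phi => [|a v IH] Phi //=; rewrite ReC_sum; apply: eq_bigr => k _.
by rewrite ReC_scale IH.
Qed.

(** All coefficients occurring in the identities are real, so they survive taking real parts and the
    estimates can be made over R. *)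
Definition Dr (L : nat) v : R := ReC (DL L (zeta L) (toC q) v).

Lemma toC_qL L : (0 < L)%N -> toC q ^+ L != 1.
Proof.
move=> L0; rewrite -rmorphXn -(rmorph1 (real_complex R)) (inj_eq (fmorph_inj _)).
by rewrite lt_eqF // exprn_ilt1 ?(ltW q_gt0) // -lt0n.
Qed.

Lemma Dr_nil L : Dr L [::] = 1.
Proof. by rewrite /Dr DL_nil. Qed.

Lemma straight_Dr L : (0 < L)%N -> straight q (Dr L).
Proof.
move=> L0 l a b r.
have := congr1 ReC (straight_DL L0 (zetaP L0) (toC_qL L0) l a b r).
by rewrite ReC_scale !ReC_add.
Qed.

Lemma Dr_cons L c v : (0 < L)%N -> Dr L (c :: v) =
  Tk L (gcoef L q) (fun s l => (dvdn L (absz (c + s%:Z)%R))%:R * Dr L l) v.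
Proof.
move=> L0; rewrite /Dr DL_cons ?zetaP ?toC_qL //.
transitivity (Tk L (gcoef L q) (fun s l => ReC
    ((dvdn L (absz (c + s%:Z)%R))%:R * DL L (zeta L) (toC q) l)) v); last first.
  apply: eq_Tk => s l _; rewrite -ReC_scale; congr (ReC (_ * _)).
  by rewrite rmorph_nat.
rewrite -ReC_Tk; congr (ReC (Tk _ _ _ _)); apply/funext => -[|k] /=.
  by rewrite rmorph1.
by rewrite fmorph_div !(rmorphM, rmorphB, rmorphXn, rmorph1).
Qed.

Lemma ReC_detL L w v : ReC (detL Cx L w v) = detL R L w v.
Proof.
rewrite /detL -[RHS]toCE; congr ReC; rewrite -det_map_mx; congr (\det _).
by apply/matrixP => i j; rewrite !mxE rmorph_nat.
Qed.

Lemma ExUD_Dr as_ bs n L : (0 < L)%N ->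
  n`!%:R * q ^+ 'C(n, 2) * ExU as_ (ExD bs (Dr L)) (nseq n 0) =
  qpoch q q n * (1 - q ^+ L)^-1 ^+ n *
  \sum_(w <- words L n) q ^+ sumn w * ExU as_ (ExD bs (detL R L w)) [seq k%:Z | k <- w].
Proof.
move=> L0.
have := congr1 ReC (ExUD_DL L0 (zetaP L0) (toC_qL L0) (map toC as_) (map toC bs) n).
have X D v : ReC (ExU (map toC as_) (ExD (map toC bs) D) v) =
    ExU as_ (ExD bs (fun l => ReC (D l))) v.
  by rewrite ReC_ExU; apply: eq_ExU_near => w _; exact: ReC_ExD.
have -> : n`!%:R * toC q ^+ 'C(n, 2) = toC (n`!%:R * q ^+ 'C(n, 2)).
  by rewrite rmorphM rmorphXn rmorph_nat.
rewrite ReC_scale X => ->.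
have -> : (\prod_(m < n) (1 - toC q ^+ m.+1)) * (1 - toC q ^+ L)^-1 ^+ n =
    toC (qpoch q q n * (1 - q ^+ L)^-1 ^+ n).
  rewrite rmorphM rmorph_prod; congr (_ * _).
    by apply: eq_bigr => m _; rewrite rmorphB rmorphM rmorph1 rmorphXn exprS.
  by rewrite rmorphXn fmorphV rmorphB rmorph1 rmorphXn.
rewrite ReC_scale ReC_sum; congr (_ * _); apply: eq_bigr => w _.
rewrite -rmorphXn ReC_scale X; congr (_ * _).
apply: eq_ExU_near => v _; apply: eq_ExD_near => u _; exact: ReC_detL.
Qed.
End RealFunctional.

(** * Wrap-around estimates and the limit of many roots of unity *)

Section RealFunctionalLimits.
Variables (R : realType) (q : R).
Hypotheses (q_gt0 : 0 < q) (q_lt1 : q < 1).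
Implicit Types (v l : seq int).

Definition subseq_nat (v : seq int) (ks : seq nat) : seq int :=
  [seq p.1 - p.2%:Z | p <- zip v ks].

Lemma Tk_bound L (c : nat -> R) (Phi : nat -> seq int -> R) v (t M : R) :
  0 <= t ->
  (forall ks, size ks = size v ->
     `|Phi (sumn ks) (subseq_nat v ks)| <= M * t ^+ sumn ks) ->
  `|Tk L c Phi v| <= M * (\sum_(k < L.+1) `|c k| * t ^+ k) ^+ size v.
Proof.
move=> t0; elim: v Phi M => [|a v IH] Phi M h /=.
  by have := h [::] erefl; rewrite !expr0.
apply: (le_trans (ler_norm_sum _ _ _)).
rewrite exprS mulrCA mulr_suml; apply: ler_sum => k _; rewrite normrM -mulrA.
apply: ler_wpM2l => //; rewrite mulrA [t ^+ k * M]mulrC; apply: IH => ks sk.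
by have := h (nat_of_ord k :: ks); rewrite /= sk exprD mulrA => /(_ erefl).
Qed.

Lemma Tk_add L (c : nat -> R) (Phi Psi : nat -> seq int -> R) v :
  Tk L c (fun s l => Phi s l + Psi s l) v = Tk L c Phi v + Tk L c Psi v.
Proof.
elim: v Phi Psi => [|a v IH] Phi Psi //=.
by rewrite -big_split; apply: eq_bigr => k _; rewrite IH mulrDr.
Qed.

Lemma Tk_eq0 L (c : nat -> R) (Phi : nat -> seq int -> R) v :
  (forall s l, Phi s l = 0) -> Tk L c Phi v = 0.
Proof.
elim: v Phi => [|a v IH] Phi h //=.
by apply: big1 => k _; rewrite IH ?mulr0.
Qed.

Lemma Tk_delta L (c : nat -> R) (Phi : seq int -> R) v : c 0%N = 1 ->
  Tk L c (fun s l => (s == 0)%N%:R * Phi l) v = Phi v.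
Proof.
move=> c0; elim: v Phi => [|a v IH] Phi /=; first by rewrite mul1r.
rewrite big_ord_recl big1 ?addr0 => [|k _].
  rewrite c0 mul1r -(IH (fun l => Phi (a :: l))).
  by apply: eq_Tk => s l _; congr (_ * Phi (_ :: l)); exact: subr0.
by rewrite Tk_eq0 ?mulr0 // => s l; rewrite lift0 mul0r.
Qed.

(* Exponents are only seen modulo L, but a wrap-around needs a total shift s >= L, where
   1 <= r^L t^s, while the t-weighted sum of |gcoef k| stays bounded. *)
Let r := Num.sqrt q.
Let t := r^-1.

Lemma r_gt0 : 0 < r. Proof. by rewrite sqrtr_gt0. Qed.
Lemma r_lt1 : r < 1. Proof. by rewrite -sqrtr1 ltr_sqrt. Qed.
Lemma r_sqr : r ^+ 2 = q. Proof. by rewrite sqr_sqrtr // ltW. Qed.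
Lemma t_ge1 : 1 <= t. Proof. by rewrite invr_ge1 ?r_gt0 ?unitf_gt0 ?ltW ?r_lt1 ?r_gt0. Qed.
Lemma t_ge0 : 0 <= t. Proof. exact: le_trans ler01 t_ge1. Qed.

(** Since q t = r, the coefficient bound q^k / q leaves a geometric series of ratio r, whose sum is
    B. *)
Let B := ((1 - r) * q)^-1.

Lemma B_ge0 : 0 <= B.
Proof. by rewrite invr_ge0 mulr_ge0 ?subr_ge0 ?ltW ?r_lt1. Qed.

Lemma gcoef_bound L k : (0 < L)%N -> `|gcoef L q k| <= q ^+ k / q.
Proof.
move=> L0; case: k => [|k] /=.
  by rewrite normr1 expr0 mul1r invr_ge1 ?unitf_gt0 ?ltW.
rewrite exprSr mulfK ?gt_eqF // normrM normrM ler0_norm ?subr_le0 ?(ltW q_lt1) //.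
have qL : q ^+ L <= q by rewrite -{2}(expr1 q) ler_wiXn2l ?ltW.
have d0 : 0 < 1 - q ^+ L by rewrite subr_gt0; exact: le_lt_trans qL q_lt1.
rewrite normfV (ger0_norm (exprn_ge0 k (ltW q_gt0))) (gtr0_norm d0).
rewrite ler_pdivrMr // mulrC.
by apply: ler_wpM2l; rewrite ?exprn_ge0 ?(ltW q_gt0) // opprB lerB.
Qed.

Lemma gcoef_sum L : (0 < L)%N -> \sum_(k < L.+1) `|gcoef L q k| * t ^+ k <= B.
Proof.
move=> L0; apply: (@le_trans _ _ (\sum_(k < L.+1) r ^+ k / q)).
  apply: ler_sum => k _; apply: (@le_trans _ _ (q ^+ k / q * t ^+ k)).
    by apply: ler_wpM2r; rewrite ?exprn_ge0 ?t_ge0 // gcoef_bound.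
  rewrite mulrAC -exprMn -{1}r_sqr /t expr2 mulfK // gt_eqF // r_gt0 //.
rewrite -mulr_suml /B invfM ler_pM2r ?invr_gt0 //.
have r1 : 0 < 1 - r by rewrite subr_gt0 r_lt1.
rewrite -[(1 - r)^-1]mul1r ler_pdivlMr // mulrC -opprB mulNr -subrX1 opprB.
by rewrite gerBl exprn_ge0 // (ltW r_gt0).
Qed.

Fixpoint Mb (n : nat) : R := if n is n'.+1 then Mb n' * B ^+ n' else 1.

Lemma Mb_ge0 n : 0 <= Mb n.
Proof. by elim: n => //= n IH; rewrite mulr_ge0 // exprn_ge0 // B_ge0. Qed.

Lemma Tk_gcoef_bound L (Phi : nat -> seq int -> R) v (M : R) : (0 < L)%N -> 0 <= M ->
  (forall ks, size ks = size v ->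
     `|Phi (sumn ks) (subseq_nat v ks)| <= M * t ^+ sumn ks) ->
  `|Tk L (gcoef L q) Phi v| <= M * B ^+ size v.
Proof.
move=> L0 M0 h; apply: le_trans (Tk_bound L (gcoef L q) t_ge0 h) _.
apply: ler_wpM2l => //; apply: lerXn2r; rewrite ?nnegrE ?B_ge0 ?gcoef_sum //.
by apply: sumr_ge0 => k _; rewrite mulr_ge0 // exprn_ge0 // t_ge0.
Qed.

Lemma size_subseq_nat v ks : size ks = size v -> size (subseq_nat v ks) = size v.
Proof. by move=> s; rewrite size_map size_zip s minnn. Qed.

Lemma Dr_bound L v : (0 < L)%N -> `|Dr q L v| <= Mb (size v).
Proof.
move=> L0; have [n sn] := ubnP (size v); elim: n v sn => // n IH [|c v] sv.
  by rewrite Dr_nil normr1.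
rewrite Dr_cons //; apply: Tk_gcoef_bound => //; first exact: Mb_ge0.
move=> ks sk; rewrite normrM -[X in X <= _]mulr1 -[X in X * _ <= _]mulrC.
have h := IH (subseq_nat v ks); rewrite size_subseq_nat // in h.
apply: ler_pM; rewrite ?mulr_ge0 ?normr_ge0 //.
  rewrite -[X in _ <= X]mulr1; apply: ler_pM; rewrite ?normr_ge0 //; first exact: h.
  by rewrite normr_nat; case: dvdn.
by rewrite exprn_ege1 // t_ge1.
Qed.

Lemma rt_ge1 L s : (L <= s)%N -> 1 <= r ^+ L * t ^+ s.
Proof.
move=> h; rewrite -(subnKC h) exprD mulrA -exprMn /t divff ?gt_eqF ?r_gt0 //.
by rewrite expr1n mul1r exprn_ege1 // t_ge1.
Qed.

Lemma Dr_head_bound L m v : (0 < L)%N -> (0 < m)%N ->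
  `|Dr q L (m%:Z :: v)| <= Mb (size v) * (r ^+ L * t ^+ m) * B ^+ size v.
Proof.
move=> L0 m0; have rt0 s : 0 <= r ^+ L * t ^+ s.
  by rewrite mulr_ge0 ?exprn_ge0 ?t_ge0 // ltW // r_gt0.
rewrite Dr_cons //; apply: Tk_gcoef_bound => // [|ks sk].
  by rewrite mulr_ge0 ?Mb_ge0.
rewrite normrM normr_nat; have := Dr_bound (subseq_nat v ks) L0.
rewrite size_subseq_nat // => h.
have -> : absz (m%:Z + (sumn ks)%:Z)%R = (m + sumn ks)%N by lia.
case: (boolP (L %| m + sumn ks)%N) => [d|_]; last first.
  by rewrite mul0r -mulrA mulr_ge0 ?Mb_ge0 // -mulrA -exprD.
rewrite mul1r -mulrA -mulrA -exprD -[X in X <= _]mulr1.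
apply: ler_pM => //; apply: rt_ge1; apply: dvdn_leq => //; lia.
Qed.

(** Shift 0 reproduces [Dr q L v] exactly; any other shift that survives is a positive multiple of L
    and hence small. *)
Lemma Dr_zero_bound L v : (0 < L)%N ->
  `|Dr q L (0 :: v) - Dr q L v| <= Mb (size v) * r ^+ L * B ^+ size v.
Proof.
move=> L0; have rt0 s : 0 <= r ^+ L * t ^+ s.
  by rewrite mulr_ge0 ?exprn_ge0 ?t_ge0 // ltW // r_gt0.
rewrite Dr_cons //.
rewrite (@eq_Tk _ _ _ _ (fun s l => (s == 0)%N%:R * Dr q L l +
   ((0 < s) && (L %| s))%N%:R * Dr q L l)) => [|s l _]; last first.
  by rewrite add0r absz_nat -mulrDl; case: s => [|s] /=; rewrite ?dvdn0 ?addr0 ?add0r.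
rewrite Tk_add Tk_delta // addrAC subrr add0r.
apply: Tk_gcoef_bound => // [|ks sk].
  by rewrite mulr_ge0 ?Mb_ge0 // exprn_ge0 // ltW // r_gt0.
rewrite normrM normr_nat; have := Dr_bound (subseq_nat v ks) L0.
rewrite size_subseq_nat // => h.
case: (boolP ((0 < sumn ks) && _)%N) => [/andP[s0 d]|_]; last first.
  by rewrite mul0r -mulrA mulr_ge0 ?Mb_ge0.
rewrite mul1r -mulrA -[X in X <= _]mulr1.
by apply: ler_pM => //; apply: rt_ge1; apply: dvdn_leq.
Qed.

Fixpoint Cb (n : nat) : R := if n is n'.+1 then Cb n' * B ^+ n else 1.

Lemma Cb_ge0 n : 0 <= Cb n.
Proof. by elim: n => //= n IH; rewrite mulr_ge0 // exprn_ge0 // B_ge0. Qed.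

(** Eliminating earlier variables only lowers the last exponent, so it stays negative until it is
    alone; there it survives only if its absolute value is at least L. *)
Lemma Dr_rcons_bound L m v : (0 < L)%N -> (0 < m)%N ->
  `|Dr q L (rcons v (- m%:Z))| <= Cb (size v) * (r ^+ L * t ^+ m).
Proof.
move=> L0; have rt0 s : 0 <= r ^+ L * t ^+ s.
  by rewrite mulr_ge0 ?exprn_ge0 ?t_ge0 // ltW // r_gt0.
have [n sn] := ubnP (size v); elim: n v sn m => // n IH [|a v] sv m m0.
  rewrite /= Dr_cons //= Dr_nil mulr1 mul1r normr_nat addr0 abszN absz_nat.
  case: (boolP (L %| m)%N) => d; last exact: rt0.
  by apply: rt_ge1; apply: dvdn_leq.
rewrite rcons_cons Dr_cons // [Cb _]/= mulrAC -[X in B ^+ X](size_rcons v (- m%:Z)).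
apply: Tk_gcoef_bound => // [|ks]; first by rewrite mulr_ge0 ?Cb_ge0.
rewrite size_rcons; case: (lastP ks) => // {}ks k; rewrite size_rcons => -[sk].
have -> : subseq_nat (rcons v (- m%:Z)) (rcons ks k) =
    rcons (subseq_nat v ks) (- (m + k)%:Z).
  by rewrite /subseq_nat zip_rcons // map_rcons /=; congr rcons; lia.
have := IH (subseq_nat v ks); rewrite size_subseq_nat // => /(_ _ (m + k)%N).
rewrite addn_gt0 m0 => /(_ sv isT) h; rewrite normrM normr_nat.
apply: (@le_trans _ _ (Cb (size v) * (r ^+ L * t ^+ (m + k)))).
  rewrite -[X in _ <= X]mul1r; apply: ler_pM => //; by case: dvdn.
rewrite exprD !mulrA; apply: ler_wpM2l.
  by rewrite -!mulrA mulr_ge0 ?Cb_ge0.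
by apply: ler_weXn2l; [exact: t_ge1|rewrite sumn_rcons leq_addl].
Qed.

Lemma geometric_cvg0 (f : nat -> R) C : (forall L, `|f L| <= C * r ^+ L.+1) ->
  f @ \oo --> (0 : R).
Proof.
move=> h; apply: norm_cvg0.
have g0 : (fun L => C * r ^+ L.+1) @ \oo --> (0 : R).
  have -> : (fun L => C * r ^+ L.+1) = (fun L => (C * r) * r ^+ L).
    by apply/funext => L; rewrite exprS mulrA.
  rewrite -(mulr0 (C * r)); apply: cvgMl_tmp; apply: cvg_expr.
  by rewrite gtr0_norm ?r_gt0 // r_lt1.
apply: (squeeze_cvgr _ (cvg_cst 0) g0).
by apply: nearW => L; rewrite normr_ge0 h.
Qed.

Lemma Dr_cvg_head c v : 0 < c -> (fun L => Dr q L.+1 (c :: v)) @ \oo --> (0 : R).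
Proof.
move=> c0; have -> : c = (absz c)%:Z by lia.
have m0 : (0 < absz c)%N by lia.
apply: (@geometric_cvg0 _ (Mb (size v) * t ^+ absz c * B ^+ size v)) => L.
apply: (le_trans (Dr_head_bound v (ltn0Sn L) m0)).
by rewrite le_eqVlt; apply/orP; left; apply/eqP; ring.
Qed.

Lemma Dr_cvg_last m v : m < 0 -> (fun L => Dr q L.+1 (rcons v m)) @ \oo --> (0 : R).
Proof.
move=> m0; have -> : m = - (absz m)%:Z by lia.
have m1 : (0 < absz m)%N by lia.
apply: (@geometric_cvg0 _ (Cb (size v) * t ^+ absz m)) => L.
apply: (le_trans (Dr_rcons_bound v (ltn0Sn L) m1)).
by rewrite le_eqVlt; apply/orP; left; apply/eqP; ring.
Qed.

Lemma Dr_cvg_nseq0 n : (fun L => Dr q L.+1 (nseq n 0)) @ \oo --> (1 : R).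
Proof.
elim: n => [|n IH].
  by under eq_fun do rewrite Dr_nil; exact: cvg_cst.
have d0 : (fun L => Dr q L.+1 (0 :: nseq n 0) - Dr q L.+1 (nseq n 0)) @ \oo --> (0 : R).
  apply: (@geometric_cvg0 _ (Mb n * B ^+ n)) => L.
  have := Dr_zero_bound (nseq n 0) (ltn0Sn L); rewrite size_nseq => h.
  by apply: (le_trans h); rewrite le_eqVlt; apply/orP; left; apply/eqP; ring.
have := cvgD d0 IH; rewrite add0r.
by rewrite addrfctE; under eq_fun do rewrite subrK; exact.
Qed.

Lemma Dr_cvg_conjl n mu : is_part mu -> (head 0 mu <= n)%N ->
  (fun L => Dr q L.+1 (conjl n mu)) @ \oo --> ((mu == [::])%:R : R).
Proof.
case: mu => [|m mu] pm hm; first exact: Dr_cvg_nseq0.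
have /andP[_ pl] : path geq n (m :: mu) by rewrite path_geq_part.
move: pm; rewrite is_part_cons => /and3P[m0 _ _] /=.
have := size_conjl pl; have := conjl_ge0 m mu.
case: (conjl m mu) => [_ m00|c v /andP[c0 _] _]; first by rewrite -m00 in m0.
by apply: Dr_cvg_head; lia.
Qed.

(** The upward expansion is exact for every L; the limit is used only for the downward one. *)
Lemma ExUD_Dr_cvg as_ bs n K : (size as_ <= K)%N ->
  (fun L => ExU as_ (ExD bs (Dr q L.+1)) (nseq n 0)) @ \oo -->
  \sum_(lam <- box_seqs K n | is_part lam)
    bnorm q n [::] / bnorm q n lam * skewW q as_ lam [::] * skewW q bs lam [::].
Proof.
move=> sK; have q0 := ltW q_gt0.
have sD L := straight_Dr q_gt0 q_lt1 (ltn0Sn L).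
under eq_fun => L.
  rewrite -[nseq n 0]/(conjl n [::]).
  rewrite (ExU_conjl (K := K) q0 q_lt1 (straight_ExD bs (sD L))) //.
  over.
apply: cvg_sum_seq => lam + pl.
rewrite part_in_box // => /andP[_ hl].
apply: cvgMl_tmp; apply: ExD_cvg => //; first by move=> v m; exact: Dr_cvg_last.
by move=> mu; exact: Dr_cvg_conjl.
Qed.

End RealFunctionalLimits.

(** * The Schur functionals: determinants *)

Lemma sw_cat (T : Type) (l r : seq T) a b : sw (size l) (l ++ a :: b :: r) = l ++ b :: a :: r.
Proof. by elim: l => //= x l ->. Qed.

Lemma size_sw (T : Type) i (x : seq T) : size (sw i x) = size x.
Proof. by elim: i x => [|i IH] [|y x] //=; [case: x|rewrite IH]. Qed.

Lemma sw_oversize (T : Type) i (x : seq T) : (size x <= i.+1)%N -> sw i x = x.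
Proof.
elim: i x => [|i IH] [|y x] //=; first by case: x.
by rewrite ltnS => h; rewrite IH.
Qed.

Lemma map_sw (T U : Type) (f : T -> U) i x : map f (sw i x) = sw i (map f x).
Proof. by elim: i x => [|i IH] [|y x] //=; [case: x|rewrite IH]. Qed.

Lemma nth_sw (T : Type) (x0 : T) i x n (i0 i1 j : 'I_n) :
  i0 = i :> nat -> i1 = i.+1 :> nat -> size x = n ->
  nth x0 (sw i x) j = nth x0 x (tperm i0 i1 j).
Proof.
move=> e0 e1 sx.
have key k m (y : seq T) : (k.+1 < size y)%N -> nth x0 (sw k y) m =
    nth x0 y (if m == k then k.+1 else if m == k.+1 then k else m).
  elim: k m y => [|k IH] [|m] [|u [|v y]] //=; first by case: m.
  move=> h; rewrite IH // !eqSS.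
  by case: eqP => // _; case: eqP.
have hi : (i.+1 < size x)%N by have := ltn_ord i1; rewrite e1 sx.
rewrite key //.
case: tpermP => [->|->|/eqP j0 /eqP j1].
- by rewrite e0 eqxx e1.
- by rewrite e1 eqn_leq ltnn /= eqxx e0.
- have n0 : (j == i :> nat) = false by rewrite -e0 val_eqE; exact/negbTE.
  have n1 : (j == i.+1 :> nat) = false by rewrite -e1 val_eqE; exact/negbTE.
  by rewrite n0 n1.
Qed.

Section DetSeq.
Variables (R : realType).

Definition det_seq (A B : Type) (a0 : A) (b0 : B) (f : A -> B -> R) n
    (v : seq A) (w : seq B) : R :=
  \det (\matrix_(i < n, j < n) f (nth a0 v i) (nth b0 w j)).

Lemma det_seq_sw (A B : Type) (a0 : A) (b0 : B) f n v (w : seq B) i :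
  (i.+1 < n)%N -> size v = n ->
  det_seq a0 b0 f n (sw i v) w = - det_seq a0 b0 f n v w.
Proof.
move=> h sv; pose i1 := Ordinal h; pose i0 := Ordinal (ltnW h).
have -> : det_seq a0 b0 f n (sw i v) w =
    \det (xrow i0 i1 (\matrix_(i < n, j < n) f (nth a0 v i) (nth b0 w j))).
  congr (\det _); apply/matrixP => j k; rewrite !mxE.
  by rewrite (@nth_sw _ _ _ _ _ i0 i1).
rewrite xrowE det_mulmx det_perm odd_tperm /= -val_eqE /= neq_ltn ltnSn /=.
by rewrite mulN1r.
Qed.

Lemma det_seq_sw_r (A B : Type) (a0 : A) (b0 : B) f n (v : seq A) w i :
  (i.+1 < n)%N -> size w = n ->
  det_seq a0 b0 f n v (sw i w) = - det_seq a0 b0 f n v w.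
Proof.
move=> h sw_; have tr u : det_seq a0 b0 f n v u = det_seq b0 a0 (fun b a => f a b) n u v.
  by rewrite /det_seq -det_tr; congr (\det _); apply/matrixP => j k; rewrite !mxE.
by rewrite !tr det_seq_sw.
Qed.

Lemma det_row0 n (M : 'M[R]_n) i : (forall j, M i j = 0) -> \det M = 0.
Proof.
by move=> h; rewrite (expand_det_row _ i) big1 // => j _; rewrite h mul0r.
Qed.

Lemma Ex_sw al be d (D : seq int -> R) i v :
  Ex al be d D (sw i v) = Ex al be d (fun u => D (sw i u)) v.
Proof.
elim: i D v => [|i IH] D [|c v] //=; last by rewrite !IH.
by case: v => [|c' v] //=; ring.
Qed.

Lemma ExU_sw xs (D : seq int -> R) i v :
  ExU xs D (sw i v) = ExU xs (fun u => D (sw i u)) v.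
Proof.
elim: xs D => [|x xs IH] D //=; rewrite IH; apply: eq_ExU_near => w _; exact: Ex_sw.
Qed.

Lemma ExD_sw xs (D : seq int -> R) i v :
  ExD xs D (sw i v) = ExD xs (fun u => D (sw i u)) v.
Proof.
elim: xs v => [|x xs IH] v //=; rewrite Ex_sw; apply: eq_Ex_near => // w _; exact: IH.
Qed.

Lemma Ex_bound al be d (D : seq int -> R) v M :
  (forall w, size w = size v -> `|D w| <= M) ->
  `|Ex al be d D v| <= (`|al| + `|be|) ^+ size v * M.
Proof.
elim: v D => [|c v IH] D h /=; first by rewrite expr0 mul1r h.
apply: (le_trans (ler_normD _ _)); rewrite exprS !normrM -mulrA mulrDl.
by apply: lerD; apply: ler_wpM2l => //; apply: IH => w sw_; apply: h; rewrite /= sw_.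
Qed.

Fixpoint ExB (xs : seq R) (n : nat) : R :=
  if xs is x :: xs' then (1 + `|x|) ^+ n * ExB xs' n else 1.

Lemma ExU_bound xs (D : seq int -> R) v M :
  (forall w, size w = size v -> `|D w| <= M) ->
  `|ExU xs D v| <= ExB xs (size v) * M.
Proof.
elim: xs D M => [|x xs IH] D M h /=; first by rewrite mul1r h.
rewrite [_ * ExB _ _]mulrC -mulrA; apply: IH => w sw_; rewrite -sw_.
have := @Ex_bound x 1 0 D w M; rewrite normr1 addrC; apply => u su.
by apply: h; rewrite su.
Qed.

Lemma ExD_bound xs (D : seq int -> R) v M :
  (forall w, size w = size v -> `|D w| <= M) ->
  `|ExD xs D v| <= ExB xs (size v) * M.
Proof.
elim: xs v => [|x xs IH] v h /=; first by rewrite mul1r h.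
rewrite -mulrA.
have := @Ex_bound 1 x (-1) (ExD xs D) v (ExB xs (size v) * M).
rewrite normr1; apply => w sw_; rewrite -sw_.
by apply: IH => u su; apply: h; rewrite su.
Qed.

Lemma det_seq_bound (A B : Type) (a0 : A) (b0 : B) f n v w :
  (forall a b, `|f a b| <= 1) -> `|det_seq a0 b0 f n v w| <= n`!%:R.
Proof.
move=> h; rewrite /det_seq /determinant; apply: (le_trans (ler_norm_sum _ _ _)).
rewrite -card_Sn -sum1_card natr_sum; apply: ler_sum => s _.
rewrite normrM normrX normrN1 expr1n mul1r normr_prod.
by apply: prodr_ile1 => i _; rewrite normr_ge0 mxE h.
Qed.
End DetSeq.

Section Fermions.
Variable R : realType.
Implicit Types (v l : seq int) (w : seq nat).

(** The version of [detL] without wrap-around. For v as long as w and w with distinct letters, it is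
    the sign of the permutation relating v to w, or 0 if there is none. *)
Definition detoo w v : R :=
  det_seq 0 0%N (fun (c : int) (k : nat) => (c == k%:Z)%:R) (size v) v w.

(** Adds the staircase n - 1, ..., 1, 0, as in the bialternant formula: weakly decreasing vectors
    become strictly decreasing. *)
Fixpoint addd (v : seq int) : seq int :=
  if v is c :: v' then c + (size v')%:Z :: addd v' else [::].

Lemma size_addd v : size (addd v) = size v.
Proof. by elim: v => //= c v ->. Qed.

Lemma addd_cat l m : addd (l ++ m) = [seq c + (size m)%:Z | c <- addd l] ++ addd m.
Proof.
by elim: l => //= c l ->; rewrite size_cat PoszD; congr (_ :: _); ring.
Qed.

Lemma addd_inj : injective addd.
Proof.
elim=> [|c v IH] [|c' v'] //= [e /[dup] ev /IH ->].
by move: e; rewrite -(size_addd v) ev size_addd => /addIr ->.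
Qed.

Lemma Ex_addd al be d (D : seq int -> R) v : (d == 0) || (d == -1) ->
  Ex al be d D (addd v) = Ex al be d (fun u => D (addd u)) v.
Proof.
move=> dP; elim: v D => [|c v IH] D //=; rewrite !IH; congr (_ * _ + _ * _);
  apply: eq_Ex_near => // u /near_seq_size su; rewrite -su; congr (D (_ :: _)); ring.
Qed.

Lemma ExU_addd xs (D : seq int -> R) v :
  ExU xs D (addd v) = ExU xs (fun u => D (addd u)) v.
Proof.
elim: xs D => [|x xs IH] D //=; rewrite IH; apply: eq_ExU_near => u _; exact: Ex_addd.
Qed.

Lemma ExD_addd xs (D : seq int -> R) v :
  ExD xs D (addd v) = ExD xs (fun u => D (addd u)) v.
Proof.
by elim: xs v => [|x xs IH] v //=; rewrite Ex_addd //; apply: eq_Ex_near.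
Qed.

(** After adding the staircase, the two vectors on the left of the relation differ by a
    transposition, under which the determinant changes sign; at q = 0 the right side is zero. *)
Lemma straight_detoo w : straight 0 (fun v => detoo w (addd v)).
Proof.
move=> l a b r; rewrite mul0r; apply/eqP; rewrite addrC addr_eq0; apply/eqP.
have -> : addd (l ++ b :: a + 1 :: r) = sw (size l) (addd (l ++ a :: b + 1 :: r)).
  rewrite !addd_cat /= -(size_addd l).
  rewrite -(size_map (fun c => c + (size r).+2%:Z) (addd l)) sw_cat.
  by congr (_ ++ _ :: _ :: _); lia.
by rewrite /detoo size_sw det_seq_sw // size_addd size_cat /=; lia.
Qed.

Lemma detoo_notin w v i : (i < size v)%N -> nth 0 v i \notin [seq k%:Z | k <- w] ->
  (size v <= size w)%N -> detoo w v = 0.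
Proof.
move=> iv ni sw_; apply: (@det_row0 _ _ _ (Ordinal iv)) => j; rewrite !mxE /=.
case: eqP => // e; case/negP: ni; rewrite e; apply: map_f; apply: mem_nth.
exact: leq_trans (ltn_ord j) sw_.
Qed.

Lemma detoo_rcons_neg w v m : (size v < size w)%N -> m < 0 -> detoo w (addd (rcons v m)) = 0.
Proof.
move=> sv m0; have e : addd (rcons v m) = rcons [seq c + 1 | c <- addd v] m.
  by rewrite -cats1 addd_cat /= addr0 cats1.
apply: (@detoo_notin _ _ (size v)); rewrite e ?size_rcons ?size_map ?size_addd //.
rewrite nth_rcons size_map size_addd ltnn eqxx.
by apply/mapP => -[k _ ek]; move: m0; rewrite ek.
Qed.

Definition toW n rho := [seq absz c | c <- addd (conjl n rho)].

Lemma addd_ge0 v : all (fun c : int => 0 <= c) v -> all (fun c : int => 0 <= c) (addd v).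
Proof. by elim: v => //= c v IH /andP[c0 /IH ->]; rewrite andbT; lia. Qed.

Lemma toW_addd n rho : [seq k%:Z | k <- toW n rho] = addd (conjl n rho).
Proof.
rewrite /toW -map_comp map_id_in // => c /= cin.
by have := allP (addd_ge0 (conjl_ge0 n rho)) c cin; lia.
Qed.

Lemma conjl_decr n mu : pairwise (fun a b : int => b <= a) (conjl n mu).
Proof.
elim: mu n => [|m mu IH] n /=.
  by elim: n => //= n ->; rewrite all_nseq lexx orbT.
rewrite pairwise_cat pairwise_map; apply/and3P; split.
- apply/allrelP => a b /mapP[c cin ->] /nseqP[-> _].
  by have := allP (conjl_ge0 m mu) c cin; lia.
- by apply: sub_pairwise (IH m) => a b /=; lia.
- by elim: (n - m)%N => //= k ->; rewrite all_nseq lexx orbT.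
Qed.

Lemma addd_decr v : pairwise (fun a b : int => b <= a) v ->
  pairwise (fun a b : int => b < a) (addd v).
Proof.
have bnd c u : all (fun b => b <= c) u -> all (fun b => b < c + (size u)%:Z) (addd u).
  elim: u => //= b u IH /andP[bc /IH h]; apply/andP; split; first by lia.
  by apply: sub_all h => x; lia.
by elim: v => //= c v IH /andP[h /IH ->]; rewrite bnd.
Qed.

Lemma conjl_inj n mu rho : is_part mu -> is_part rho -> path geq n mu -> path geq n rho ->
  conjl n mu = conjl n rho -> mu = rho.
Proof.
have cnt m mu' k : path geq m mu' -> count (fun c : int => 0 < c)
    (inc (conjl m mu') ++ nseq k 0) = m.
  move=> pm; rewrite count_cat count_nseq ltxx mul0n addn0 count_map.
  rewrite -[RHS](size_conjl pm); apply/eqP; rewrite -all_count.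
  by apply: sub_all (conjl_ge0 m mu') => c /=; lia.
have cnt0 k : count (fun c : int => 0 < c) (nseq k 0) = 0%N by rewrite count_nseq ltxx mul0n.
elim: mu rho n => [|m mu IH] [|m' rho] n //.
- move=> _ + _; rewrite is_part_cons => /and3P[m0 _ _] /andP[_ pm] /= e.
  by have := congr1 (count (fun c : int => 0 < c)) e; rewrite cnt // cnt0 => e0; rewrite -e0 in m0.
- rewrite is_part_cons => /and3P[m0 _ _] _ /andP[_ pm] _ /= e.
  by have := congr1 (count (fun c : int => 0 < c)) e; rewrite cnt // cnt0 => e0; rewrite e0 in m0.
rewrite !is_part_cons => /and3P[m0 hm pm] /and3P[m0' hm' pm'] /andP[_ q1] /andP[_ q2] /= e.
have := congr1 (count (fun c : int => 0 < c)) e; rewrite !cnt // => em; subst m'.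
congr (_ :: _); apply: (IH _ m) => //.
move/eqP: e; rewrite eqseq_cat ?size_map ?size_conjl // => /andP[/eqP e _].
by apply: (inj_map (addIr (1 : int))).
Qed.

(** Strictly decreasing vectors are determined by their sets of entries. If the two differ, an entry
    of the first is missing from the second and gives a zero row. *)
Lemma detoo_conjl n mu rho : is_part mu -> is_part rho ->
  (head 0 mu <= n)%N -> (head 0 rho <= n)%N ->
  detoo (toW n rho) (addd (conjl n mu)) = (mu == rho)%:R.
Proof.
move=> pm pr hm hr.
have sm : size (addd (conjl n mu)) = n by rewrite size_addd size_conjl // path_geq_part.
have sr : size (addd (conjl n rho)) = n by rewrite size_addd size_conjl // path_geq_part.
have gt_uniq (v : seq int) : pairwise (fun a b : int => b < a) v -> uniq v.
  by move=> h; apply: (pairwise_uniq _ h) => x; exact: ltxx.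
have um := gt_uniq _ (addd_decr (conjl_decr n mu)).
have ur := gt_uniq _ (addd_decr (conjl_decr n rho)).
case: eqP => [->|nmr].
  rewrite /detoo sr /det_seq -[RHS](det1 R n); congr (\det _).
  apply/matrixP => i j; rewrite !mxE -(nth_map 0%N 0) ?size_map ?sr // toW_addd.
  by rewrite nth_uniq ?sr.
have [i iv ni] : exists2 i, (i < size (addd (conjl n mu)))%N &
    nth 0 (addd (conjl n mu)) i \notin [seq k%:Z | k <- toW n rho].
  rewrite toW_addd.
  have : ~~ all (fun c => c \in addd (conjl n rho)) (addd (conjl n mu)).
    apply/negP => /allP sub; apply: nmr.
    have [_ e] := uniq_min_size um sub (eq_leq (etrans sr (esym sm))).
    have : perm_eq (addd (conjl n mu)) (addd (conjl n rho)) by exact: uniq_perm.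
    move=> /(sorted_eq (leT := fun a b : int => b < a)) h.
    have := h _ _ _ _; move=> {}h; apply: (conjl_inj pm pr (n := n)); rewrite ?path_geq_part //.
    apply: addd_inj; apply: h.
    - by move=> y x z /= xy yz; exact: lt_trans yz xy.
    - by move=> x y /= /andP[xy yx]; have := lt_trans xy yx; rewrite ltxx.
    - by apply: pairwise_sorted; apply/addd_decr/conjl_decr.
    - by apply: pairwise_sorted; apply/addd_decr/conjl_decr.
  by move=> /allPn[c /(nthP 0)[i iv <-] ni]; exists i.
by apply: (detoo_notin iv ni); rewrite size_map sr sm.
Qed.

Lemma qpoch00 n : qpoch (0 : R) 0 n = 1.
Proof. by rewrite /qpoch big1 // => i _; rewrite mul0r subr0. Qed.

Lemma bnorm0 n lam : bnorm (0 : R) n lam = 1.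
Proof. by rewrite /bnorm qpoch00 mul1r big1 // => i _; exact: qpoch00. Qed.

Lemma ExUD_detoo as_ bs n rho K : is_part rho -> (head 0 rho <= n)%N ->
  (size rho + size as_ <= K)%N ->
  ExU as_ (ExD bs (detoo (toW n rho))) [seq k%:Z | k <- toW n rho] =
  \sum_(lam <- box_seqs K n | is_part lam)
     skewW 0 as_ lam rho * skewW 0 bs lam rho.
Proof.
move=> pr hr sK; rewrite toW_addd ExU_addd.
(* [detoo_rcons_neg] covers vectors no longer than the word; the cut-off to length n extends the
   vanishing to all lengths and keeps the functional straight. *)
pose D v := (size v == n)%:R * detoo (toW n rho) (addd v).
have sD : straight 0 D.
  move=> l a b r; rewrite /D !size_cat /= -mulrDr (straight_detoo (toW n rho) l a b r).
  by rewrite !mul0r mulr0.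
have sw_ : size (toW n rho) = n by rewrite size_map size_addd size_conjl // path_geq_part.
have sc mu : is_part mu -> (head 0 mu <= n)%N -> size (conjl n mu) = n.
  by move=> pm hm; rewrite size_conjl // path_geq_part.
transitivity (ExU as_ (ExD bs D) (conjl n rho)).
  apply: eq_ExU_near => v /near_seq_size sv; rewrite ExD_addd.
  apply: eq_ExD_near => u /near_seq_size su.
  by rewrite /D -su -sv sc // eqxx mul1r.
rewrite (ExU_conjl (K := K) (lexx 0) ltr01 (straight_ExD bs sD)) //.
rewrite big_seq_cond [RHS]big_seq_cond; apply: eq_bigr => lam /andP[+ pl].
rewrite part_in_box // => /andP[_ hl]; rewrite !bnorm0 divr1 mul1r; congr (_ * _).
(* A constant sequence turns the limit statement into an exact identity. *)
have : (fun _ : nat => ExD bs D (conjl n lam)) @ \oo --> skewW 0 bs lam rho.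
  apply: (@ExD_cvg R 0 (lexx 0) ltr01 (fun=> D) bs n rho) => //.
    move=> v m m0; suff -> : D (rcons v m) = 0 by exact: cvg_cst.
    rewrite /D size_rcons; case: eqP => [e|_]; last by rewrite mul0r.
    by rewrite detoo_rcons_neg ?mulr0 // sw_ -e.
  move=> mu pm hm; rewrite /D sc // eqxx mul1r detoo_conjl //; exact: cvg_cst.
by move=> /cvg_lim <- //; rewrite lim_cst.
Qed.
End Fermions.

(** * Reducing sums over words to strictly decreasing words *)

Section SymmetricSums.
Variable R : realType.
Implicit Types (w : seq nat).

Definition XL (as_ bs : seq R) L w := ExU as_ (ExD bs (detL R L w)) [seq k%:Z | k <- w].

Lemma ExUD_eq0 as_ bs (D : seq int -> R) v :
  (forall u, size u = size v -> D u = 0) -> ExU as_ (ExD bs D) v = 0.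
Proof.
move=> h; apply/eqP; rewrite -normr_le0.
rewrite -[X in _ <= X](mulr0 (ExB as_ (size v))) -[X in _ <= _ * X](mulr0 (ExB bs (size v))).
apply: ExU_bound => w sw_; rewrite -sw_; apply: ExD_bound => u su.
by rewrite h ?normr0 // su.
Qed.

(** The word is both the evaluation point and the index of the functional, so a swap changes the
    sign twice, once through rows and once through columns. *)
Lemma XL_sw as_ bs L i w : XL as_ bs L (sw i w) = XL as_ bs L w.
Proof.
have [h|h] := ltnP i.+1 (size w); last by rewrite sw_oversize.
rewrite /XL map_sw ExU_sw; apply: eq_ExU_near => v /near_seq_size.
rewrite size_map => sv; rewrite ExD_sw; apply: eq_ExD_near => u /near_seq_size su.
have e w' u' : detL R L w' u' = det_seq 0 0%N
  (fun c k => (dvdn L (absz (c - k%:Z)%R))%:R) (size u') u' w' by [].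
by rewrite !e size_sw det_seq_sw ?det_seq_sw_r ?opprK // -su -sv.
Qed.

Lemma sw_invariant_perm (T : eqType) (U : Type) (F : seq T -> U) :
  (forall i x, F (sw i x) = F x) -> forall x y, perm_eq x y -> F x = F y.
Proof.
move=> h x y pxy.
have h1 l a b r : F (l ++ a :: b :: r) = F (l ++ b :: a :: r) by rewrite -(h (size l)) sw_cat.
have h2 l a s r : F (l ++ a :: s ++ r) = F (l ++ s ++ a :: r).
  elim: s l => //= b s IH l; rewrite h1.
  by have := IH (rcons l b); rewrite !cat_rcons.
have h3 l s1 s2 r : F (l ++ s1 ++ s2 ++ r) = F (l ++ s2 ++ s1 ++ r).
  elim: s1 l => //= a s1 IH l; rewrite -h2.
  by have := IH (rcons l a); rewrite !cat_rcons.
move: (erefl (F x)); apply: (catCA_perm_ind (P := fun z => F x = F z)) pxy => s1 s2 s3 ->.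
exact: (h3 [::]).
Qed.

Lemma XL_perm as_ bs L w w' : perm_eq w w' -> XL as_ bs L w = XL as_ bs L w'.
Proof. by apply: sw_invariant_perm => i x; exact: XL_sw. Qed.

Lemma XL_nuniq as_ bs L w : ~~ uniq w -> XL as_ bs L w = 0.
Proof.
move=> nu; have [a [r pw]] : exists a r, perm_eq w (a :: a :: r).
  elim: w nu => //= x w IH; rewrite negb_and negbK => /orP[xw|/IH[a [r pw]]].
    by exists x, (rem x w); rewrite perm_cons perm_to_rem.
  exists a, (x :: r); rewrite -(perm_cons x) in pw; apply: (perm_trans pw).
  by apply/seq.permP => P /=; lia.
rewrite (XL_perm _ _ _ pw); apply: ExUD_eq0 => v; rewrite size_map => sv.
have e : detL R L [:: a, a & r] v = - detL R L [:: a, a & r] v.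
  have h1 : (1 < size v)%N by rewrite sv.
  exact: (@det_seq_sw_r R _ _ 0 0%N (fun c k => (dvdn L (absz (c - k%:Z)%R))%:R)
    (size v) v [:: a, a & r] 0 h1 (esym sv)).
by move/eqP: e; rewrite -addr_eq0 -mulr2n mulrn_eq0 /= => /eqP.
Qed.

Lemma mem_words L n w : (w \in words L n) = (size w == n) && all (fun k => k < L)%N w.
Proof.
apply/idP/idP => [/size_words[-> ->]|]; first by rewrite eqxx.
elim: n w => [|n IH] [|k w] //= /andP[/eqP[sw_] /andP[kL aw]].
apply/allpairsPdep; exists k, w; split => //; first by rewrite mem_iota.
by apply: IH; rewrite sw_ eqxx.
Qed.

Lemma words_uniq L n : uniq (words L n).
Proof.
elim: n => [|n IH] //; apply: allpairs_uniq_dep; rewrite ?iota_uniq //.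
by move=> [a u] [b v] _ _ /= [-> ->].
Qed.

(** A word with distinct letters has n! rearrangements. This n! later cancels the one created by
    symmetrising the kernel. *)
Lemma sum_words_sorted L n (G : seq nat -> R) :
  (forall w w', perm_eq w w' -> G w = G w') -> (forall w, ~~ uniq w -> G w = 0) ->
  \sum_(w <- words L n) G w = n`!%:R * \sum_(w <- words L n | sorted gtn w) G w.
Proof.
move=> Gp Gu.
have geq_total : total geq by move=> a b; exact: leq_total.
have geq_trans : transitive geq by move=> a b c /= ab bc; exact: leq_trans bc ab.
have geq_anti : antisymmetric geq by move=> a b /= h; apply/eqP; rewrite eqn_leq andbC.
have perm_words w w' : perm_eq w w' -> w \in words L n -> w' \in words L n.
  by move=> p; rewrite !mem_words (perm_size p) (perm_all _ p).
transitivity (\sum_(w <- words L n | uniq w)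
   \sum_(s <- words L n | sorted gtn s) (perm_eq s w)%:R * G s).
  rewrite [LHS](bigID (fun w : seq nat => uniq w)) /= [X in _ + X]big1 ?addr0; last exact: Gu.
  rewrite big_seq_cond [RHS]big_seq_cond; apply: eq_bigr => w /andP[ww uw].
  have ps : perm_eq (sort geq w) w by rewrite perm_sort.
  have ss : sorted gtn (sort geq w).
    by rewrite gtn_sorted_uniq_geq sort_uniq uw sort_sorted.
  rewrite big_mkcond (bigD1_seq (sort geq w)) ?words_uniq //=; last first.
    by apply: perm_words ww; rewrite perm_sym.
  rewrite ss ps mul1r (Gp _ _ ps) big1 ?addr0 // => s sn.
  case: ifP => // gs; case: (boolP (perm_eq s w)) => [psw|]; last by rewrite mul0r.
  case/negP: sn; apply/eqP; apply: (sorted_eq geq_trans geq_anti).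
  - by move: gs; rewrite gtn_sorted_uniq_geq => /andP[].
  - exact: sort_sorted.
  - by rewrite (perm_trans psw) // perm_sym.
rewrite exchange_big /= mulr_sumr big_seq_cond [RHS]big_seq_cond.
apply: eq_bigr => s /andP[sw_ gs]; rewrite -mulr_suml; congr (_ * _).
have us : uniq s by move: gs; rewrite gtn_sorted_uniq_geq => /andP[].
have sn : size s = n by move: sw_; rewrite mem_words => /andP[/eqP].
transitivity (\sum_(w <- words L n | uniq w && perm_eq s w) (1 : R)).
  by rewrite [RHS]big_mkcondr; apply: eq_bigr => w _; case: perm_eq.
rewrite -big_filter big_const_seq count_predT iter_addr_0.
rewrite -sn -(size_permutations us); congr (_ *+ _); apply: perm_size; apply: uniq_perm.
- by rewrite filter_uniq // words_uniq.
- exact: permutations_uniq.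
move=> w; rewrite mem_filter mem_permutations perm_sym.
case: (boolP (perm_eq w s)) => pws; rewrite ?andbF ?andbT // (perm_uniq pws) us /=.
by rewrite sn (perm_words s) // perm_sym.
Qed.
End SymmetricSums.

(** * Strictly decreasing words as partitions in a box *)

Section StrictWords.

Lemma conjl_surj m n (v : seq int) : size v = n ->
  pairwise (fun a b : int => b <= a) v -> all (fun c : int => 0 <= c <= m%:Z) v ->
  exists rho, [/\ is_part rho, (head 0 rho <= n)%N, (size rho <= m)%N & conjl n rho = v].
Proof.
elim: m n v => [|m IH] n v sv pv bv.
  exists [::]; split => //=; rewrite -sv; symmetry; apply/all_pred1P.
  by apply: sub_all bv => c /=; lia.
(* v1 collects the positive entries lowered by one; its length becomes the first part of rho. *)
have [v1 [k [ev pv1 bv1]]] : exists v1 k, [/\ v = inc v1 ++ nseq k 0,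
    pairwise (fun a b : int => b <= a) v1 & all (fun c : int => 0 <= c <= m%:Z) v1].
  elim: v pv bv {sv} => [|c v IHv]; first by exists [::], 0%N.
  move=> /= /andP[hc pv] /andP[bc bv]; have [v1 [k [ev pv1 bv1]]] := IHv pv bv.
  have [c0|c0] := ltrP 0 c.
    exists (c - 1 :: v1), k; split => /=; first by rewrite subrK ev.
      rewrite pv1 andbT; move: hc; rewrite ev all_cat => /andP[+ _].
      by rewrite all_map; apply: sub_all => x /=; lia.
    by rewrite bv1 andbT; lia.
  exists [::], (size v).+1; split => //=; have -> : c = 0 by lia.
  congr (_ :: _); apply/all_pred1P; apply/allP => x xv.
  by have := allP hc x xv; have := allP bv x xv; rewrite /=; lia.
have [rho [pr hr sr er]] := IH (size v1) v1 erefl pv1 bv1.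
have nk : n = (size v1 + k)%N by rewrite -sv ev size_cat size_map size_nseq.
have [v10|v10] := posnP (size v1).
  exists [::]; split => //=; rewrite nk v10 add0n ev.
  by case: (v1) v10.
exists (size v1 :: rho); split => /=.
- by rewrite is_part_cons v10 hr pr.
- by rewrite nk leq_addr.
- by rewrite ltnS.
by rewrite er nk addKn ev.
Qed.

Fixpoint subd (v : seq int) : seq int :=
  if v is c :: v' then c - (size v')%:Z :: subd v' else [::].

Lemma size_subd v : size (subd v) = size v.
Proof. by elim: v => //= c v ->. Qed.

Lemma subdK v : addd (subd v) = v.
Proof. by elim: v => //= c v ->; rewrite size_subd subrK. Qed.

Lemma subd_bound (v : seq int) c : pairwise (fun a b : int => b < a) v ->
  all (fun c : int => 0 <= c) v -> all (fun b : int => b < c) v -> 0 <= c ->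
  (size v)%:Z <= c /\ all (fun b : int => b <= c - (size v)%:Z) (subd v).
Proof.
elim: v c => [|b v IH] c //= /andP[hb pv] /andP[b0 av] /andP[bc _] c0.
have [h1 h2] := IH b pv av hb b0; split; first lia.
apply/andP; split; first lia.
by apply: sub_all h2 => x; lia.
Qed.

Lemma subd_decr (v : seq int) : pairwise (fun a b : int => b < a) v ->
  all (fun c : int => 0 <= c) v ->
  pairwise (fun a b : int => b <= a) (subd v) /\ all (fun c : int => 0 <= c) (subd v).
Proof.
elim: v => //= c v IH /andP[hc pv] /andP[c0 av]; have [-> ->] := IH pv av.
have [h1 ->] := subd_bound pv av hc c0; split => //.
by rewrite andbT; lia.
Qed.

Lemma conjl_le_size n rho : all (fun c : int => c <= (size rho)%:Z) (conjl n rho).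
Proof.
elim: rho n => [|m rho IH] n /=; first by rewrite all_nseq lexx orbT.
rewrite all_cat all_nseq orbT andbT all_map.
by apply: sub_all (IH m) => c /=; lia.
Qed.

Lemma addd_lt (v : seq int) m : all (fun c : int => c <= m) v ->
  all (fun c : int => c < m + (size v)%:Z) (addd v).
Proof.
elim: v => //= c v IH /andP[cm /IH h]; apply/andP; split; first lia.
by apply: sub_all h => x; lia.
Qed.

Lemma sumn_absz_addd (v : seq int) : all (fun c : int => 0 <= c) v ->
  sumn (map absz (addd v)) = (sumn (map absz v) + 'C(size v, 2))%N.
Proof.
elim: v => //= c v IH /andP[c0 /IH ->]; rewrite binS bin1; lia.
Qed.

Lemma sumn_absz_conjl n rho : path geq n rho -> sumn (map absz (conjl n rho)) = sumn rho.
Proof.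
have sum0 k : sumn (map absz (nseq k 0)) = 0%N by elim: k.
elim: rho n => [|m rho IH] n; first by rewrite /= sum0.
rewrite [path _ _ _]/= => /andP[_ pm]; rewrite /= map_cat sumn_cat sum0 addn0 -(IH m pm).
have inc_sum (v : seq int) : all (fun c : int => 0 <= c) v ->
    sumn (map absz (inc v)) = (size v + sumn (map absz v))%N.
  by elim: v => //= c v IHv /andP[c0 /IHv ->]; lia.
by rewrite inc_sum ?conjl_ge0 // size_conjl.
Qed.

Lemma size_toW n rho : is_part rho -> (head 0 rho <= n)%N -> size (toW n rho) = n.
Proof. by move=> pr hr; rewrite size_map size_addd size_conjl // path_geq_part. Qed.

Lemma sumn_toW n rho : is_part rho -> (head 0 rho <= n)%N ->
  sumn (toW n rho) = (sumn rho + 'C(n, 2))%N.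
Proof.
move=> pr hr; have pth : path geq n rho by rewrite path_geq_part.
by rewrite /toW sumn_absz_addd ?conjl_ge0 // sumn_absz_conjl // size_conjl.
Qed.

Lemma toW_sorted n rho : sorted gtn (toW n rho).
Proof.
apply: pairwise_sorted.
have := addd_decr (conjl_decr n rho); rewrite -toW_addd pairwise_map.
by apply: sub_pairwise => a b /=; lia.
Qed.

Lemma toW_inj n rho rho' : is_part rho -> is_part rho' ->
  (head 0 rho <= n)%N -> (head 0 rho' <= n)%N -> toW n rho = toW n rho' -> rho = rho'.
Proof.
move=> pr pr' hr hr' e; apply: (conjl_inj pr pr' (n := n)); rewrite ?path_geq_part //.
by apply: addd_inj; rewrite -!toW_addd e.
Qed.

Lemma toW_surj n m w : size w = n -> sorted gtn w -> all (fun k => k < m + n)%N w ->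
  exists rho, [/\ is_part rho, (head 0 rho <= n)%N, (size rho <= m)%N & toW n rho = w].
Proof.
move=> sw_ gw aw; pose v := [seq k%:Z | k <- w].
have pv : pairwise (fun a b : int => b < a) v.
  rewrite pairwise_map; have gt_trans : transitive gtn by move=> a b c /= h1 h2; exact: ltn_trans h2 h1.
  by move: gw; rewrite sorted_pairwise //; apply: sub_pairwise => a b /=; lia.
have av : all (fun c : int => 0 <= c) v by rewrite all_map; apply/allP => k _ /=.
have [pu au] := subd_decr pv av.
have bu : all (fun c : int => 0 <= c <= m%:Z) (subd v).
  have mv : all (fun c : int => c < (m + n)%:Z) v.
    by rewrite all_map; apply: sub_all aw => k /=; lia.
  have [_ h] := subd_bound pv av mv (le0z_nat _).
  apply/allP => c cin; rewrite (allP au _ cin) /=.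
  by have := allP h _ cin; rewrite /= size_map sw_; lia.
have sv : size (subd v) = n by rewrite size_subd size_map.
have [rho [pr hr sr er]] := conjl_surj sv pu bu.
exists rho; split => //; rewrite /toW er subdK /v -map_comp map_id_in //.
Qed.

(** Removing the staircase from letters below L leaves columns of height at most L - n, that is,
    partitions with at most L - n parts of size at most n. *)
Lemma sum_strict_words (V : nmodType) L n (F : seq nat -> V) : (n <= L)%N ->
  \sum_(w <- words L n | sorted gtn w) F w =
  \sum_(rho <- box_seqs (L - n) n | is_part rho) F (toW n rho).
Proof.
move=> nL; rewrite -big_filter -[RHS]big_filter -(big_map (toW n) xpredT F).
apply: perm_big; apply: uniq_perm.
- by rewrite filter_uniq // words_uniq.
- rewrite map_inj_in_uniq ?filter_uniq ?box_seqs_uniq // => x y.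
  rewrite !mem_filter => /andP[px + ] /andP[py +].
  by rewrite !part_in_box // => /andP[_ hx] /andP[_ hy]; exact: toW_inj.
move=> w; rewrite mem_filter mem_words; apply/idP/mapP.
  move=> /andP[gw /andP[/eqP sw_ aw]].
  have aw' : all (fun k => k < L - n + n)%N w by rewrite subnK.
  have [rho [pr hr sr <-]] := toW_surj sw_ gw aw'.
  by exists rho => //; rewrite mem_filter pr part_in_box // sr hr.
move=> [rho]; rewrite mem_filter => /andP[pr]; rewrite part_in_box // => /andP[sr hr] ->.
rewrite toW_sorted size_toW // eqxx /=.
have := addd_lt (conjl_le_size n rho); rewrite -toW_addd all_map size_conjl ?path_geq_part //.
by apply: sub_all => k /=; lia.
Qed.
End StrictWords.

(** * The restricted Cauchy identity *)

Section RestrictedCauchy.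
Variables (R : realType) (q : R) (as_ bs : seq R) (n : nat).
Hypotheses (q_gt0 : 0 < q) (q_lt1 : q < 1).

Let r := Num.sqrt q.
Let c := (size as_ + size bs)%N.

Definition Xoo (w : seq nat) : R := ExU as_ (ExD bs (detoo R w)) [seq k%:Z | k <- w].

Lemma near_seq_nth k (v w : seq int) i : near_seq k v w ->
  (absz (nth 0 v i - nth 0 w i)%R <= k)%N.
Proof.
elim: v w i => [|a v IH] [|b w] [|i] //=; rewrite ?subrr //.
  by case/andP.
by case/andP => _ /IH.
Qed.

(** All factors together move an exponent by at most c. With every letter below L - c, an exponent
    and a letter can then be congruent modulo L only if they are equal. *)
Lemma XL_Xoo L w : all (fun k => k + c < L)%N w -> XL as_ bs L w = Xoo w.
Proof.
move=> aw; apply: eq_ExU_near => v nv; apply: eq_ExD_near => u nu.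
have nw : near_seq c [seq k%:Z | k <- w] u by exact: near_seq_trans nv nu.
have su : size u = size w by rewrite -(near_seq_size nw) size_map.
rewrite /detL /detoo /det_seq; congr (\det _); apply/matrixP => i j; rewrite !mxE.
have i_n : (i < size w)%N by rewrite -su.
have jn : (j < size w)%N by rewrite -su.
have := near_seq_nth i nw; rewrite (nth_map 0%N) // => h.
have h1 := allP aw _ (mem_nth 0%N i_n); have h2 := allP aw _ (mem_nth 0%N jn).
move: (nth 0 u i) (nth 0%N w i) (nth 0%N w j) h h1 h2 => a k l h h1 h2.
have [->|ne] := eqVneq a l%:Z; first by rewrite subrr dvdn0.
rewrite gtnNdvd //; first by move: ne; lia.
lia.
Qed.

Let M := ExB as_ n * (ExB bs n * n`!%:R).

Lemma ExUD_det_bound f w : (forall (a : int) (b : nat), `|f a b| <= 1) -> size w = n ->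
  `|ExU as_ (ExD bs (fun v => det_seq 0 0%N f (size v) v w)) [seq k%:Z | k <- w]| <= M.
Proof.
move=> h sw_; rewrite /M -{1}sw_ -(size_map Posz w); apply: ExU_bound => v sv.
rewrite -{1}sw_ -(size_map Posz w) -sv; apply: ExD_bound => u su.
rewrite (_ : n = size u) ?su ?sv ?size_map //; exact: det_seq_bound.
Qed.

(** A discrepancy requires a letter k with k + c >= L, and then r^(sumn w) <= r^L r^(-c). Only half
    of q^(sumn w) is spent here; the other half controls the sum over words. *)
Lemma XL_Xoo_bound L w : size w = n ->
  r ^+ sumn w * `|XL as_ bs L w - Xoo w| <= M *+ 2 * (r ^+ L * r^-1 ^+ c).
Proof.
move=> sw_; have r0 : 0 < r by exact: r_gt0.
have M0 : 0 <= M.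
  apply: le_trans (normr_ge0 _) (@ExUD_det_bound (fun _ _ => 0) w _ sw_) => *.
  by rewrite normr0 ler01.
have bnd : `|XL as_ bs L w - Xoo w| <= M *+ 2.
  apply: (le_trans (ler_normB _ _)); rewrite mulr2n; apply: lerD.
    apply: (@ExUD_det_bound (fun a k => (dvdn L (absz (a - k%:Z)%R))%:R)) => // a b.
    by rewrite normr_nat; case: dvdn.
  apply: (@ExUD_det_bound (fun a k => (a == k%:Z)%:R)) => // a b.
  by rewrite normr_nat; case: eqP.
have rt0 : 0 <= r ^+ L * r^-1 ^+ c by rewrite mulr_ge0 ?exprn_ge0 ?invr_ge0 ?(ltW r0).
case: (boolP (all (fun k => k + c < L)%N w)) => [aw|/allPn[k kw]].
  by rewrite XL_Xoo // subrr normr0 mulr0 mulr_ge0 // mulrn_wge0.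
rewrite -leqNgt => Lk; rewrite mulrC; apply: ler_pM => //.
  by rewrite exprn_ge0 // ltW.
have kle : (k <= sumn w)%N.
  by rewrite sumnE (big_rem k) //= leq_addr.
have := @rt_ge1 R q q_gt0 q_lt1 L (c + sumn w) (leq_trans Lk _).
rewrite addnC leq_add2l kle -/r exprD => /(_ isT) h.
have rw0 : r ^+ sumn w != 0 by rewrite expf_neq0 // gt_eqF.
have -> : r ^+ L * r^-1 ^+ c = r ^+ sumn w * (r ^+ L * (r^-1 ^+ c * r^-1 ^+ sumn w)).
  by rewrite exprVn [r^-1 ^+ sumn w]exprVn; field; rewrite rw0 expf_neq0 // gt_eqF.
by rewrite -[X in X <= _]mulr1; apply: ler_wpM2l => //; rewrite exprn_ge0 // ltW.
Qed.

Lemma sum_words_expr L (x : R) :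
  \sum_(w <- words L n) x ^+ sumn w = (\sum_(k < L) x ^+ k) ^+ n.
Proof.
rewrite -[X in _ ^+ X](card_ord n) -prodr_const -(sum_words L n (fun=> fun k => x ^+ k)).
apply: eq_big_seq => w /size_words[sw_ _].
by rewrite prodrXr sumnE (big_nth 0%N) big_mkord sw_.
Qed.

Definition Krho rho := \sum_(lam <- box_seqs (size rho + size as_) n | is_part lam)
  skewW 0 as_ lam rho * skewW 0 bs lam rho.

(** Dividing by [bnorm] supplies the normalisation of Q_lam together with the factor 1 / (q;q)_(n -
    lam_1). *)
Definition Zn := \sum_(lam <- box_seqs (size as_) n | is_part lam)
  skewW q as_ lam [::] * skewW q bs lam [::] / bnorm q n lam.

Let VL L := \sum_(w <- words L n | sorted gtn w) q ^+ sumn w * XL as_ bs L w.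
Let SL L := \sum_(w <- words L n | sorted gtn w) q ^+ sumn w * Xoo w.

(** Cancelling n! in [ExUD_Dr] expresses the sum over strict words through the q-Whittaker
    functional, whose limit is known. *)
Lemma VL_cvg : (fun L => VL L.+1) @ \oo --> q ^+ 'C(n, 2) * Zn.
Proof.
have qn0 : qpoch q q n != 0 by apply/lt0r_neq0/qpoch_gt0 => //; exact: ltW.
have e L : VL L.+1 = q ^+ 'C(n, 2) / qpoch q q n *
    (ExU as_ (ExD bs (Dr q L.+1)) (nseq n 0) * (1 - q ^+ L.+1) ^+ n).
  have d0 : 1 - q ^+ L.+1 != 0.
    by rewrite subr_eq0 eq_sym lt_eqF // exprn_ilt1 // ltW.
  have := ExUD_Dr q_gt0 q_lt1 as_ bs n (ltn0Sn L).
  rewrite (@sum_words_sorted R L.+1 n (fun w => q ^+ sumn w * XL as_ bs L.+1 w)); last 2 first.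
  - move=> w w' p; rewrite (XL_perm as_ bs L.+1 p); congr (q ^+ _ * _).
    by rewrite !sumnE; exact: perm_big.
  - by move=> w nu; rewrite XL_nuniq // mulr0.
  rewrite -/(VL _) => h.
  have f0 : n`!%:R != 0 :> R by rewrite pnatr_eq0 -lt0n fact_gt0.
  apply: (mulfI f0); apply: (mulIf (x := qpoch q q n / (1 - q ^+ L.+1) ^+ n)).
    by rewrite mulf_neq0 // invr_eq0 expf_neq0.
  transitivity (qpoch q q n * (1 - q ^+ L.+1)^-1 ^+ n * (n`!%:R * VL L.+1)).
    by rewrite exprVn; ring.
  by rewrite -h; field; rewrite qn0 expf_neq0.
under eq_fun do rewrite e.
have -> : q ^+ 'C(n, 2) * Zn =
    q ^+ 'C(n, 2) / qpoch q q n * (qpoch q q n * Zn * (1 - 0) ^+ n).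
  by rewrite subr0 expr1n mulr1; field.
apply: cvgMl_tmp; apply: cvgM.
  have := @ExUD_Dr_cvg R q q_gt0 q_lt1 as_ bs n _ (leqnn (size as_)).
  suff -> : \sum_(lam <- box_seqs (size as_) n | is_part lam)
      bnorm q n [::] / bnorm q n lam * skewW q as_ lam [::] * skewW q bs lam [::] =
      qpoch q q n * Zn by [].
  rewrite /Zn mulr_sumr; apply: eq_bigr => lam _.
  by rewrite {1}/bnorm subn0 big_ord0 mulr1; ring.
have q0 : (fun L => q ^+ L.+1) @ \oo --> (0 : R).
  apply: (@geometric_cvg0 R q q_gt0 q_lt1 _ 1) => L; rewrite mul1r.
  rewrite ger0_norm ?exprn_ge0 ?(ltW q_gt0) //.
  apply: lerXn2r; rewrite ?nnegrE ?(ltW q_gt0) ?(ltW (r_gt0 q_gt0)) //.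
  by rewrite -{1}(r_sqr q_gt0) expr2 ger_pMr ?r_gt0 // (ltW (r_lt1 q_lt1)).
have h : (fun L => 1 - q ^+ L.+1) @ \oo --> (1 - 0 : R) by exact: cvgB (cvg_cst _) q0.
elim: n {e qn0} => [|k IH]; first by under eq_fun do rewrite expr0; rewrite expr0; exact: cvg_cst.
rewrite exprS; under eq_fun do rewrite exprS; exact: (cvgM h IH).
Qed.

Lemma SL_cvg : (fun L => SL L.+1) @ \oo --> q ^+ 'C(n, 2) * Zn.
Proof.
have r0 : 0 < r by exact: r_gt0.
have r1 : 0 < 1 - r by rewrite subr_gt0; exact: r_lt1.
have d0 : (fun L => VL L.+1 - SL L.+1) @ \oo --> (0 : R).
  apply: (@geometric_cvg0 R q q_gt0 q_lt1 _ (M *+ 2 * r^-1 ^+ c * (1 - r)^-1 ^+ n)) => L.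
  rewrite /VL /SL -sumrB; apply: (le_trans (ler_norm_sum _ _ _)).
  apply: (@le_trans _ _ (\sum_(w <- words L.+1 n) r ^+ sumn w * (M *+ 2 * (r ^+ L.+1 * r^-1 ^+ c)))).
    rewrite big_mkcond big_seq [X in _ <= X]big_seq; apply: ler_sum => w /size_words[sw_ _].
    have b0 := XL_Xoo_bound L.+1 sw_.
    have M0 : 0 <= r ^+ sumn w by rewrite exprn_ge0 // ltW.
    case: ifP => _; last first.
      by rewrite mulr_ge0 //; apply: le_trans b0; rewrite mulr_ge0.
    rewrite -mulrBr normrM ger0_norm ?exprn_ge0 ?(ltW q_gt0) //.
    by rewrite -(r_sqr q_gt0) -exprM mulnC exprM expr2 -mulrA; exact: ler_wpM2l.
  (* The remaining half-weights sum to the n-th power of a geometric sum, bounded uniformly in L. *)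
  rewrite -mulr_suml sum_words_expr mulrC.
  have -> : M *+ 2 * r^-1 ^+ c * (1 - r)^-1 ^+ n * r ^+ L.+1 =
    M *+ 2 * (r ^+ L.+1 * r^-1 ^+ c) * (1 - r)^-1 ^+ n by ring.
  apply: ler_wpM2l.
    by apply: le_trans (XL_Xoo_bound L.+1 (size_nseq n 0%N)); rewrite mulr_ge0 // exprn_ge0 // ltW.
  apply: lerXn2r; rewrite ?nnegrE ?invr_ge0 ?(ltW r1) //.
    by apply: sumr_ge0 => k _; rewrite exprn_ge0 // ltW.
  rewrite -[(1 - r)^-1]mul1r ler_pdivlMr // mulrC -opprB mulNr -subrX1 opprB.
  by rewrite gerBl exprn_ge0 // ltW.
have -> : (fun L => SL L.+1) = (fun L => VL L.+1 - (VL L.+1 - SL L.+1)).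
  by apply/funext => L; rewrite subKr.
by rewrite -[X in _ --> X]subr0; apply: cvgB => //; exact: VL_cvg.
Qed.

Lemma Krho_cvg :
  (fun m => \sum_(rho <- box_seqs m n | is_part rho) q ^+ sumn rho * Krho rho) @ \oo --> Zn.
Proof.
have qc0 : q ^+ 'C(n, 2) != 0 by rewrite expf_neq0 // gt_eqF.
rewrite -cvg_shiftS /=.
have -> : Zn = (q ^+ 'C(n, 2))^-1 * (q ^+ 'C(n, 2) * Zn) by rewrite mulKf.
(* Letters below m + n + 1 correspond to at most m + 1 parts, and the staircase accounts for
   q^C(n,2). *)
have e m : \sum_(rho <- box_seqs m.+1 n | is_part rho) q ^+ sumn rho * Krho rho =
    (q ^+ 'C(n, 2))^-1 * SL (m + n).+1.
  rewrite /SL sum_strict_words; last by rewrite ltnW // ltnS leq_addl.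
  rewrite -addSn addnK mulr_sumr big_seq_cond [RHS]big_seq_cond.
  apply: eq_bigr => rho /andP[+ pr]; rewrite part_in_box // => /andP[_ hr].
  by rewrite sumn_toW // /Xoo (ExUD_detoo bs pr hr (leqnn _)) exprD -/(Krho rho); field.
under eq_fun do rewrite e.
apply: cvgMl_tmp; have := SL_cvg.
by rewrite -(cvg_shiftn n).
Qed.
End RestrictedCauchy.

(** * Distribution of the first parts *)

Section SumsOverPartitions.
Variable R : realType.

Lemma esum_uniq_seq (I : choiceType) (S : set I) (f : I -> R) (r : seq I) :
  uniq r -> (forall i, i \in r -> S i) -> (forall i, S i -> 0 <= f i) ->
  (forall i, S i -> i \notin r -> f i = 0) ->
  (\esum_(i in S) (f i)%:E = (\sum_(i <- r) f i)%:E)%E.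
Proof.
move=> ur rS f0 fr; rewrite (esumID [set` r]); last by move=> i Si; rewrite lee_fin f0.
rewrite [X in (_ + X)%E]esum1 ?adde0; last first.
  by move=> i [Si /negP ir]; rewrite fr.
have -> : S `&` [set` r] = [set` r].
  by apply/seteqP; split => i /=; [case|move=> ir; split => //; exact: rS].
rewrite esum_fset //; last by move=> i; rewrite inE /= => ir; rewrite lee_fin; exact/f0/rS.
by rewrite -fsbig_seq // sumEFin.
Qed.

Definition parts n : set (seq nat) := [set l | is_part l && (head 0 l <= n)%N].

(** The terms are nonnegative and boxes of growing height exhaust the partitions of width n, so the
    limit of the box sums is the supremum over finite sets. *)
Lemma esum_parts_cvg (f : seq nat -> R) n (l : R) :
  (forall rho, parts n rho -> 0 <= f rho) ->
  (fun m => \sum_(rho <- box_seqs m n | is_part rho) f rho) @ \oo --> l ->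
  (\esum_(rho in parts n) (f rho)%:E = l%:E)%E.
Proof.
move=> f0 fl; pose u m := \sum_(rho <- box_seqs m n | is_part rho) f rho.
have boxP m rho : rho \in [seq x <- box_seqs m n | is_part x] ->
    parts n rho /\ (size rho <= m)%N.
  by rewrite mem_filter => /andP[pr]; rewrite part_in_box // => /andP[sr hr]; rewrite /parts /= pr hr.
have uE m : ((u m)%:E = \sum_(rho \in [set` [seq x <- box_seqs m n | is_part x]]) (f rho)%:E)%E.
  by rewrite -fsbig_seq ?filter_uniq ?box_seqs_uniq // sumEFin big_filter.
have u_le m m' : (m <= m')%N -> u m <= u m'.
  move=> mm; rewrite -lee_fin !uE.
  apply: lee_fsum_nneg_subset; [exact: finite_seq|exact: finite_seq| |].
    move=> rho; rewrite !inE /= !mem_filter => /andP[pr].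
    by rewrite pr !part_in_box // => /andP[sr ->]; rewrite andbT (leq_trans sr).
  move=> rho; rewrite inE /= => /andP[_]; rewrite inE => /boxP[pr _].
  by rewrite lee_fin f0.
have u_lim m : u m <= l.
  rewrite -(cvg_lim (@Rhausdorff R) fl); apply: nondecreasing_cvgn_le.
    by move=> a b; exact: u_le.
  by apply/cvg_ex; exists l.
apply/eqP; rewrite eq_le; apply/andP; split.
  apply: ge_ereal_sup => _ [X [finX XS] <-].
  have [s es] := (finite_seqP X).1 finX.
  pose m := \max_(x <- s) size x.
  apply: (@le_trans _ _ (u m)%:E); last by rewrite lee_fin.
  rewrite uE; apply: lee_fsum_nneg_subset; [exact: finX|exact: finite_seq| |].
    move=> rho; rewrite inE => Xr; have := XS _ Xr => /andP[pr hr].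
    rewrite inE /= mem_filter pr part_in_box // hr andbT /m.
    by apply: leq_bigmax_seq => //; move: Xr; rewrite es.
  move=> rho; rewrite inE /= => /andP[_]; rewrite inE => /boxP[pr _].
  by rewrite lee_fin f0.
have u_esum m : ((u m)%:E <= \esum_(rho in parts n) (f rho)%:E)%E.
  apply: esum_ge; exists [set` [seq x <- box_seqs m n | is_part x]]; last by rewrite uE.
  by split => [|rho /= /boxP[]] //; exact: finite_seq.
have : (0%:E <= \esum_(rho in parts n) (f rho)%:E)%E.
  by apply: esum_ge0 => rho pr; rewrite lee_fin f0.
move: u_esum; case: (\esum_(rho in parts n) (f rho)%:E)%E => [e| |] //= h _.
  rewrite lee_fin -(cvg_lim (@Rhausdorff R) fl); apply: limr_le.
    by apply/cvg_ex; exists l.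
  by apply: nearW => m; rewrite -lee_fin; exact: h.
by rewrite leey.
Qed.

Lemma psiW_ge0 (q : R) lam mu : 0 <= q -> q < 1 -> 0 <= psiW q lam mu.
Proof.
move=> q0 q1; apply: prodr_ge0 => i _; have P n := ltW (qpoch_gt0 n q0 q1).
by rewrite divr_ge0 ?mulr_ge0.
Qed.

Lemma skewW_ge0 (q : R) xs lam rho : 0 <= q -> q < 1 -> (forall x, x \in xs -> 0 < x) ->
  0 <= skewW q xs lam rho.
Proof.
move=> q0 q1; elim: xs lam => [|x xs IH] lam h /=; first by rewrite ler0n.
apply: sumr_ge0 => mu _; rewrite !mulr_ge0 ?psiW_ge0 ?exprn_ge0 ?IH //.
  by apply: ltW; apply: h; rewrite mem_head.
by move=> y yx; apply: h; rewrite in_cons yx orbT.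
Qed.

Lemma psiW0 lam mu : psiW (0 : R) lam mu = 1.
Proof. by rewrite /psiW big1 // => i _; rewrite !qpoch00 !mul1r invr1. Qed.

Lemma skewS_revE xs lam rho : skewS_rev xs lam rho = skewW (0 : R) xs lam rho.
Proof.
elim: xs lam => [|x xs IH] lam //=; apply: eq_bigr => mu _.
by rewrite psiW0 mul1r IH.
Qed.

Lemma qWP_revE (q : R) xs lam : qWP_rev q xs lam = skewW q xs lam [::].
Proof. by elim: xs lam => [|x xs IH] lam //=; apply: eq_bigr => mu _; rewrite IH. Qed.

Lemma subpartP rho lam :
  reflect (forall i, nth 0 rho i <= nth 0 lam i)%N (subpart rho lam).
Proof.
apply: (iffP allP) => [h i|h i _]; last exact: h.
have [ir|ir] := ltnP i (size rho); last by rewrite nth_default.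
by apply: h; rewrite mem_iota.
Qed.

Lemma subpart_size rho lam : is_part rho -> subpart rho lam -> (size rho <= size lam)%N.
Proof.
move=> /andP[_ /allP pr] /subpartP h; rewrite leqNgt; apply/negP => s.
have := h (size lam); rewrite (nth_default _ (leqnn (size lam))) leqNgt => /negP; apply.
exact/pr/mem_nth.
Qed.

Lemma interlace_subpart mu lam : is_part mu -> interlace mu lam -> subpart mu lam.
Proof.
move=> pm il; apply/allP => i; rewrite mem_iota => /andP[_ im].
have /andP[sm _] := interlace_size pm il.
have := allP il i; rewrite mem_iota /= => h.
suff /h/andP[] : (i < (size lam).+1)%N by [].
by move: im; rewrite add0n => im; apply: leq_trans im _; exact: leq_trans sm _.
Qed.

Lemma skewW_subpart (q : R) xs lam rho : is_part lam -> skewW q xs lam rho != 0 ->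
  subpart rho lam.
Proof.
elim: xs lam => [|x xs IH] lam pl /=.
  by case: (lam =P rho) => [->|_]; rewrite ?eqxx // => _; apply/subpartP.
apply: contraR => ns; rewrite big1_seq // => mu /andP[/andP[pm il] _].
have [->|/(IH _ pm) /subpartP s1] := eqVneq (skewW q xs mu rho) 0; first by rewrite mulr0.
case/negP: ns; apply/subpartP => i; apply: leq_trans (s1 i) _.
by have /subpartP := interlace_subpart pm il.
Qed.

(** Up to (q;q)_oo this is the distribution function of chi; at m = n - mu_1 it supplies the extra
    factor in [Zn]. *)
Lemma sum_chi (q : R) m : 0 <= q -> q < 1 ->
  \sum_(k < m.+1) q ^+ k / qpoch q q k = (qpoch q q m)^-1.
Proof.
move=> q0 q1; have P n := lt0r_neq0 (qpoch_gt0 n q0 q1).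
elim: m => [|m IH]; first by rewrite big_ord1 expr0 mul1r.
rewrite big_ord_recr /= IH; have := P m.+1; rewrite qpochS mulf_eq0 negb_or => /andP[h1 h2].
by rewrite exprS; field; rewrite h1 h2.
Qed.

Lemma esum_exchange (T1 T2 : choiceType) (I : set T1) (J : set T2) (f : T1 -> T2 -> \bar R) :
  (forall i j, I i -> J j -> (0 <= f i j)%E) ->
  (\esum_(i in I) \esum_(j in J) f i j = \esum_(j in J) \esum_(i in I) f i j)%E.
Proof.
move=> f0; rewrite !esum_esum //; last by move=> j i Jj Ii; exact: f0.
rewrite (@reindex_esum _ _ _ (J `*`` fun=> I) _ (fun p => (p.2, p.1))) //.
split.
- by move=> [j i] [].
- by move=> [j i] [j' i'] _ _ [-> ->].
- by move=> [i j] [Ii Jj]; exists (j, i).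
Qed.
End SumsOverPartitions.

(** * Statement (a): both probabilities as multiples of [Zn] *)

Section PartA.
Variables (R : realType) (q : R) (a b : seq R).
Hypotheses (q_gt0 : 0 < q) (q_lt1 : q < 1).
Hypotheses (a_gt0 : forall x, x \in a -> 0 < x) (b_gt0 : forall y, y \in b -> 0 < y).
Hypothesis ab_lt1 : forall x y, x \in a -> y \in b -> x * y < 1.

Let q_ge0 : 0 <= q := ltW q_gt0.

Lemma qpoch_ge0 x n : 0 <= x -> x < 1 -> 0 <= qpoch x q n.
Proof.
move=> x0 x1; apply: prodr_ge0 => i _; rewrite subr_ge0.
by rewrite mulr_ile1 ?exprn_ge0 ?exprn_ile1 // ltW.
Qed.

Lemma qpoch_cvg x : 0 <= x -> x < 1 -> cvgn (qpoch x q).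
Proof.
move=> x0 x1; apply: nonincreasing_is_cvgn; last first.
  by exists 0 => _ [n _ <-]; exact: qpoch_ge0.
apply/nonincreasing_seqP => n; rewrite qpochS.
rewrite -[X in _ <= X]mulr1; apply: ler_wpM2l; first exact: qpoch_ge0.
by rewrite gerBl mulr_ge0 // exprn_ge0.
Qed.

Lemma qpinf_ge0 x : 0 <= x -> x < 1 -> 0 <= qpinf x q.
Proof.
move=> x0 x1; apply: limr_ge; first exact: qpoch_cvg.
by apply: nearW => n; exact: qpoch_ge0.
Qed.

Lemma cauchy_prod_ge0 : 0 <= cauchy_prod q a b.
Proof.
rewrite /cauchy_prod big_seq; apply: prodr_ge0 => x xa.
rewrite big_seq; apply: prodr_ge0 => y yb.
apply: qpinf_ge0; last exact: ab_lt1.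
by apply: mulr_ge0; apply: ltW; [exact: a_gt0|exact: b_gt0].
Qed.

Let A := cauchy_prod q a b.
Let Q := qpinf q q.

Let A_ge0 : 0 <= A := cauchy_prod_ge0.
Lemma Q_ge0 : 0 <= Q. Proof. exact: qpinf_ge0. Qed.

Let sa lam rho := skewW 0 (rev a) lam rho.
Let sb lam rho := skewW 0 (rev b) lam rho.

Lemma rev_gt0 (s : seq R) : (forall x, x \in s -> 0 < x) -> forall x, x \in rev s -> 0 < x.
Proof. by move=> h x; rewrite mem_rev; exact: h. Qed.

Lemma MqWE mu : MqW q a b mu =
  A * (skewW q (rev a) mu [::] * skewW q (rev b) mu [::] /
       \prod_(j < size mu) qpoch q q (nth 0 mu j - nth 0 mu j.+1)%N).
Proof. by rewrite /MqW /qWQ /qWP !qWP_revE -/A; ring. Qed.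

Lemma MqW_ge0 mu : 0 <= MqW q a b mu.
Proof.
rewrite MqWE mulr_ge0 // divr_ge0 ?prodr_ge0 ?mulr_ge0 //.
- by apply: skewW_ge0 => //; exact: rev_gt0.
- by apply: skewW_ge0 => //; exact: rev_gt0.
by move=> i _; apply/ltW/qpoch_gt0.
Qed.

Lemma MqW_eq0 mu : is_part mu -> (size a < size mu)%N -> MqW q a b mu = 0.
Proof.
move=> pm sm; rewrite MqWE; have [->|/(skewW_size pm)] := eqVneq (skewW q (rev a) mu [::]) 0.
  by rewrite !mul0r mulr0.
by rewrite size_rev add0n leqNgt sm.
Qed.

Lemma Pchi_ge0 k : 0 <= Pchi q k.
Proof.
by rewrite mulr_ge0 ?Q_ge0 // divr_ge0 ?exprn_ge0 // ltW // qpoch_gt0.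
Qed.

Lemma sum_Pchi m : \sum_(k < m.+1) Pchi q k = Q / qpoch q q m.
Proof. by rewrite -mulr_suml sum_chi // mulrC. Qed.

Lemma probA_qWE n : (probA_qW q a b n = (A * Q * Zn q (rev a) (rev b) n)%:E)%E.
Proof.
pose ms := [seq mu <- box_seqs (size a) n | is_part mu].
pose r := [seq (mu, k) | mu <- ms, k <- iota 0 (n - head 0%N mu).+1].
have msP mu : (mu \in ms) = [&& is_part mu, (size mu <= size a)%N & (head 0 mu <= n)%N].
  by rewrite mem_filter; case: (boolP (is_part mu)) => // pm; rewrite part_in_box.
have rP mu k : ((mu, k) \in r) = (mu \in ms) && (k <= n - head 0 mu)%N.
  apply/allpairsPdep/andP => [[m [j [mm jm [-> ->]]]]|[mm jm]].
    by split => //; move: jm; rewrite mem_iota.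
  by exists mu, k; rewrite mem_iota.
rewrite /probA_qW (esum_uniq_seq (r := r)).
- congr (_%:E); rewrite big_allpairs_dep big_filter /Zn size_rev mulr_sumr.
  rewrite big_seq_cond [RHS]big_seq_cond; apply: eq_bigr => mu /andP[_ pm].
  rewrite sum_iota_ord /= -mulr_sumr sum_Pchi MqWE /bnorm invfM /=.
  by ring.
- apply: allpairs_uniq_dep; rewrite ?filter_uniq ?box_seqs_uniq //.
    by move=> ? _; exact: iota_uniq.
  by move=> [x i] [y j] _ _ /= [-> ->].
- move=> [mu k]; rewrite rP msP => /andP[/and3P[pm sm hm] hk] /=.
  by rewrite pm; lia.
- by move=> [mu k] _; rewrite mulr_ge0 ?MqW_ge0 ?Pchi_ge0.
move=> [mu k] /= /andP[pm hk]; rewrite rP msP pm.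
have -> : (head 0 mu <= n)%N by lia.
have -> : (k <= n - head 0 mu)%N by lia.
by rewrite !andbT -ltnNge => sm; rewrite MqW_eq0 // mul0r.
Qed.

Lemma MpSE lam : MpS q a b lam = Q * A *
  \sum_(rho <- box_seqs (size lam) (head 0%N lam) | is_part rho && subpart rho lam)
     q ^+ sumn rho * (sa lam rho * sb lam rho).
Proof.
rewrite /MpS -/A -/Q; congr (_ * _); apply: eq_bigr => rho _.
by rewrite /skewS !skewS_revE mulrA.
Qed.

Lemma sasb_ge0 lam rho : 0 <= sa lam rho * sb lam rho.
Proof. by rewrite mulr_ge0 ?skewW_ge0 //; exact: rev_gt0. Qed.

Lemma MpS_ge0 lam : 0 <= MpS q a b lam.
Proof.
rewrite MpSE mulr_ge0 ?mulr_ge0 ?Q_ge0 //; apply: sumr_ge0 => rho _.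
by rewrite mulr_ge0 ?exprn_ge0 ?sasb_ge0.
Qed.

(** Nonnegativity allows exchanging the sums over lam and rho; for fixed rho the inner sum is
    [Krho], and [Krho_cvg] sums over rho. *)
Lemma probA_pSE n : (probA_pS q a b n = (A * Q * Zn q (rev a) (rev b) n)%:E)%E.
Proof.
pose f lam rho := Q * A * (q ^+ sumn rho * (sa lam rho * sb lam rho)).
have f0 lam rho : 0 <= f lam rho.
  by rewrite /f !mulr_ge0 ?Q_ge0 ?exprn_ge0 // skewW_ge0 //; exact: rev_gt0.
(* Since terms with rho outside lam vanish, rho can range over a set independent of lam. *)
have fsub lam rho : is_part lam -> ~~ subpart rho lam -> f lam rho = 0.
  move=> pl ns; rewrite /f /sa; have [->|/(skewW_subpart pl)] := eqVneq (skewW 0 (rev a) lam rho) 0.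
    by rewrite mul0r !mulr0.
  by rewrite (negbTE ns).
transitivity (\esum_(lam in parts n) \esum_(rho in parts n) (f lam rho)%:E)%E.
  apply: eq_esum => lam /andP[pl hl].
  rewrite (esum_uniq_seq (r := [seq rho <- box_seqs (size lam) (head 0%N lam) | is_part rho && subpart rho lam])).
  - by rewrite MpSE big_filter mulr_sumr.
  - by rewrite filter_uniq // box_seqs_uniq.
  - move=> rho; rewrite mem_filter => /andP[/andP[pr _]].
    by rewrite part_in_box // => /andP[_ hr]; rewrite /parts /= pr (leq_trans hr).
  - by move=> rho _; exact: f0.
  move=> rho /andP[pr hr]; rewrite mem_filter pr part_in_box //=.
  case: (boolP (subpart rho lam)) => [sr|/fsub->//].
  rewrite subpart_size //=; move/subpartP: sr => /(_ 0%N); rewrite !nth0 => ->.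
  by [].
rewrite esum_exchange; last by move=> lam rho _ _; rewrite lee_fin f0.
have -> : (\esum_(rho in parts n) \esum_(lam in parts n) (f lam rho)%:E =
   \esum_(rho in parts n) (A * Q * (q ^+ sumn rho * Krho (rev a) (rev b) n rho))%:E)%E.
  apply: eq_esum => rho /andP[pr hr].
  rewrite (esum_uniq_seq (r := [seq lam <- box_seqs (size rho + size a) n | is_part lam])).
  - rewrite big_filter /Krho size_rev !mulr_sumr; congr (_%:E); apply: eq_bigr => lam _.
    by rewrite /f /sa /sb; ring.
  - by rewrite filter_uniq // box_seqs_uniq.
  - move=> lam; rewrite mem_filter => /andP[pl].
    by rewrite part_in_box // => /andP[_ hl]; rewrite /parts /= pl.
  - by move=> lam _; exact: f0.
  move=> lam /andP[pl hl]; rewrite mem_filter pl part_in_box // hl andbT /= -ltnNge => sl.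
  rewrite /f /sa; have [->|/(skewW_size pl)] := eqVneq (skewW 0 (rev a) lam rho) 0.
    by rewrite mul0r !mulr0.
  by rewrite size_rev leqNgt sl.
apply: esum_parts_cvg.
  move=> rho _; rewrite !mulr_ge0 ?Q_ge0 ?exprn_ge0 // /Krho sumr_ge0 // => lam _.
  exact: sasb_ge0.
under eq_fun do rewrite -mulr_sumr.
by apply: cvgMl_tmp; exact: Krho_cvg.
Qed.

Lemma probA_eq n : probA_qW q a b n = probA_pS q a b n.
Proof. by rewrite probA_qWE probA_pSE. Qed.
End PartA.

(** * Euler's identity and the theta function *)

Section QSeries.
Variables (R : realType) (q : R).
Hypotheses (q_gt0 : 0 < q) (q_lt1 : q < 1).

Let q_ge0 : 0 <= q := ltW q_gt0.

Lemma sum_geometric_le n : \sum_(i < n) q ^+ i <= (1 - q)^-1.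
Proof.
have r1 : 0 < 1 - q by rewrite subr_gt0.
rewrite -[(1 - q)^-1]mul1r ler_pdivlMr // mulrC -opprB mulNr -subrX1 opprB.
by rewrite gerBl exprn_ge0.
Qed.

Lemma qpoch_rec x n : qpoch x q n.+1 = (1 - x) * qpoch (x * q) q n.
Proof.
rewrite /qpoch big_ord_recl expr0 mulr1; congr (_ * _); apply: eq_bigr => i _.
by rewrite lift0 exprS mulrA.
Qed.

Lemma qpochN_ge1 x n : 0 <= x -> 1 <= qpoch (- x) q n.
Proof.
move=> x0; elim: n => [|n IH]; first by rewrite qpoch0.
rewrite qpochS mulNr opprK; apply: (le_trans IH).
rewrite -[X in X <= _]mulr1; apply: ler_wpM2l; first exact: le_trans IH.
by rewrite lerDl mulr_ge0 // exprn_ge0.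
Qed.

Lemma qpochN_le x n : 0 <= x -> qpoch (- x) q n <= expR (x / (1 - q)).
Proof.
move=> x0; apply: (@le_trans _ _ (expR (x * \sum_(i < n) q ^+ i))); last first.
  by rewrite ler_expR; apply: ler_wpM2l => //; exact: sum_geometric_le.
elim: n => [|n IH]; first by rewrite qpoch0 big_ord0 mulr0 expR0.
rewrite qpochS big_ord_recr /= [x * (_ + _)]mulrDr expRD mulNr opprK.
have h := qpochN_ge1 n x0; apply: ler_pM => //; first exact: le_trans h.
  by rewrite addr_ge0 // mulr_ge0 // exprn_ge0.
exact: expR_ge1Dx.
Qed.

Lemma qpochN_cvg x : 0 <= x -> cvgn (qpoch (- x) q).
Proof.
move=> x0; apply: nondecreasing_is_cvgn; last first.
  by exists (expR (x / (1 - q))) => _ [n _ <-]; exact: qpochN_le.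
apply/nondecreasing_seqP => n; rewrite qpochS mulNr opprK.
rewrite -[X in X <= _]mulr1; apply: ler_wpM2l; first exact: le_trans (qpochN_ge1 n x0).
by rewrite lerDl mulr_ge0 // exprn_ge0.
Qed.

Lemma qpinfN_gt0 x : 0 <= x -> 0 < qpinf (- x) q.
Proof.
move=> x0; apply: (lt_le_trans ltr01); apply: limr_ge; first exact: qpochN_cvg.
by apply: nearW => n; exact: qpochN_ge1.
Qed.

Lemma qpinfN_rec x : 0 <= x -> qpinf (- x) q = (1 + x) * qpinf (- (x * q)) q.
Proof.
move=> x0; apply: (cvg_lim (@Rhausdorff R)); rewrite -cvg_shiftS /=.
under eq_fun do rewrite qpoch_rec opprK mulNr.
by apply: cvgMl_tmp; apply: qpochN_cvg; rewrite mulr_ge0.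
Qed.

(** Uses 1 - y >= exp(- y / (1 - y)) at y = q^(n+1), with y / (1 - y) <= q^n / (1 - q). Uniformity
    in n gives (q;q)_oo > 0. *)
Lemma qpoch_lower n : expR (- ((1 - q)^-1 ^+ 2)) <= qpoch q q n.
Proof.
have r1 : 0 < 1 - q by rewrite subr_gt0.
apply: (@le_trans _ _ (expR (- ((1 - q)^-1 * \sum_(i < n) q ^+ i)))).
  rewrite ler_expR lerN2 expr2; apply: ler_wpM2l; first by rewrite invr_ge0 ltW.
  exact: sum_geometric_le.
elim: n => [|n IH]; first by rewrite qpoch0 big_ord0 mulr0 oppr0 expR0.
rewrite qpochS big_ord_recr /= [_ * (\sum_(i < n) _ + _)]mulrDr opprD expRD.
apply: ler_pM => //; rewrite ?expR_ge0 //.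
have y1 : q * q ^+ n < 1 by rewrite -exprS exprn_ilt1.
have d0 : 0 < 1 - q * q ^+ n by rewrite subr_gt0.
rewrite expRN -[X in _ <= X]invrK lef_pV2 ?posrE ?invr_gt0 ?expR_gt0 //.
apply: (le_trans _ (expR_ge1Dx _)).
have -> : (1 - q * q ^+ n)^-1 = 1 + (q * q ^+ n) / (1 - q * q ^+ n).
  by field; rewrite gt_eqF.
rewrite lerD2l ler_pdivrMr // -mulrA [(1 - q)^-1 * _]mulrC ler_pdivlMr //.
apply: (@le_trans _ _ (q ^+ n * (1 - q))).
  by apply: ler_wpM2r; rewrite ?(ltW r1) // ger_pMl ?exprn_gt0 // ltW.
apply: ler_wpM2l; rewrite ?exprn_ge0 // lerD2l lerN2.
by rewrite ger_pMr // exprn_ile1 // ltW.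
Qed.

Lemma qpoch_qq_cvg : cvgn (qpoch q q).
Proof. by apply: qpoch_cvg. Qed.

Lemma qpinf_gt0 : 0 < qpinf q q.
Proof.
apply: (lt_le_trans (expR_gt0 (- ((1 - q)^-1 ^+ 2)))); apply: limr_ge; first exact: qpoch_qq_cvg.
by apply: nearW => n; exact: qpoch_lower.
Qed.

Lemma q_binomial z n :
  qpoch (- z) q n = \sum_(j < n.+1) qbin q n j * q ^+ 'C(j, 2) * z ^+ j.
Proof.
elim: n z => [|n IH] z; first by rewrite big_ord1 qpoch0 qbin0 // !mulr1.
rewrite qpoch_rec opprK mulNr IH.
pose T j := qbin q n j * q ^+ 'C(j, 2) * (z * q) ^+ j.
transitivity (\sum_(j < n.+2) T j + \sum_(j < n.+1) z * T j).
  have T0 : T n.+1 = 0 by rewrite /T qbin_gt // !mul0r.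
  by rewrite mulrDl mul1r mulr_sumr [X in _ = X + _]big_ord_recr /= T0 addr0.
rewrite big_ord_recl [RHS]big_ord_recl -addrA; congr (_ + _).
  by rewrite /T !qbin0 // expr0 !mul1r.
rewrite -big_split; apply: eq_bigr => j _; rewrite /= /bump /= add1n qbin_pascal //.
rewrite /T binS bin1 exprD !exprMn !exprS; ring.
Qed.

Definition euler_sum z N := \sum_(j < N) z ^+ j * q ^+ 'C(j, 2) / qpoch q q j.

Lemma qbin_le n j : qbin q n j <= (qpoch q q j)^-1.
Proof.
have P k := qpoch_gt0 k q_ge0 q_lt1.
rewrite /qbin; case: ifP => [jn|_]; last by rewrite invr_ge0 ltW.
rewrite invfM mulrCA -[X in _ <= X]mulr1; apply: ler_wpM2l; first by rewrite invr_ge0 ltW.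
have decr m k : qpoch q q (m + k) <= qpoch q q m.
  elim: k => [|k IH]; first by rewrite addn0.
  rewrite addnS qpochS; apply: le_trans IH.
  by rewrite ger_pMr // gerBl -exprS exprn_ge0.
by rewrite ler_pdivrMr // mul1r -{1}(subnK jn).
Qed.

Lemma qbin_cvg j : (qbin q)^~ j @ \oo --> (qpoch q q j)^-1.
Proof.
have Q0 := qpinf_gt0; have P k := qpoch_gt0 k q_ge0 q_lt1.
rewrite -(cvg_shiftn j) /=.
have -> : (fun n => qbin q (n + j) j) =
    (fun n => (qpoch q q j)^-1 * (qpoch q q (n + j) * (qpoch q q n)^-1)).
  apply/funext => n; rewrite /qbin leq_addl addnK; field.
  by rewrite !gt_eqF.
suff : (fun n => (qpoch q q j)^-1 * (qpoch q q (n + j) * (qpoch q q n)^-1)) @ \oo -->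
    (qpoch q q j)^-1 * (qpinf q q * (qpinf q q)^-1) by rewrite divff ?gt_eqF // mulr1.
apply: cvgMl_tmp; apply: cvgM.
  by rewrite (cvg_shiftn j (qpoch q q)); exact: qpoch_qq_cvg.
by apply: cvgV; [rewrite gt_eqF|exact: qpoch_qq_cvg].
Qed.

Lemma euler_sum_le z N : 0 <= z -> euler_sum z N <= qpinf (- z) q.
Proof.
move=> z0.
have h : (fun n => \sum_(j <- iota 0 N) qbin q n j * q ^+ 'C(j, 2) * z ^+ j) @ \oo -->
    \sum_(j <- iota 0 N) (qpoch q q j)^-1 * q ^+ 'C(j, 2) * z ^+ j.
  apply: cvg_sum_seq => j _ _; apply: cvgMr_tmp; apply: cvgMr_tmp; exact: qbin_cvg.
have -> : euler_sum z N = \sum_(j <- iota 0 N) (qpoch q q j)^-1 * q ^+ 'C(j, 2) * z ^+ j.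
  by rewrite sum_iota_ord; apply: eq_bigr => j _; ring.
rewrite -(cvg_lim (@Rhausdorff R) h); apply: ler_lim.
- by apply/cvg_ex; eexists; exact: h.
- exact: qpochN_cvg.
exists N => // n /= Nn; rewrite q_binomial sum_iota_ord.
rewrite (big_ord_widen n.+1 (fun j => qbin q n j * q ^+ 'C(j, 2) * z ^+ j)); last exact: leqW.
rewrite [X in X <= _]big_mkcond; apply: ler_sum => j _; case: ifP => // _.
rewrite !mulr_ge0 ?exprn_ge0 // /qbin; case: ifP => // _.
by rewrite divr_ge0 ?mulr_ge0 // ltW // qpoch_gt0.
Qed.

(** A squeeze: [qbin_le] puts the finite q-binomial sum below the partial Euler sum, and
    [euler_sum_le], a limit with the number of terms fixed, puts that below the infinite product. *)
Lemma euler_cvg z : 0 <= z -> euler_sum z @ \oo --> qpinf (- z) q.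
Proof.
move=> z0; rewrite -cvg_shiftS /=.
apply: (squeeze_cvgr _ (qpochN_cvg z0) (cvg_cst (qpinf (- z) q))).
apply: nearW => n; rewrite euler_sum_le // andbT q_binomial; apply: ler_sum => j _.
rewrite -mulrA mulrC [q ^+ _ * _]mulrC; apply: ler_wpM2l; last exact: qbin_le.
by rewrite mulr_ge0 ?exprn_ge0.
Qed.
End QSeries.

(** * Quasi-periodicity of theta and the law of chi + S *)

Section ThetaShift.
Variables (R : realType) (q t : R).
Hypotheses (q_gt0 : 0 < q) (q_lt1 : q < 1) (t_gt0 : 0 < t).

Let s := Num.sqrt q.
Let s_gt0 : 0 < s. Proof. by rewrite sqrtr_gt0. Qed.
Let s_neq0 : s != 0 := lt0r_neq0 s_gt0.
Let t_neq0 : t != 0 := lt0r_neq0 t_gt0.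
Let qs : q = s * s. Proof. by rewrite -expr2 sqr_sqrtr // ltW. Qed.

(** This is theta(-u). *)
Definition theta_pair (u : R) := qpinf (- (q / u)) q * qpinf (- u) q.

Lemma theta_pair_shift u : 0 < u -> theta_pair u = u * theta_pair (u * q).
Proof.
move=> u0; have q0 := lt0r_neq0 q_gt0; have un0 := lt0r_neq0 u0; rewrite /theta_pair.
have -> : q / (u * q) = u^-1 by field; rewrite ?q0 ?un0.
rewrite (qpinfN_rec q_gt0 q_lt1 (ltW u0)).
rewrite (qpinfN_rec q_gt0 q_lt1 (x := u^-1)) ?invr_ge0 ?(ltW u0) // [u^-1 * q]mulrC.
by field.
Qed.

Let uz (m : int) := t * s * q ^ m.

Lemma uz_gt0 m : 0 < uz m. Proof. by rewrite !mulr_gt0 // exprz_gt0. Qed.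

Lemma uzE m : uz m = t * s ^ (1 + m + m).
Proof.
rewrite /uz qs expfzMl -!mulrA; congr (_ * _).
by rewrite !expfzDr // expr1z mulrA.
Qed.

(** The factors collected by m shifts multiply to t^m q^(m^2 / 2), the unnormalised weight of S. *)
Lemma theta_pair_int (m : int) : theta_pair (uz 0) = t ^ m * s ^ (m * m) * theta_pair (uz m).
Proof.
have step (k : int) : t ^ k * s ^ (k * k) * theta_pair (uz k) =
    t ^ (k + 1) * s ^ ((k + 1) * (k + 1)) * theta_pair (uz (k + 1)).
  rewrite (theta_pair_shift (uz_gt0 k)).
  have -> : uz (k + 1) = uz k * q by rewrite /uz expfzDr ?gt_eqF // expr1z mulrA.
  rewrite {1}uzE; have -> : (k + 1) * (k + 1) = k * k + (1 + k + k) by ring.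
  by rewrite !expfzDr // expr1z; ring.
have nn (n : nat) : theta_pair (uz 0) = t ^ n%:Z * s ^ (n%:Z * n%:Z) * theta_pair (uz n%:Z).
  elim: n => [|n ->]; first by rewrite mulr0 !expr0z !mul1r.
  by rewrite step -addn1 PoszD.
have np (n : nat) : theta_pair (uz 0) =
    t ^ (- n%:Z) * s ^ (- n%:Z * - n%:Z) * theta_pair (uz (- n%:Z)).
  elim: n => [|n ->]; first by rewrite oppr0 mulr0 !expr0z !mul1r.
  by rewrite [RHS]step; have -> : - n.+1%:Z + 1 = - n%:Z by lia.
by case: m => n; [exact: nn|rewrite NegzE; exact: np].
Qed.

Definition Fz (m : int) := (qpinf (- t * (s * q ^ m)) q)^-1.

Lemma FzE m : Fz m = (qpinf (- uz m) q)^-1.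
Proof. by rewrite /Fz /uz mulNr !mulrA. Qed.

Lemma qthetaE : qtheta q (- t * s) = theta_pair (uz 0).
Proof.
rewrite /qtheta /theta_pair mulrC; congr (_ * _).
  by rewrite /uz expr0z mulr1 mulNr invrN mulrN.
by rewrite /uz expr0z mulr1 mulNr.
Qed.

Lemma theta_pair_gt0 u : 0 < u -> 0 < theta_pair u.
Proof. by move=> u0; rewrite mulr_gt0 // qpinfN_gt0 ?divr_ge0 // ltW. Qed.

Let Q := qpinf q q.
Let Q_gt0 : 0 < Q := qpinf_gt0 q_gt0 q_lt1.

Lemma PSE l : PS q t l = t ^ l * s ^ (l * l) / (Q * theta_pair (uz 0)).
Proof.
rewrite /PS -/s qthetaE; congr (_ * _ / _); rewrite exprnP; congr (_ ^ _).
by rewrite -mulnn PoszM; lia.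
Qed.

Lemma PS_ge0 l : 0 <= PS q t l.
Proof.
rewrite PSE; apply: divr_ge0.
  by apply: mulr_ge0; apply: exprz_ge0; exact: ltW.
by apply: ltW; rewrite mulr_gt0 // theta_pair_gt0 // uz_gt0.
Qed.

(** The distribution function of chi in closed form, extended by 0 so that convolutions run over all
    integers. *)
Definition Cchi (j : int) : R := if 0 <= j then Q / qpoch q q (absz j) else 0.

Lemma Cchi_ge0 j : 0 <= Cchi j.
Proof.
rewrite /Cchi; case: ifP => // _.
by rewrite divr_ge0 ?(ltW Q_gt0) // ltW // qpoch_gt0 // ltW.
Qed.

(** Expanding the square (m - j)^2 turns the weight of S at m - j into the power and q^C(j,2) of an
    Euler sum at q / [uz m]. *)
Lemma gauss_shift (m : int) (j : nat) :
  t ^ (m - j%:Z) * s ^ ((m - j%:Z) * (m - j%:Z)) =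
  t ^ m * s ^ (m * m) * ((q / uz m) ^+ j * q ^+ 'C(j, 2)).
Proof.
elim: j => [|j IH]; first by rewrite subr0 !expr0 !mulr1.
rewrite binS bin1 exprS exprD.
transitivity (t ^ m * s ^ (m * m) * ((q / uz m) ^+ j * q ^+ 'C(j, 2)) * (q / uz m * q ^+ j)).
  rewrite -IH; have -> : q / uz m * q ^+ j = t^-1 * s ^ (1 - (m - j%:Z) - (m - j%:Z)).
    have e (x : int) : q ^ x = s ^ (x + x) by rewrite qs expfzMl expfzDr.
    apply: (mulIf (lt0r_neq0 (uz_gt0 m))); rewrite mulrAC mulfVK ?lt0r_neq0 ?uz_gt0 //.
    rewrite exprnP -exprSz e uzE mulrACA mulVf // mul1r -expfzDr //.
    by congr (_ ^ _); lia.
  have -> : (m - j.+1%:Z) * (m - j.+1%:Z) =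
    (m - j%:Z) * (m - j%:Z) + (1 - (m - j%:Z) - (m - j%:Z)) by lia.
  have -> : m - j.+1%:Z = m - j%:Z + -1 by lia.
  by rewrite !expfzDr // exprN1; ring.
by ring.
Qed.

Lemma sum_PS_Cchi_cvg (m : int) :
  (fun N => \sum_(j < N) PS q t (m - j%:Z) * Cchi j%:Z) @ \oo --> Fz m.
Proof.
have G0 := lt0r_neq0 (theta_pair_gt0 (uz_gt0 0)); have Q0 := lt0r_neq0 Q_gt0.
have u0 := uz_gt0 m; pose c := t ^ m * s ^ (m * m) / theta_pair (uz 0).
have e N : \sum_(j < N) PS q t (m - j%:Z) * Cchi j%:Z = c * euler_sum q (q / uz m) N.
  rewrite mulr_sumr; apply: eq_bigr => j _; rewrite PSE gauss_shift /Cchi /=.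
  have := lt0r_neq0 (qpoch_gt0 j (ltW q_gt0) q_lt1).
  by rewrite /c => d0; field; rewrite Q0 G0 d0.
under eq_fun do rewrite e.
(* Euler's sum is one factor of theta at [uz m]; quasi-periodicity cancels it against the
   normalisation of S and leaves the reciprocal of the other factor. *)
have -> : Fz m = c * qpinf (- (q / uz m)) q.
  rewrite FzE /c (theta_pair_int m) /theta_pair.
  have h1 : 0 < qpinf (- (q / uz m)) q by rewrite qpinfN_gt0 // divr_ge0 // ltW.
  have h2 : 0 < qpinf (- uz m) q by rewrite qpinfN_gt0 // ltW.
  have h3 : t ^ m != 0 by rewrite expfz_neq0.
  have h4 : s ^ (m * m) != 0 by rewrite expfz_neq0.
  by field; rewrite h3 h4 !lt0r_neq0.
by apply: cvgMl_tmp; apply: euler_cvg => //; rewrite divr_ge0 // ltW.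
Qed.

End ThetaShift.

(** * Convolution with chi and S *)

Section WeightedSums.
Variable R : realType.

Lemma esum_scale (I : choiceType) (S : set I) (f : I -> R) (c v : R) : 0 <= c ->
  (forall i, S i -> 0 <= f i) -> (\esum_(i in S) (f i)%:E = v%:E)%E ->
  (\esum_(i in S) (c * f i)%:E = (c * v)%:E)%E.
Proof.
move=> c0 f0 fv.
have fsumM d X : finite_set X ->
    (\sum_(i \in X) (d * f i)%:E = d%:E * \sum_(i \in X) (f i)%:E)%E.
  by move=> fX; rewrite !fsbig_finite // !sumEFin -EFinM mulr_sumr.
have le_v X : finite_set X -> X `<=` S -> (\sum_(i \in X) (f i)%:E <= v%:E)%E.
  by move=> fX XS; rewrite -fv; apply: ereal_sup_ubound; exists X.
have [->|cn0] := eqVneq c 0.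
  by rewrite mul0r esum1 // => i _; rewrite mul0r.
have cgt0 : 0 < c by rewrite lt_neqAle eq_sym cn0.
apply/eqP; rewrite eq_le; apply/andP; split.
  apply: ge_ereal_sup => _ [X [fX XS] <-]; rewrite fsumM // EFinM.
  by apply: lee_wpmul2l; [rewrite lee_fin|exact: le_v].
rewrite EFinM -fv muleC -lee_pdivlMr //.
apply: ge_ereal_sup => _ [X [fX XS] <-]; rewrite lee_pdivlMr // muleC -fsumM //.
by apply: ereal_sup_ubound; exists X.
Qed.

Lemma esum_nat_cvg (f : nat -> R) (l : R) : (forall j, 0 <= f j) ->
  (fun N => \sum_(j < N) f j) @ \oo --> l -> (\esum_(j in setT) (f j)%:E = l%:E)%E.
Proof.
move=> f0 fl; rewrite -nneseries_esumT; last by move=> j; rewrite lee_fin.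
have -> : (fun n => \sum_(0 <= k < n) (f k)%:E)%E = EFin \o (fun N => \sum_(j < N) f j).
  by apply/funext => N /=; rewrite sumEFin big_mkord.
rewrite EFin_lim; last by apply/cvg_ex; exists l.
by congr (_%:E); exact: (cvg_lim (@Rhausdorff R) fl).
Qed.
End WeightedSums.

(** * Statement (b): both sides as one convolution *)

Section PartB.
Variables (R : realType) (q t : R) (a b : seq R).
Hypotheses (q_gt0 : 0 < q) (q_lt1 : q < 1) (t_gt0 : 0 < t).
Hypotheses (a_gt0 : forall x, x \in a -> 0 < x) (b_gt0 : forall y, y \in b -> 0 < y).
Hypothesis ab_lt1 : forall x y, x \in a -> y \in b -> x * y < 1.

Let A := cauchy_prod q a b.
Let Q := qpinf q q.
Let H n := A * Q * Zn q (rev a) (rev b) n.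

(* The distribution function of lam_1, extended by 0 to negative integers. *)
Definition Hz (N : int) : R := if 0 <= N then H (absz N) else 0.

Let MqW0 mu : 0 <= MqW q a b mu. Proof. exact: MqW_ge0. Qed.
Let MpS0 mu : 0 <= MpS q a b mu. Proof. exact: MpS_ge0. Qed.
Let PS0 l : 0 <= PS q t l. Proof. exact: PS_ge0. Qed.
Let C0 j : 0 <= Cchi q j. Proof. exact: Cchi_ge0. Qed.

Lemma esum_PS_Cchi m :
  (\esum_(l in [set: int]) (PS q t l * Cchi q (m - l))%:E = (Fz q t m)%:E)%E.
Proof.
rewrite (esumID [set l : int | l <= m]); last by move=> l _; rewrite lee_fin mulr_ge0.
rewrite [X in (_ + X)%E]esum1 ?adde0; last first.
  move=> l [_ /negP]; rewrite -ltNge => lm; rewrite /Cchi.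
  by rewrite ifF ?mulr0 //; apply/negbTE; lia.
rewrite setTI (@reindex_esum _ _ _ [set: nat] _ (fun j : nat => m - j%:Z)); last first.
  split.
  - by move=> j _ /=; lia.
  - by move=> i j _ _ /= e; lia.
  - by move=> l /= lm; exists (absz (m - l)) => //=; lia.
apply: esum_nat_cvg; first by move=> j; rewrite mulr_ge0.
rewrite (_ : (fun N => _) = fun N => \sum_(j < N) PS q t (m - j%:Z) * Cchi q j%:Z).
  exact: sum_PS_Cchi_cvg.
apply/funext => N; apply: eq_bigr => j _; congr (_ * Cchi q _); lia.
Qed.

Lemma esum_MqW_Cchi (N : int) :
  (\esum_(mu in [set mu | is_part mu]) (MqW q a b mu * Cchi q (N - (head 0%N mu)%:Z))%:E
   = (Hz N)%:E)%E.
Proof.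
pose r := [seq mu <- box_seqs (size a) (absz N) | is_part mu & (head 0%N mu)%:Z <= N].
rewrite (esum_uniq_seq (r := r)).
- congr (_%:E); rewrite big_filter /Hz; case: (leP 0 N) => N0; last first.
    by rewrite big1 // => mu /andP[_ hm]; exfalso; lia.
  rewrite /H /Zn size_rev mulr_sumr big_seq_cond [RHS]big_seq_cond.
  apply: eq_big => [mu|mu /andP[_ /andP[pm hm]]].
    case: (boolP (is_part mu)) => pm; rewrite ?andbF //= part_in_box //.
    by case: leqP => //= _; lia.
  rewrite /Cchi ifT; last by lia.
  rewrite MqWE /bnorm -/A -/Q.
  have -> : absz (N - (head 0%N mu)%:Z)%R = (absz N - head 0 mu)%N by lia.
  by rewrite invfM; ring.
- by rewrite filter_uniq // box_seqs_uniq.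
- by move=> mu; rewrite mem_filter => /andP[/andP[]].
- by move=> mu _; rewrite mulr_ge0.
move=> mu /= pm; rewrite mem_filter pm /= part_in_box //.
have [hm|hm _] := leP (head 0%N mu)%:Z N; last first.
  by rewrite /Cchi ifF ?mulr0 //; apply/negbTE; lia.
have -> : (head 0 mu <= absz N)%N by lia.
by rewrite andbT /= -ltnNge => sm; rewrite MqW_eq0 // mul0r.
Qed.

(** Writing the expectation's weight as a sum over the values l of S and exchanging sums leaves, for
    each l, the probability that mu_1 + chi <= n - l. *)
Lemma expB_qWE n : expB_qW q t a b n =
  (\esum_(l in [set: int]) (PS q t l * Hz (n%:Z - l))%:E)%E.
Proof.
transitivity (\esum_(mu in [set mu | is_part mu]) \esum_(l in [set: int])
    (MqW q a b mu * (PS q t l * Cchi q (n%:Z - (head 0%N mu)%:Z - l)))%:E)%E.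
  apply: eq_esum => mu pm; symmetry; apply: esum_scale => //.
    by move=> l _; rewrite mulr_ge0.
  exact: esum_PS_Cchi.
rewrite esum_exchange; last first.
  by move=> mu l _ _; rewrite lee_fin; apply: mulr_ge0 => //; apply: mulr_ge0.
apply: eq_esum => l _.
have f0 mu : is_part mu -> 0 <= MqW q a b mu * Cchi q (n%:Z - l - (head 0%N mu)%:Z).
  by move=> _; rewrite mulr_ge0.
rewrite -(esum_scale (PS0 l) f0 (esum_MqW_Cchi (n%:Z - l))).
by apply: eq_esum => mu _; rewrite mulrCA; congr (_ * (_ * Cchi q _))%:E; lia.
Qed.

(** For a fixed value l of S the event is lam_1 <= n - l, empty when n < l and otherwise given by
    [probA_pSE]. *)
Lemma probB_pSE n : probB_pS q t a b n =
  (\esum_(l in [set: int]) (PS q t l * Hz (n%:Z - l))%:E)%E.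
Proof.
pose J (l : int) := [set lam | is_part lam && ((head 0%N lam)%:Z + l <= n%:Z)].
transitivity (\esum_(l in [set: int]) \esum_(lam in J l) (PS q t l * MpS q a b lam)%:E)%E.
  rewrite esum_esum; last by move=> l lam _ _; rewrite lee_fin mulr_ge0.
  rewrite /probB_pS (@reindex_esum _ _ _ ([set: int] `*`` J) _ (fun p => (p.2, p.1))).
    by apply: eq_esum => -[l lam] _ /=; rewrite mulrC.
  split.
  - by move=> [l lam] [_].
  - by move=> [l lam] [l' lam'] _ _ [-> ->].
  - by move=> [lam l] h; exists (l, lam).
apply: eq_esum => l _; rewrite /Hz; case: (leP 0 (n%:Z - l)) => nl; last first.
  by rewrite mulr0 esum1 // => lam /andP[_ h]; exfalso; lia.
apply: esum_scale => //.
have -> : J l = parts (absz (n%:Z - l)).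
  apply/seteqP; split => lam /=; rewrite /J /parts /= => /andP[-> h] /=; lia.
exact: probA_pSE.
Qed.

Lemma expB_eq n : expB_qW q t a b n = probB_pS q t a b n.
Proof. by rewrite expB_qWE probB_pSE. Qed.
End PartB.

Theorem theorem1p3 (R : realType) (q t : R) (a b : seq R) :
  0 < q -> q < 1 -> 0 < t ->
  (forall x, x \in a -> 0 < x) -> (forall y, y \in b -> 0 < y) ->
  (forall x y, x \in a -> y \in b -> x * y < 1) ->
  (forall n : nat, probA_qW q a b n = probA_pS q a b n) /\
  (forall n : nat, expB_qW q t a b n = probB_pS q t a b n) /\
  ((forall n : nat, probA_qW q a b n = probA_pS q a b n) <->
   (forall n : nat, expB_qW q t a b n = probB_pS q t a b n)).
Proof.
move=> q0 q1 t0 a0 b0 ab.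
have HA n : probA_qW q a b n = probA_pS q a b n by exact: probA_eq.
have HB n : expB_qW q t a b n = probB_pS q t a b n by exact: expB_eq.
(* Each direction of the equivalence has an already proved conclusion; the substantive link between
   (a) and (b) is the common function [Hz]. *)
by split; [exact: HA|split; [exact: HB|split]].
Qed.
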